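(* Let $n\geq 2$ be an integer and let $\mathrm{Q}_{4n}=\langle a,b\mid a^{2n}=1,\ b^2=a^n,\ b^{-1}ab=a^{-1}\rangle$ be the generalized quaternion group of order $4n$. Let $m\in\{2,3\}$. Then the following four conditions are equivalent: (1) $\mathrm{Q}_{4n}$ is an $m$-BCI-group; (2) $\mathrm{Q}_{4n}$ is an $m$-DCI-group; (3) $\mathrm{Q}_{4n}$ is an $m$-CI-group; (4) $n$ is odd or $n=2$.
   Context: All groups, graphs and digraphs are finite. $S^\alpha$ denotes the image of a subset $S$ of a group $G$ under $\alpha\in\mathrm{Aut}(G)$, and $gS^\alpha=\{gs^\alpha\mid s\in S\}$. Bi-Cayley graphs: for a group $G$ and a subset $S\subseteq G$ (possibly containing the identity), $\mathrm{BCay}(G,S)$ is the (undirected) graph with vertex set $G\times\{0,1\}$ and edge set $\{\{(x,0),(sx,1)\}\mid x\in G,\ s\in S\}$; it is regular of valency $|S|$. It is a BCI-graph if for every $T\subseteq G$, $\mathrm{BCay}(G,S)\cong\mathrm{BCay}(G,T)$ implies that $T=gS^\alpha$ for some $g\in G$ and $\alpha\in\mathrm{Aut}(G)$. For a positive integer $m$, $G$ is an $m$-BCI-group if every bi-Cayley graph of $G$ of valency at most $m$ is a BCI-graph. Cayley digraphs: for a group $G$ and a subset $S\subseteq G$ with $1\notin S$, $\mathrm{Cay}(G,S)$ is the digraph with vertex set $G$ and arc set $\{(g,sg)\mid g\in G,\ s\in S\}$; it has valency $|S|$ (every vertex has in-valency and out-valency $|S|$). If $S=S^{-1}$ it is regarded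 as an undirected graph, called a Cayley graph. $\mathrm{Cay}(G,S)$ is a CI-digraph if for every $T\subseteq G$ with $1\notin T$, $\mathrm{Cay}(G,S)\cong\mathrm{Cay}(G,T)$ implies that $S^\sigma=T$ for some $\sigma\in\mathrm{Aut}(G)$; when $\mathrm{Cay}(G,S)$ is a Cayley graph (i.e. $S=S^{-1}$) satisfying this property it is called a CI-graph. For a positive integer $m$, $G$ is an $m$-DCI-group if every Cayley digraph of $G$ of valency at most $m$ is a CI-digraph, and an $m$-CI-group if every Cayley graph of $G$ of valency at most $m$ is a CI-graph. *)

(* Defs.v *)
From mathcomp Require Import all_boot all_fingroup.

Set Implicit Arguments.
Unset Strict Implicit.
Unset Printing Implicit Defensive.

Import GroupScope.

(* A digraph on a finite vertex type is its arc relation; an undirected graph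
   is a symmetric relation. *)
Definition graph_iso (V W : finType) (e : rel V) (f : rel W) : Prop :=
  exists h : V -> W, bijective h /\ forall x y, f (h x) (h y) = e x y.

(* Throughout, the ambient finite group is the whole type gT; automorphisms are
   the elements of Aut [set: gT], acting on subsets by direct image. *)
Section CayleyGraphs.

Variable gT : finGroupType.
Implicit Types S T : {set gT}.

(* The second component of a vertex: false stands for 0 and true for 1. *)
Definition bcay_edges S : {set {set gT * bool}} :=
  [set [set (x, false); (s * x, true)] | x in [set: gT], s in S].

Definition bcay S : rel (gT * bool) :=
  fun u v => [set u; v] \in bcay_edges S.

Definition bci_graph S : Prop :=
  forall T, graph_iso (bcay S) (bcay T) ->
    exists (g : gT) (alpha : {perm gT}),
      alpha \in Aut [set: gT] /\ T = g *: (alpha @: S).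

Definition cay S : rel gT :=
  fun g h => [exists s in S, h == s * g].

Definition ci_digraph S : Prop :=
  forall T, 1 \notin T -> graph_iso (cay S) (cay T) ->
    exists sigma : {perm gT}, sigma \in Aut [set: gT] /\ sigma @: S = T.

End CayleyGraphs.

(* In the next three definitions #|S| is the valency of the graph given by S. *)
Definition BCI_group (m : nat) (gT : finGroupType) : Prop :=
  forall S : {set gT}, #|S| <= m -> bci_graph S.

Definition DCI_group (m : nat) (gT : finGroupType) : Prop :=
  forall S : {set gT}, 1 \notin S -> #|S| <= m -> ci_digraph S.

(* S^-1 is the set of inverses, so S = S^-1 selects the undirected graphs. *)
Definition CI_group (m : nat) (gT : finGroupType) : Prop :=
  forall S : {set gT}, 1 \notin S -> S = S^-1 -> #|S| <= m -> ci_digraph S.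

(* Grp (...) is the finitely presented group, characterized by its finite
   homomorphic images. The library's 'Q_(4 * n) is not used because it is
   meaningful only for n a power of 2 (for odd n its order is not 4 * n).
   Recall that a ^ b is the conjugate b^-1 * a * b. *)
Definition is_quaternion (n : nat) (gT : finGroupType) : Prop :=
  [set: gT] \isog
    Grp (a : b : a ^+ (2 * n) = 1, b ^+ 2 = a ^+ n, a ^ b = a^-1).

(* Main.v *)
Require Import Defs.
From HB Require Import structures.
From mathcomp Require Import all_boot all_order all_algebra all_fingroup.
From mathcomp Require Import cyclic zify ring.

Set Implicit Arguments.
Unset Strict Implicit.
Unset Printing Implicit Defensive.

Import GroupScope.

(* Write [E i = a^i] and [F i = a^i b] with exponents in Z/2n, and [nu = n], so that [E nu] is
   the central involution.

   If n > 2 is even, [E (n/2)] and [F 0] both have order 4 but are not conjugate under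
   automorphisms, while {x, x^-1} (resp. {1, x}) gives isomorphic Cayley (resp. bi-Cayley)
   graphs for all x of the same order.

   Let n be odd. Up to left translation, a set of three elements lies in <a>, or is
   {1, E x, F j}. Colour an edge of a bi-Cayley graph by the element of S it comes from: the
   number of closed walks of a given length starting along an edge depends only on its colour,
   and these numbers (found by evaluating words in S) show that an isomorphism respects enough
   of the colouring to force an isomorphism of cyclic groups matching the two sets; such
   isomorphisms extend to automorphisms of Q_4n.
   An isomorphism of Cayley digraphs lifts to the bi-Cayley graphs, so only the pairs S, gS remain;
   there the 2-cycles, the orders of the generated subgroups and closed walks mixing forward and
   backward steps give an automorphism again.

   For n = 2 the graphs are told apart by closed walks of length 4 (resp. 2), which is checked by
   computation. *)

(** * Graph isomorphisms and closed walks *)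

(** The obstacle is that an isomorphism need not respect the colours. Where it does, it intertwines
    translations by powers of a, so the exponents on both sides satisfy the same integral relations;
    in Z/2n this yields one unit k carrying one family of exponents to the other, and a -> a^k
    extends to the whole group. The work lies in the sets whose colours the counts do not separate:
    those whose exponents satisfy a short relation such as 2x = y + z, or whose x has order 2 or 6.
    There cruder invariants, such as the order of the generated subgroup, take over. The counts are
    uniform in n because words of bounded length involve only bounded multiples of the exponents, so
    only finitely many relations between exponents have to be told apart. Oddness of n enters
    through the absence of elements of order 4 in <a>: 4x = 0 implies 2x = 0, the double of x is
    never [nu], and orders of elements separate <a> from its complement. *)

Section Walks.

Variables (V W : finType) (e : rel V) (f : rel W) (h : V -> W).
Hypotheses (h_bij : bijective h) (h_iso : forall x y, f (h x) (h y) = e x y).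

Lemma connect_homo x y : connect e x y -> connect f (h x) (h y).
Proof.
case/connectP=> p; elim: p x => [|z p IHp] x /=; first by move=> _ ->.
case/andP=> exz pz ly; apply: connect_trans (IHp z pz ly).
by apply: connect1; rewrite h_iso.
Qed.

End Walks.

Lemma graph_iso_inv (V W : finType) (e : rel V) (f : rel W) h :
    bijective h -> (forall x y, f (h x) (h y) = e x y) ->
  exists2 k, cancel h k /\ cancel k h & forall x y, e (k x) (k y) = f x y.
Proof.
by case=> k hK kK h_iso; exists k => // x y; rewrite -h_iso !kK.
Qed.

Lemma graph_iso_sym (V W : finType) (e : rel V) (f : rel W) :
  graph_iso e f -> graph_iso f e.
Proof.
case=> h [h_bij h_iso]; have [k [hK kK] k_iso] := graph_iso_inv h_bij h_iso.
by exists k; split=> //; exists h.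
Qed.

Lemma graph_iso_trans (U V W : finType) (d : rel U) (e : rel V) (f : rel W) :
  graph_iso d e -> graph_iso e f -> graph_iso d f.
Proof.
case=> h [h_bij h_iso] [k [k_bij k_iso]]; exists (k \o h); split.
  exact: bij_comp.
by move=> x y /=; rewrite k_iso h_iso.
Qed.

Lemma card_connect_iso (V W : finType) (e : rel V) (f : rel W) h x :
    bijective h -> (forall x y, f (h x) (h y) = e x y) ->
  #|connect f (h x)| = #|connect e x|.
Proof.
move=> h_bij h_iso; have [k [hK kK] k_iso] := graph_iso_inv h_bij h_iso.
rewrite -(card_image (bij_inj h_bij)); apply: eq_card => y.
apply/idP/imageP=> [xy | [z xz ->]]; last exact: (connect_homo h_iso).
exists (k y) => //; rewrite -topredE /= -[x]hK; exact: (connect_homo k_iso).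
Qed.

(** In [ds], [true] is a step along an arc and [false] a step against it; mixed directions serve the
    digraphs with x of order 6. *)
Fixpoint walks (V : finType) (e : rel V) (ds : bitseq) (x y : V) : nat :=
  if ds is d :: ds' then
    \sum_(z | if d then e x z else e z x) walks e ds' z y
  else x == y.

Lemma walks_iso (V W : finType) (e : rel V) (f : rel W) h ds x y :
    bijective h -> (forall x y, f (h x) (h y) = e x y) ->
  walks f ds (h x) (h y) = walks e ds x y.
Proof.
move=> h_bij h_iso; elim: ds x => [|d ds IHds] x /=.
  by rewrite (inj_eq (bij_inj h_bij)).
rewrite (reindex h) /=; last exact: onW_bij.
by apply: eq_big => [z | z _]; rewrite ?h_iso.
Qed.

(* The end points, with multiplicity, of the walks in a graph given by explicit lists of
   neighbours: walks are then counted by evaluation. *)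
Fixpoint formal_ends (A : Type) (step : bool -> A -> seq A) (ds : bitseq) a :=
  if ds is d :: ds' then
    flatten [seq formal_ends step ds' c | c <- step d a]
  else [:: a].

(** [phi] need not be injective: as soon as every list of formal neighbours maps bijectively onto an
    actual neighbourhood, formal and actual walks from a given start correspond one to one. *)
Lemma walks_formal (V : finType) (e : rel V) (A : Type)
    (step : bool -> A -> seq A) (phi : A -> V) ds a y :
    (forall d a, uniq (map phi (step d a))) ->
    (forall d a y, (y \in map phi (step d a)) =
                   if d then e (phi a) y else e y (phi a)) ->
  walks e ds (phi a) y =
    count (fun c => phi c == y) (formal_ends step ds a).
Proof.
move=> step_uniq stepE; elim: ds a => [|d ds IHds] a /=; first by rewrite addn0.
under eq_bigl => z do rewrite -stepE.
rewrite -big_uniq //= big_map count_flatten -map_comp sumnE big_map.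
by apply: eq_bigr => c _; rewrite IHds.
Qed.

Section Cayley.

Variable gT : finGroupType.
Implicit Types (g x y s t : gT) (S T : {set gT}) (u v : gT * bool).

(** The other end of the edge coloured s at u. As [nb s] is an involution, the colours form a proper
    edge colouring of the bi-Cayley graph. *)
Definition nb s u : gT * bool :=
  if u.2 then (s^-1 * u.1, false) else (s * u.1, true).

Lemma nbK s : involutive (nb s).
Proof. by case=> x [] /=; rewrite /nb /= ?mulKg ?mulKVg. Qed.

Lemma nb_inj u : injective (fun s => nb s u).
Proof. by case: u => x [] s t [] /mulIg // /invg_inj. Qed.

Lemma cayE S x y : cay S x y = (y * x^-1 \in S).
Proof.
apply/exists_inP/idP=> [[s sS /eqP->] | yxS]; first by rewrite mulgK.
by exists (y * x^-1); rewrite ?mulgKV.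
Qed.

Lemma cayP S x y : reflect (exists2 s, s \in S & y = s * x) (cay S x y).
Proof.
apply: (iffP exists_inP) => [[s sS /eqP->] | [s sS ->]]; exists s => //.
Qed.

Lemma bcayP S u v : reflect (exists2 s, s \in S & v = nb s u) (bcay S u v).
Proof.
apply: (iffP imset2P) => [[x s _ sS] | [s sS ->]].
  move=> uv; exists s => //.
  have uP : u \in [set (x, false); (s * x, true)] by rewrite -uv set21.
  have vP : v \in [set (x, false); (s * x, true)] by rewrite -uv set22.
  have: (x, false) \in [set u; v] by rewrite uv set21.
  have: (s * x, true) \in [set u; v] by rewrite uv set22.
  case/set2P: uP => ->; case/set2P: vP => ->; rewrite /nb /= ?mulKg // => h1 h2.
    by case/set2P: h1.
  by case/set2P: h2.
case: u => x []; rewrite /nb /=.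
  exists (s^-1 * x) s; rewrite ?inE // ?mulKVg.
  by rewrite setUC.
by exists x s; rewrite ?inE.
Qed.

Lemma bcay_sym S u v : bcay S u v = bcay S v u.
Proof. by rewrite /bcay setUC. Qed.

Lemma bcay_iso_nb S T (h : gT * bool -> gT * bool) : (forall u v, bcay T (h u) (h v) = bcay S u v) ->
  forall s u, s \in S -> exists2 t, t \in T & h (nb s u) = nb t (h u).
Proof.
move=> h_iso s u sS; apply/bcayP; rewrite h_iso; apply/bcayP.
by exists s.
Qed.

Lemma cay_iso_mul S T (h : gT -> gT) : (forall x y, cay T (h x) (h y) = cay S x y) ->
  forall s x, s \in S -> exists2 t, t \in T & h (s * x) = t * h x.
Proof.
move=> h_iso s u sS; apply/cayP; rewrite h_iso; apply/cayP.
by exists s.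
Qed.

Lemma bcay_iso_card S T : graph_iso (bcay S) (bcay T) -> #|S| = #|T|.
Proof.
have deg U u : #|bcay U u| = #|U|.
  rewrite -(card_imset U (@nb_inj u)); apply: eq_card => v.
  by rewrite -topredE /=; apply/bcayP/imsetP.
case=> h [h_bij h_iso]; rewrite -(deg S (1, false)) -(deg T (h (1, false))).
rewrite -(card_image (bij_inj h_bij)); apply: eq_card => u.
case: (h_bij) => k hK kK.
apply/imageP/idP=> [[v ev ->] | eu]; first by rewrite -topredE /= h_iso.
by exists (k u); rewrite ?kK // -topredE /= -h_iso kK.
Qed.

(** The bi-Cayley graph is the bipartite double cover of the Cayley digraph, so h acts on both
    halves at once. *)
Lemma cay_iso_lift S T (h : gT -> gT) : bijective h ->
    (forall x y, cay T (h x) (h y) = cay S x y) ->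
  bijective (fun u : gT * bool => (h u.1, u.2)) /\
  forall u v, bcay T (h u.1, u.2) (h v.1, v.2) = bcay S u v.
Proof.
case=> k hK kK h_iso.
have key (S' T' : {set gT}) (h' : gT -> gT) :
    (forall x y, cay T' (h' x) (h' y) = cay S' x y) ->
  forall u v, bcay S' u v -> bcay T' (h' u.1, u.2) (h' v.1, v.2).
  move=> iso' u v /bcayP[s sS ->]; apply/bcayP; case: u => x [] /=.
    have [t tT xt] := cay_iso_mul iso' (s^-1 * x) sS.
    by exists t => //; rewrite /nb /=; move: xt; rewrite mulKVg => ->; rewrite mulKg.
  by have [t tT xt] := cay_iso_mul iso' x sS; exists t => //; rewrite /nb /= xt.
split; first by exists (fun u => (k u.1, u.2)); case=> x i /=; rewrite ?hK ?kK.
move=> u v; apply/idP/idP; last exact: key.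
have k_iso x y : cay S (k x) (k y) = cay T x y by rewrite -h_iso !kK.
by move/(key _ _ _ k_iso); rewrite /= !hK; case: u v => ? ? [].
Qed.

Lemma cay_bcay_iso S T : graph_iso (cay S) (cay T) -> graph_iso (bcay S) (bcay T).
Proof.
case=> h [h_bij h_iso]; have [b i] := cay_iso_lift h_bij h_iso.
by exists (fun u => (h u.1, u.2)).
Qed.

Lemma cay_iso_card S T : graph_iso (cay S) (cay T) -> #|S| = #|T|.
Proof. by move/cay_bcay_iso/bcay_iso_card. Qed.

(** The left multipliers that preserve X are closed under products, hence by finiteness form a
    subgroup, and this subgroup contains S. In particular directed reachability already reaches a
    whole coset of the generated subgroup. *)
Lemma gen_sub_closed S (X : {set gT}) :
  1 \in X -> (forall s x, s \in S -> x \in X -> s * x \in X) -> <<S>> \subset X.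
Proof.
move=> X1 SX.
pose Y := [set y | [forall x in X, y * x \in X]].
have YP y : reflect (forall x, x \in X -> y * x \in X) (y \in Y).
  by rewrite inE; apply: (iffP forall_inP).
have Y_group : group_set Y.
  apply/group_setP; split; first by apply/YP=> x; rewrite mul1g.
  by move=> y z /YP yY /YP zY; apply/YP=> x xX; rewrite -mulgA; apply/yY/zY.
have: <<S>> \subset Group Y_group.
  by rewrite gen_subG; apply/subsetP=> s sS; apply/YP=> x; apply: SX.
move/subsetP=> sub; apply/subsetP=> y /sub /YP/(_ 1 X1).
by rewrite mulg1.
Qed.

Lemma card_connect_cay S x : #|connect (cay S) x| = #|<<S>>|.
Proof.
rewrite -(card_rcoset <<S>>%G x); apply: eq_card => y; apply/idP/idP.
  case/connectP=> p; elim/last_ind: p y => [|p z IHp] y /=.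
    by move=> _ ->; rewrite rcoset_refl.
  rewrite rcons_path last_rcons => /andP[pp /cayP[s sS ez]] ->.
  rewrite mem_rcoset ez -mulgA; apply: groupM; first exact: mem_gen.
  by rewrite -mem_rcoset IHp.
rewrite mem_rcoset => yx.
suff /subsetP/(_ _ yx): <<S>> \subset [set y | connect (cay S) x (y * x)].
  by rewrite inE mulgKV.
apply: gen_sub_closed => [|s z sS]; rewrite !inE ?mul1g ?connect0 // => xz.
apply: connect_trans xz (connect1 _); apply/cayP.
by exists s; rewrite ?mulgA.
Qed.

Lemma cay_iso_gen S T : graph_iso (cay S) (cay T) -> #|<<S>>| = #|<<T>>|.
Proof.
case=> h [h_bij h_iso]; rewrite -(card_connect_cay S 1).
by rewrite -(card_connect_iso 1 h_bij h_iso) card_connect_cay.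
Qed.

(** The colour 1 changes sides without moving the group element, so a component is a full coset on
    both sides. Without 1 in S the component would be governed by the quotients of elements of S
    instead. *)
Lemma card_connect_bcay S u : 1 \in S -> #|connect (bcay S) u| = (#|<<S>>| * 2)%N.
Proof.
move=> S1; case: u => x i.
rewrite -(card_rcoset <<S>>%G x) -card_bool -cardX.
apply: eq_card => v; apply/idP/idP.
  case/connectP=> p; elim/last_ind: p v => [|p w IHp] v /=.
    by move=> _ ->; rewrite !inE rcoset_refl.
  rewrite rcons_path last_rcons => /andP[pp /bcayP[s sS ez]] ->.
  have := IHp _ pp erefl; rewrite ez; case: (last _ _) => y j /=.
  rewrite !inE !andbT !mem_rcoset /nb /= => yx.
  by case: j; rewrite /= -mulgA groupM // ?groupV mem_gen.
case: v => y j; rewrite !inE andbT mem_rcoset => yx.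
have sw z j1 j2 : connect (bcay S) (z, j1) (z, j2).
  have c1 j3 : bcay S (z, j3) (z, ~~ j3).
    by apply/bcayP; exists 1 => //; rewrite /nb; case: (j3); rewrite /= ?invg1 mul1g.
  have [<- | ] := eqVneq j1 j2; first exact: connect0.
  by move=> j12; rewrite (_ : j2 = ~~ j1) ?connect1 //; case: (j1) (j2) j12 => [] [].
suff /subsetP/(_ _ yx): <<S>> \subset [set y | connect (bcay S) (x, i) (y * x, j)].
  by rewrite inE mulgKV.
apply: gen_sub_closed => [|s z sS]; rewrite !inE ?mul1g // => xz.
apply: connect_trans xz _; apply: connect_trans (sw _ j false) _.
apply: connect_trans (sw _ true j); apply: connect1; apply/bcayP.
by exists s; rewrite /nb /= ?mulgA.
Qed.

Lemma bcay_iso_gen S T : 1 \in S -> 1 \in T ->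
  graph_iso (bcay S) (bcay T) -> #|<<S>>| = #|<<T>>|.
Proof.
move=> S1 T1 [h [h_bij h_iso]]; apply/eqP; rewrite -(eqn_pmul2r (ltn0Sn 1)).
rewrite -(card_connect_bcay (1, false) S1).
by rewrite -(card_connect_iso _ h_bij h_iso) card_connect_bcay.
Qed.

Definition bequiv S T := exists (g : gT) (alpha : {perm gT}),
  alpha \in Aut [set: gT] /\ T = g *: (alpha @: S).

Lemma perm_Aut (f : gT -> gT) (f_inj : injective f) :
  {morph f : x y / x * y} -> perm f_inj \in Aut [set: gT].
Proof.
move=> fM; rewrite inE; apply/andP; split.
  by apply/subsetP=> x _; rewrite inE.
by apply/morphicP=> x y _ _; rewrite !permE fM.
Qed.

Lemma aut_mul (alpha : {perm gT}) : alpha \in Aut [set: gT] -> {morph alpha : x y / x * y}.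
Proof. by move/Aut_morphic/morphicP=> aM x y; apply: aM; rewrite inE. Qed.

Lemma bequiv_refl S : bequiv S S.
Proof.
exists 1, 1; split; first exact: group1.
rewrite -[LHS]mul1g; congr (_ * _).
by rewrite -[LHS]imset_id; apply: eq_imset => x; rewrite perm1.
Qed.

Lemma lcosetE' g S : g *: S = [set g * x | x in S].
Proof. by rewrite -lcosetE. Qed.

Lemma aut_one (alpha : {perm gT}) : alpha \in Aut [set: gT] -> alpha 1 = 1.
Proof. by move=> aA; apply: (mulgI (alpha 1)); rewrite -aut_mul // !mulg1. Qed.

Lemma bequiv_sym S T : bequiv S T -> bequiv T S.
Proof.
case=> g [alpha [aA ->]].
have a'A : (alpha^-1)%g \in Aut [set: gT] by rewrite groupV.
exists ((alpha^-1)%g g^-1), (alpha^-1)%g; split=> //.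
rewrite !lcosetE' -!imset_comp -[LHS]imset_id; apply: eq_imset => x /=.
by rewrite (aut_mul a'A) mulgA -(aut_mul a'A) mulVg (aut_one a'A) mul1g permK.
Qed.

Lemma bequiv_trans S T U : bequiv S T -> bequiv T U -> bequiv S U.
Proof.
case=> g [alpha [aA ->]] [k [beta [bA ->]]].
exists (k * beta g), (alpha * beta)%g; split; first exact: groupM.
rewrite !lcosetE' -!imset_comp; apply: eq_imset => x /=.
by rewrite permM (aut_mul bA) mulgA.
Qed.

Lemma bequiv_lcoset g S : bequiv S [set g * x | x in S].
Proof.
have [k [alpha [aA eS]]] := bequiv_refl S.
exists g, 1; split; first exact: group1.
rewrite lcosetE' -imset_comp; apply: eq_imset => x /=.
by rewrite perm1.
Qed.

Lemma bequiv_aut (alpha : {perm gT}) S :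
  alpha \in Aut [set: gT] -> bequiv S (alpha @: S).
Proof.
move=> aA; exists 1, alpha; split=> //.
by rewrite lcosetE' -imset_comp; apply: eq_imset => x /=; rewrite mul1g.
Qed.

(** An automorphism acts on both halves, whereas the translation by g is applied to the half of
    index 1 alone. *)
Lemma bequiv_iso S T : bequiv S T -> graph_iso (bcay S) (bcay T).
Proof.
case=> g [alpha [aA ->]].
have key (U : {set gT}) (f : gT -> gT) (k : gT * bool -> gT * bool) : injective k ->
    injective f -> (forall s u, k (nb s u) = nb (f s) (k u)) ->
    graph_iso (bcay U) (bcay (f @: U)).
  move=> kI fI kE; exists k; split; first exact: injF_bij.
  move=> u v; apply/bcayP/bcayP=> [[_ /imsetP[s sU ->]] | [s sU ->]].
    by rewrite -kE => /kI ->; exists s.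
  by exists (f s); rewrite ?imset_f ?kE.
apply: graph_iso_trans (_ : graph_iso _ (bcay (alpha @: S))) _.
  apply: (key _ _ (fun u => (alpha u.1, u.2))).
  - by case=> x i [y j] /= [/perm_inj-> ->].
  - exact: perm_inj.
  by move=> s [x []]; rewrite /nb /= (aut_mul aA) //; congr (_ * _, _);
     apply: (mulgI (alpha s)); rewrite -(aut_mul aA) !mulgV (aut_one aA).
rewrite lcosetE'; apply: (key _ _ (fun u => (if u.2 then g * u.1 else u.1, u.2))).
- by case=> x [] [y []] //= [] // /mulgI ->.
- exact: mulgI.
by move=> s [x []]; rewrite /nb /= ?mulgA // invMg mulgKV.
Qed.

End Cayley.

(** * Integers modulo N *)

Section Zp.

Import GRing.Theory.
Local Open Scope ring_scope.

Variable N : nat.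
Hypothesis N_gt1 : (1 < N)%N.
Local Notation R := 'Z_N.
Implicit Types (x y w d k : R) (l m p : nat).

Lemma Zp_natr_eq0 m : (m%:R == 0 :> R) = (N %| m)%N.
Proof. by rewrite -val_eqE /= val_Zp_nat. Qed.

Lemma Zp_mulrn_eq0 x m : (x *+ m == 0) = (N %| x * m)%N.
Proof. by rewrite -Zp_natr_eq0 natrM natr_Zp mulr_natr. Qed.

Lemma Zp_mulrn_opp x m : x *+ (m * N.-1) = - (x *+ m).
Proof.
apply/eqP; rewrite -addr_eq0 -mulrnDr -mulnSr prednK ?(ltnW N_gt1) //.
by rewrite Zp_mulrn_eq0 mulnA dvdn_mull.
Qed.

Lemma coprime_shift (c o : nat) : coprime c o ->
  exists j, coprime N (c + j * o).
Proof.
case: (posnP c) => [-> | c_gt0 co].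
  by rewrite /coprime gcd0n => /eqP->; exists 1%N; rewrite gcdn1.
(* The shift j is the part of N prime to c, so a prime divisor q of N divides exactly one of c and
   j. If q divides c, it divides neither j nor o; in both cases it does not divide c + j * o. *)
exists (N`_(\pi(c)^'))%N; apply/negPn/negP=> nco.
rewrite /coprime in nco; set g := gcdn N _ in nco.
have g_gt1 : (1 < g)%N by rewrite ltn_neqAle eq_sym nco gcdn_gt0 ltnW.
have q_pr := pdiv_prime g_gt1; set q := pdiv g in q_pr.
have /andP[qN qs] : (q %| N)%N && (q %| c + N`_(\pi(c)^') * o)%N.
  by rewrite -dvdn_gcd pdiv_dvd.
have qc : (q \in \pi(c)) = (q %| c)%N by rewrite mem_primes q_pr c_gt0.
have qj : (q %| N`_(\pi(c)^'))%N = (q \notin \pi(c)).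
  have : (q \in \pi(N`_(\pi(c)^'))%N) = (q \in \pi(N)) && (q \in \pi(c)^').
    by rewrite pi_of_part ?(ltnW N_gt1) // inE.
  rewrite inE /= !mem_primes q_pr part_gt0 (ltnW N_gt1) qN /= => ->.
  by rewrite -[LHS]/(~~ (q \in \pi(c))) qc c_gt0.
have [qc' | qc'] := boolP (q %| c)%N.
  move: qs; rewrite dvdn_addr // Euclid_dvdM // qj qc qc' /= => qo.
  by have := dvdn_gcd q c o; rewrite (eqP co) qc' qo dvdn1 => /eqP q1; rewrite q1 in q_pr.
by move: qs; rewrite dvdn_addl ?(negPf qc') // dvdn_mulr // qj qc.
Qed.

(** The number N / gcd(x, N) kills x, hence y, which means that gcd(x, N) divides y; Bezout then
    writes y as a multiple of x. *)
Lemma ann_multiple x y : (forall m, x *+ m = 0 -> y *+ m = 0) ->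
  exists c, y = x *+ c.
Proof.
move=> xy; have N0 := ltnW N_gt1.
have dvd_y : (gcdn x N %| y)%N.
  have := xy (N %/ gcdn x N)%N; rewrite -{1}[x]natr_Zp -mulrnA => h.
  have {h}/eqP : y *+ (N %/ gcdn x N) = 0.
    apply/h/eqP; rewrite Zp_natr_eq0 muln_divA ?dvdn_gcdr //.
    by rewrite mulnC -muln_divA ?dvdn_gcdl // dvdn_mulr.
  rewrite Zp_mulrn_eq0 muln_divA ?dvdn_gcdr // => /dvdnP[c /eqP].
  rewrite -(eqn_pmul2r (_ : 0 < gcdn x N)%N) ?gcdn_gt0 ?N0 ?orbT //.
  rewrite divnK ?dvdn_mull ?dvdn_gcdr // mulnAC eqn_pmul2r // => /eqP->.
  exact: dvdn_mull.
case/dvdnP: dvd_y => c yc.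
have [[|xp] x_gt0] : exists xv, (x : nat) = xv by exists x.
  exists 0%N; rewrite mulr0n -[y]natr_Zp yc x_gt0 gcd0n; apply/eqP.
  by rewrite Zp_natr_eq0 dvdn_mull.
have x0 : (0 < x)%N by rewrite x_gt0.
case: (egcdnP N x0) => km kn e _; exists (km * c)%N.
have g : (gcdn x N)%:R = x *+ km.
  rewrite -[x in RHS]natr_Zp -mulrnA mulnC e natrD natrM.
  by rewrite pchar_Zp // mulr0 add0r.
by rewrite -[LHS]natr_Zp yc natrM g mulr_natl -mulrnA.
Qed.

(** Each element is a multiple of the other. The factor c with y = c x matters only modulo the order
    o of x, is prime to o, and can be shifted by a multiple of o until it is prime to N. *)
Lemma unit_ann x y : (forall m, x *+ m = 0 <-> y *+ m = 0) ->
  exists2 k, k \is a GRing.unit & k * x = y.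
Proof.
move=> xy; have N0 := ltnW N_gt1.
have [c yc] := ann_multiple (fun m => proj1 (xy m)).
have [c' xc] := ann_multiple (fun m => proj2 (xy m)).
pose o := (N %/ gcdn x N)%N.
have o0 : x *+ o = 0.
  apply/eqP; rewrite Zp_mulrn_eq0 muln_divA ?dvdn_gcdr // mulnC.
  by rewrite -muln_divA ?dvdn_gcdl // dvdn_mulr.
have x0 m : x *+ m = 0 -> (o %| m)%N.
  move/eqP; rewrite Zp_mulrn_eq0 => d.
  rewrite -(@dvdn_pmul2l (gcdn x N)) ?gcdn_gt0 ?N0 ?orbT //.
  rewrite muln_divA ?dvdn_gcdr // mulKn ?gcdn_gt0 ?N0 ?orbT //.
  by rewrite muln_gcdl dvdn_gcd d dvdn_mulr.
have co : coprime c o.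
  have : x *+ (c * c' + N.-1) = 0.
    rewrite mulrnDr mulrnA -yc -xc -[X in _ + x *+ X]mul1n Zp_mulrn_opp mulr1n.
    exact: subrr.
  move/x0 => d; rewrite /coprime -dvdn1.
  have goN : (gcdn c o %| N)%N.
    by apply: dvdn_trans (dvdn_gcdr _ _) _; apply: dvdn_div; apply: dvdn_gcdr.
  have : (gcdn c o %| (c * c' + N.-1) + 1)%N.
    rewrite -addnA addn1 prednK // dvdn_addr // dvdn_mulr ?dvdn_gcdl //.
  rewrite dvdn_addr //; exact: dvdn_trans (dvdn_gcdr _ _) d.
have [j Nj] := coprime_shift co; exists (c + j * o)%:R; first by rewrite unitZpE.
by rewrite mulr_natl mulrnDr mulnC mulrnA o0 mul0rn addr0.
Qed.

(** Bezout with natural coefficients: the negative one is replaced by a multiple of [N.-1], which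
    acts as -1. *)
Lemma gcd_combination x y : exists d l m p q,
  [/\ d = x *+ l + y *+ m, x = d *+ p & y = d *+ q].
Proof.
have [x0 | x0] := eqVneq x 0.
  by exists y, 0%N, 1%N, 0%N, 1%N; rewrite x0 mulr0n add0r mulr1n.
have xp : (0 < x)%N by rewrite lt0n.
case: (egcdnP y xp) => km kn e _; exists (gcdn x y)%:R.
exists km, (kn * N.-1)%N, (x %/ gcdn x y)%N, (y %/ gcdn x y)%N; split.
- have xk : x *+ km = (km * x)%:R by rewrite mulnC natrM natr_Zp mulr_natr.
  have yk : y *+ kn = (kn * y)%:R by rewrite mulnC natrM natr_Zp mulr_natr.
  by rewrite Zp_mulrn_opp xk yk e natrD addrC addKr.
- by rewrite -mulrnA mulnC divnK ?dvdn_gcdl ?natr_Zp.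
- by rewrite -mulrnA mulnC divnK ?dvdn_gcdr ?natr_Zp.
Qed.

(* Isomorphic subgroups of a cyclic group are matched by an automorphism. *)
Lemma unit_rel3 x y w x' y' w' :
    (forall l m p, x *+ l + y *+ m + w *+ p = 0 <->
                   x' *+ l + y' *+ m + w' *+ p = 0) ->
  exists2 k, k \is a GRing.unit & [/\ k * x = x', k * y = y' & k * w = w'].
Proof.
move=> rel; have [d1 [l1 [m1 [p1 [q1 [d1E xE yE]]]]]] := gcd_combination x y.
have [d [l [m [p [q [dE d1d wE]]]]]] := gcd_combination d1 w.
pose d' := x' *+ (l1 * l) + y' *+ (m1 * l) + w' *+ m.
have dE' : d = x *+ (l1 * l) + y *+ (m1 * l) + w *+ m.
  by rewrite dE d1E mulrnDl -!mulrnA.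
have dn c : d *+ c = x *+ (l1 * l * c) + y *+ (m1 * l * c) + w *+ (m * c).
  by rewrite dE' !mulrnDl -!mulrnA.
have d'n c : d' *+ c = x' *+ (l1 * l * c) + y' *+ (m1 * l * c) + w' *+ (m * c).
  by rewrite !mulrnDl -!mulrnA.
have [|k kU kd] := @unit_ann d d'; first by move=> c; rewrite dn d'n rel.
have oppK (z z' : R) c : z = z' *+ c -> z' *+ (c * N.-1) + z = 0.
  by rewrite Zp_mulrn_opp => ->; rewrite addNr.
have oppK' (z z' : R) c : z' *+ (c * N.-1) + z = 0 -> z = z' *+ c.
  by move/eqP; rewrite Zp_mulrn_opp addrC subr_eq0 => /eqP.
exists k => //; split.
- have xd : x = d *+ (p * p1) by rewrite mulrnA -d1d.
  rewrite {1}xd mulrnAr kd; apply/esym/oppK'; move/oppK: xd; rewrite dn d'n.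
  set a := (l1 * l * _)%N; set b := (m1 * l * _)%N; set c := (m * _)%N => h.
  have := proj1 (rel a.+1 b c); rewrite !mulrSr.
  rewrite (_ : x *+ a + x + y *+ b + w *+ c = 0); last by rewrite -h; ring.
  by move/(_ erefl) => <-; ring.
- have yd : y = d *+ (p * q1) by rewrite mulrnA -d1d.
  rewrite {1}yd mulrnAr kd; apply/esym/oppK'; move/oppK: yd; rewrite dn d'n.
  set a := (l1 * l * _)%N; set b := (m1 * l * _)%N; set c := (m * _)%N => h.
  have := proj1 (rel a b.+1 c); rewrite !mulrSr.
  rewrite (_ : x *+ a + (y *+ b + y) + w *+ c = 0); last by rewrite -h; ring.
  by move/(_ erefl) => <-; ring.
- have wd := wE.
  rewrite {1}wd mulrnAr kd; apply/esym/oppK'; move/oppK: wd; rewrite dn d'n.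
  set a := (l1 * l * _)%N; set b := (m1 * l * _)%N; set c := (m * _)%N => h.
  have := proj1 (rel a b c.+1); rewrite !mulrSr.
  rewrite (_ : x *+ a + y *+ b + (w *+ c + w) = 0); last by rewrite -h; ring.
  by move/(_ erefl) => <-; ring.
Qed.

End Zp.

(** * Coordinates on the generalized quaternion group *)

Section Model.

Import GRing.Theory.

Variable n : nat.

(** A presentation by itself bounds the order only from above. This model, with (i, e) standing for
    a^i b^e, is a homomorphic image of order 4n and supplies the lower bound that makes the
    coordinates injective. *)
Definition quat_model := ('Z_(2 * n) * bool)%type.
HB.instance Definition _ := Finite.on quat_model.

Definition half_turn : 'Z_(2 * n) := (n%:R)%R.

Lemma half_turnD : (half_turn + half_turn = 0)%R.
Proof.
(* No bound on n is assumed, because the group structure below is declared for every n; this leaves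
   the degenerate n = 0. *)
rewrite -natrD addnn -mul2n; case: (ltnP 1 (2 * n)) => n_gt; first exact: pchar_Zp.
by have -> : n = 0%N by lia.
Qed.

Lemma half_turnN : (- half_turn = half_turn)%R.
Proof. by apply/eqP; rewrite eq_sym -addr_eq0 half_turnD. Qed.

Definition qmul (p q : quat_model) : quat_model :=
  if p.2 then
    if q.2 then ((p.1 - q.1 + half_turn)%R, false) else ((p.1 - q.1)%R, true)
  else ((p.1 + q.1)%R, q.2).

Definition qone : quat_model := (0%R, false).

Definition qinv (p : quat_model) : quat_model :=
  if p.2 then ((p.1 + half_turn)%R, true) else ((- p.1)%R, false).

Lemma qmulA : associative qmul.
Proof.
case=> i [] [j []] [k []]; rewrite /qmul /=; congr (_, _);
  rewrite ?opprD ?half_turnN; ring.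
Qed.

Lemma qmul1 : left_id qone qmul.
Proof. by case=> i e; rewrite /qmul /= add0r. Qed.

Lemma qmulV : left_inverse qone qinv qmul.
Proof.
case=> i []; rewrite /qmul /qone /=; congr (_, _); last exact: addNr.
by rewrite [(i + _)%R]addrC addrK half_turnD.
Qed.

HB.instance Definition _ := Finite_isGroup.Build quat_model qmulA qmul1 qmulV.

Lemma card_quat_model : 1 < n -> #|[set: quat_model]| = (4 * n)%N.
Proof.
by move=> n_gt1; rewrite cardsT card_prod card_bool card_ord Zp_cast //; lia.
Qed.

Lemma quat_model_expg k : ((1%R, false) : quat_model) ^+ k = (k%:R%R, false).
Proof. by elim: k => // k IHk; rewrite expgS IHk mulrS. Qed.

Lemma quat_model_homg : 1 < n ->
  [set: quat_model] \homg
    Grp (a : b : a ^+ (2 * n) = 1, b ^+ 2 = a ^+ n, a ^ b = a^-1).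
Proof.
move=> n_gt1; apply/existsP.
exists ((1%R, false) : quat_model, (0%R, true) : quat_model).
rewrite /= !xpair_eqE /= !quat_model_expg; apply/and4P; split.
- rewrite eqEsubset subsetT /=; apply/subsetP=> [[i e] _].
  have iX : ((i, false) : quat_model) \in
      <[(1%R, false) : quat_model]> <*> <[(0%R, true) : quat_model]>.
    rewrite -[i]natr_Zp -quat_model_expg groupX //.
    by apply: (subsetP (joing_subl _ _)); apply: cycle_id.
  case: e => //; have -> : (i, true) = ((i, false) : quat_model) * (0%R, true).
    by congr (_, _); rewrite /= addr0.
  by rewrite groupM //; apply: (subsetP (joing_subr _ _)); apply: cycle_id.
- by rewrite pchar_Zp //; lia.
- by apply/eqP; congr (_, _); rewrite /= subrr add0r.
- by rewrite andbT add0r addr0 addrAC half_turnD add0r.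
Qed.

End Model.

(** The interface to the group: from here on only these rules are used, never the presentation. *)
Record quat_coords n (gT : finGroupType) := QuatCoords {
  qE : 'Z_(2 * n) -> gT;
  qF : 'Z_(2 * n) -> gT;
  qEE : forall i j, qE i * qE j = qE (i + j)%R;
  qEF : forall i j, qE i * qF j = qF (i + j)%R;
  qFE : forall i j, qF i * qE j = qF (i - j)%R;
  qFF : forall i j, qF i * qF j = qE (i - j + half_turn n)%R;
  qE_inj : injective qE;
  qF_inj : injective qF;
  qE_neq_F : forall i j, qE i != qF j;
  q_cover : forall g, (exists i, g = qE i) \/ (exists i, g = qF i)
}.

(** The relations bring every product of generators to the form a^i or a^i b, so the 4n pairs map
    onto the group; the order of the model then forces this map to be injective. *)
Lemma quaternion_coords n gT :
  1 < n -> is_quaternion n gT -> inhabited (quat_coords n gT).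
Proof.
move=> n_gt1 isoQ; have N_gt1 : 1 < 2 * n by lia.
have oG : 4 * n <= #|gT|.
  rewrite -(card_quat_model n_gt1) -cardsT; apply: leq_homg.
  by rewrite (isoQ _ [set: quat_model n]%G) quat_model_homg.
have /existsP[[a b] /= /eqP[defG aN b2 ab]] := isoGrp_hom isoQ.
have aM i : a ^+ (i %% (2 * n)) = a ^+ i by apply: expg_mod.
have aD (i j : 'Z_(2 * n)) : a ^+ i * a ^+ j = a ^+ (i + j)%R.
  by rewrite -expgD -[LHS]aM; congr (a ^+ _); rewrite -[X in _ %% X](Zp_cast N_gt1).
have aV (i : 'Z_(2 * n)) : a ^+ (- i)%R = a ^- i.
  by apply: (mulgI (a ^+ i)); rewrite aD GRing.addrN mulgV.
have ba (i : 'Z_(2 * n)) : b * a ^+ i = a ^+ (- i)%R * b.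
  have h : (a ^+ (- i)%R) ^ b = a ^+ i by rewrite conjXg ab expgVn -aV GRing.opprK.
  by rewrite -h conjgE mulKVg.
have ah : a ^+ half_turn n = b * b.
  by rewrite -[RHS]/(b ^+ 2) b2 /half_turn val_Zp_nat // aM.
pose E (i : 'Z_(2 * n)) := a ^+ i; pose F (i : 'Z_(2 * n)) := a ^+ i * b.
pose c (p : 'Z_(2 * n) * bool) := if p.2 then F p.1 else E p.1.
have EE i j : E i * E j = E (i + j)%R by exact: aD.
have EF i j : E i * F j = F (i + j)%R by rewrite /F mulgA aD.
have FE i j : F i * E j = F (i - j)%R by rewrite /F /E -mulgA ba mulgA aD.
have FF i j : F i * F j = E (i - j + half_turn n)%R.
  by rewrite {2}/F mulgA -[a ^+ j]/(E j) FE /F -mulgA -ah /E aD.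
have c_onto g : g \in c @: setT.
  have: <<a |: [set b]>> \subset c @: setT.
    apply: gen_sub_closed => [|s x]; first by apply/imsetP; exists (0%R, false).
    have cI i : (E i \in c @: setT) * (F i \in c @: setT).
      by split; apply/imsetP; [exists (i, false) | exists (i, true)].
    have a_E : a = E 1%R by rewrite /E /= modn_small ?expg1 // Zp_cast.
    have b_F : b = F 0%R by rewrite /F /= mul1g.
    by case/set2P=> -> /imsetP[[i []] _ ->]; rewrite /c ?a_E ?b_F ?EE ?EF ?FE ?FF cI.
  have -> : <<a |: [set b]>> = [set: gT] by rewrite -defG joing_idl joing_idr.
  by move/subsetP; apply; rewrite inE.
have cI : injective c.
  have: {in setT &, injective c}.
    apply/imset_injP; rewrite eqn_leq leq_imset_card /=.
    have -> : #|[set: 'Z_(2 * n) * bool]| = (4 * n)%N.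
      by rewrite cardsT card_prod card_bool card_ord Zp_cast //; lia.
    apply: leq_trans oG _.
    by apply/subset_leq_card/subsetP=> g _; apply: c_onto.
  by move=> cI x y; apply: cI; rewrite inE.
exists; exists E F => //.
- by move=> i j eij; have [] := cI (i, false) (j, false) eij.
- by move=> i j eij; have [] := cI (i, true) (j, true) eij.
- by move=> i j; apply/eqP=> eij; have [] := cI (i, false) (j, true) eij.
- move=> g; have /imsetP[[i []] _ ->] := c_onto g; first by right; exists i.
  by left; exists i.
Qed.

Section Quaternion.

Import GRing.Theory.

Variables (n : nat) (gT : finGroupType) (Q : quat_coords n gT).
Hypothesis n_gt1 : 1 < n.

Local Notation R := 'Z_(2 * n).
Local Notation E := (qE Q).
Local Notation F := (qF Q).
Local Notation nu := (half_turn n).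
Implicit Types (i j k t : R) (g x y : gT).

Let N_gt1 : 1 < 2 * n.
Proof. by rewrite mul2n -addnn ltn_addl. Qed.

Lemma half_turn_neq0 : (nu != 0)%R.
Proof. by rewrite Zp_natr_eq0 // gtnNdvd //; lia. Qed.

Lemma two_torsion i : (i *+ 2 = 0)%R -> i = 0%R \/ i = nu.
Proof.
move/eqP; rewrite Zp_mulrn_eq0 // => d.
have /dvdnP[q iq] : n %| i by rewrite -(@dvdn_pmul2l 2) // [X in _ %| X]mulnC.
have : (i < 2 * n)%N by rewrite -[X in _ < X](Zp_cast N_gt1).
rewrite iq ltn_pmul2r; last by lia.
case: q iq => [|[|]] // iq _; first by left; apply: val_inj.
by right; rewrite -[i]natr_Zp iq mul1n.
Qed.

Lemma four_torsion i : odd n -> (i *+ 4 = 0 -> i *+ 2 = 0)%R.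
Proof.
move=> n_odd /eqP; rewrite Zp_mulrn_eq0 // => d; apply/eqP; rewrite Zp_mulrn_eq0 //.
have ni : n %| i.
  rewrite -(@Gauss_dvdr n 2) ?coprimen2 // -(@dvdn_pmul2l 2) // mulnA.
  by rewrite [X in _ %| X]mulnC.
by rewrite [X in _ %| X]mulnC dvdn_pmul2l.
Qed.

Lemma qE0 : E 0%R = 1.
Proof. by apply: (mulgI (E 0%R)); rewrite qEE addr0 mulg1. Qed.

Lemma qEV i : (E i)^-1 = E (- i)%R.
Proof. by apply: (mulgI (E i)); rewrite qEE subrr qE0 mulgV. Qed.

Lemma qFV i : (F i)^-1 = F (i + nu)%R.
Proof.
apply: (mulgI (F i)); rewrite qFF mulgV opprD addrA subrr half_turnN add0r.
by rewrite half_turnD qE0.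
Qed.

Definition qM := (qEE Q, qEF Q, qFE Q, qFF Q, qEV, qFV).

Lemma qE_eq i j : (E i == E j) = (i == j).
Proof. exact/inj_eq/qE_inj. Qed.

Lemma qF_eq i j : (F i == F j) = (i == j).
Proof. exact/inj_eq/qF_inj. Qed.

Lemma qEF_eq i j : (E i == F j) = false.
Proof. exact/negbTE/qE_neq_F. Qed.

Lemma qFE_eq i j : (F i == E j) = false.
Proof. by rewrite eq_sym qEF_eq. Qed.

Lemma qE1_eq i : (E i == 1) = (i == 0%R).
Proof. by rewrite -qE0 qE_eq. Qed.

Lemma qF1_eq i : (F i == 1) = false.
Proof. by rewrite -qE0 qFE_eq. Qed.

Definition q_eqs := (qE_eq, qF_eq, qEF_eq, qFE_eq, qE1_eq, qF1_eq).

Lemma qEX i m : E i ^+ m = E (i *+ m)%R.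
Proof.
by elim: m => [|m IHm]; rewrite ?mulr0n ?qE0 // expgS IHm qEE mulrS.
Qed.

Lemma qFX2 i : F i ^+ 2 = E nu.
Proof. by rewrite expgS expg1 qFF subrr add0r. Qed.

Lemma qFX4 i : F i ^+ 4 = 1.
Proof. by rewrite (expgM _ 2 2) qFX2 qEX mulr2n half_turnD qE0. Qed.

Lemma order_qF i : #[F i] = 4.
Proof.
have: #[F i] %| 4 by rewrite order_dvdn qFX4.
have: ~~ (#[F i] %| 2) by rewrite order_dvdn qFX2 qE1_eq half_turn_neq0.
by case: #[F i] (order_gt0 (F i)) => [|[|[|[|[|]]]]] // k _ _ /dvdn_leq; rewrite ltnNge => /(_ isT).
Qed.

(* The automorphisms a -> a^k, b -> a^t b; for n > 2 there are no others. *)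
Lemma qaut k t : k \is a GRing.unit -> exists2 alpha : {perm gT},
  alpha \in Aut [set: gT] &
  (forall i, alpha (E i) = E (k * i)%R) /\
  (forall i, alpha (F i) = F (k * i + t)%R).
Proof.
move=> kU.
pose f g := if [pick i | g == E i] is Some i then E (k * i)%R
            else if [pick i | g == F i] is Some i then F (k * i + t)%R else 1.
have fE i : f (E i) = E (k * i)%R.
  rewrite /f; case: pickP => [j | /(_ i)]; last by rewrite eqxx.
  by rewrite qE_eq => /eqP->.
have fF i : f (F i) = F (k * i + t)%R.
  rewrite /f; case: pickP => [j | _]; first by rewrite qFE_eq.
  case: pickP => [j | /(_ i)]; last by rewrite eqxx.
  by rewrite qF_eq => /eqP->.
have f_inj : injective f.
  move=> x y; case: (q_cover Q x) => -[i ->]; case: (q_cover Q y) => -[j ->].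
  - by rewrite !fE => /qE_inj/(mulrI kU)->.
  - by rewrite fE fF => /eqP; rewrite qEF_eq.
  - by rewrite fE fF => /eqP; rewrite qFE_eq.
  by rewrite !fF => /qF_inj/addIr/(mulrI kU)->.
have k_nu : (k * nu = nu)%R.
  have [] := @two_torsion (k * nu)%R => //.
    by rewrite -mulrnAr mulr2n half_turnD mulr0.
  by move/eqP; rewrite -[X in _ == X](mulr0 k) (inj_eq (mulrI kU)) (negPf half_turn_neq0).
have f_morph : {morph f : x y / x * y}.
  move=> x y; case: (q_cover Q x) => -[i ->]; case: (q_cover Q y) => -[j ->];
    rewrite !(fE, fF, qM); [congr (E _) | congr (F _) | congr (F _) | congr (E _)].
  - ring.
  - ring.
  - ring.
  by rewrite !mulrDr k_nu; ring.
exists (perm f_inj); first exact: perm_Aut.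
by split=> i; rewrite permE.
Qed.

End Quaternion.

(** Left multiplications by x and by y are permutations of the group all of whose cycles have the
    same length, hence they are conjugate in the symmetric group. *)
Lemma shift_bij (gT : finGroupType) (x y : gT) : #[x] = #[y] ->
  exists2 h : gT -> gT, bijective h & forall g, h (x * g) = y * h g.
Proof.
move=> oxy; have dv : #[y] %| #[x] by rewrite oxy.
pose r := eltm dv; have rI : 'injm r by rewrite injm_eltm oxy.
pose X := <[x]>%G; pose Y := <[y]>%G.
(* Cosets of <x> and of <y> are paired by their positions in the two enumerations, which have equal
   length by Lagrange's theorem. *)
pose f (B : {set gT}) := nth set0 (enum (rcosets Y [set: gT])) (index B (enum (rcosets X [set: gT]))).
have oXY : size (enum (rcosets X [set: gT])) = size (enum (rcosets Y [set: gT])).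
  rewrite -!cardE; apply/eqP; rewrite -(eqn_pmul2l (order_gt0 x)) {2}oxy.
  by rewrite [X in X == _](Lagrange (subsetT <[x]>)) [X in _ == X](Lagrange (subsetT <[y]>)).
have idx g : index (X :* g) (enum (rcosets X [set: gT])) < size (enum (rcosets X [set: gT])).
  by rewrite index_mem mem_enum; apply/rcosetsP; exists g; rewrite ?inE.
have fY g : exists2 k, k \in [set: gT] & f (X :* g) = Y :* k.
  by apply/rcosetsP; rewrite -mem_enum mem_nth // -oXY.
have f_inj g g' : f (X :* g) = f (X :* g') -> X :* g = X :* g'.
  move/eqP; rewrite nth_uniq ?enum_uniq // -?oXY // => /eqP e.
  by rewrite -(nth_index set0 (_ : X :* g \in enum (rcosets X [set: gT]))) -?index_mem // e
             nth_index // -index_mem.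
(* Inside a coset, a power of x times the representative goes to the same power of y times the
   representative of the paired coset. *)
pose h g := r (g * (repr (X :* g))^-1) * repr (f (X :* g)).
have gX g : g * (repr (X :* g))^-1 \in X.
  by have := mem_repr_rcoset X g; rewrite mem_rcoset -groupV invMg invgK.
have hf g : Y :* h g = f (X :* g).
  have [k _ fk] := fY g.
  have rY : r (g * (repr (X :* g))^-1) \in Y.
    have: r (g * (repr (X :* g))^-1) \in r @* <[x]> by apply: mem_morphim; exact: gX.
    by rewrite morphim_cycle ?cycle_id // /r /= eltm_id.
  by rewrite /h fk -fk rcosetM rcoset_id // fk; apply/rcoset_eqP/mem_repr_rcoset.
exists h.
  apply: injF_bij => g g' e; have eX : X :* g = X :* g'.
    by apply: f_inj; rewrite -!hf e.
  have gX1 := gX g; rewrite eX in gX1.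
  by move: e; rewrite /h eX => /mulIg /(injmP rI _ _ gX1 (gX g')) /mulIg.
move=> g; rewrite /h (_ : X :* (x * g) = X :* g) -?mulgA.
  by rewrite /r morphM ?cycle_id ?gX //= eltm_id mulgA.
by rewrite rcosetM (@rcoset_id _ X x) //; apply: cycle_id.
Qed.

(** * Even n > 2 *)

Section PairGraphs.

Variables (gT : finGroupType) (x y : gT).
Hypothesis oxy : #[x] = #[y].

Lemma cay_pair_iso :
  graph_iso (cay [set x; x^-1]) (cay [set y; y^-1]).
Proof.
have [h h_bij hM] := shift_bij oxy; have h_inj := bij_inj h_bij.
have hV g : h (x^-1 * g) = y^-1 * h g.
  by apply: (mulgI y); rewrite -hM !mulKVg.
exists h; split=> // g g'; apply/cayP/cayP=> -[z].
  case/set2P=> ->; rewrite -?hM -?hV => /h_inj ->.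
    by exists x; rewrite ?set21.
  by exists x^-1; rewrite ?set22.
case/set2P=> -> ->; first by exists y; rewrite ?set21.
by exists y^-1; rewrite ?set22.
Qed.

Lemma bcay_pair_iso : graph_iso (bcay [set 1; x]) (bcay [set 1; y]).
Proof.
have [h h_bij hM] := shift_bij oxy; have h_inj := bij_inj h_bij.
have hV g : h (x^-1 * g) = y^-1 * h g.
  by apply: (mulgI y); rewrite -hM !mulKVg.
pose k (u : gT * bool) := (h u.1, u.2).
have k_inj : injective k by case=> g i [g' i'] /= [/h_inj-> ->].
have k1 u : k (nb 1 u) = nb 1 (k u).
  by case: u => g []; rewrite /k /nb /= ?invg1 !mul1g.
have kx u : k (nb x u) = nb y (k u) by case: u => g []; rewrite /k /nb /= ?hM ?hV.
exists k; split; first exact: injF_bij.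
move=> u v; apply/bcayP/bcayP=> -[z].
  case/set2P=> ->; rewrite -?k1 -?kx => /k_inj ->.
    by exists 1; rewrite ?set21.
  by exists x; rewrite ?set22.
case/set2P=> -> ->; first by exists 1; rewrite ?set21.
by exists y; rewrite ?set22.
Qed.

End PairGraphs.

Section EvenCase.

Import GRing.Theory.

Variables (n : nat) (gT : finGroupType) (Q : quat_coords n gT).
Hypothesis n_gt2 : 2 < n.

Local Notation E := (qE Q).
Local Notation F := (qF Q).

Let n_gt1 : 1 < n. Proof. exact: ltnW. Qed.

(** The image of a would commute with F j. An element commuting with F j is a power of a of order at
    most 2 or some F t, so its fourth power is 1, whereas a has order 2n > 4. *)
Lemma aut_qE_neq_qF (alpha : {perm gT}) i j :
  alpha \in Aut [set: gT] -> alpha (E i) <> F j.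
Proof.
move=> aA eF; set g := alpha (E 1%R).
have gF : g * F j = F j * g.
  by rewrite -eF -!(aut_mul aA) !qEE addrC.
have g4 : g ^+ 4 = 1.
  case: (q_cover Q g) gF => -[t ->]; last by rewrite qFX4.
  rewrite !qM => /qF_inj/(congr1 (fun z => z - j)%R).
  rewrite addrK addrAC subrr add0r => t2.
  have t20 : (t *+ 2 = 0)%R by rewrite mulr2n {1}t2 addNr.
  by rewrite qEX (mulrnA _ 2 2) t20 mul0rn qE0.
have: alpha (E 1%R ^+ 4) = alpha 1.
  by rewrite (aut_one aA) -g4 !expgS !expg0 !(aut_mul aA) (aut_one aA).
move/perm_inj/eqP; rewrite qEX qE1_eq Zp_natr_eq0; last by lia.
by move/dvdn_leq; lia.
Qed.

Hypothesis n_even : ~~ odd n.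

Let k : 'Z_(2 * n) := (n./2%:R)%R.

Let k2 : (k *+ 2 = half_turn n)%R.
Proof. by rewrite -mulrnA muln2 halfK (negPf n_even) subn0. Qed.

Let order_k : #[E k] = #[F 0%R].
Proof.
rewrite (order_qF Q) //.
have: #[E k] %| 4 by rewrite order_dvdn qEX (mulrnA _ 2 2) k2 mulr2n half_turnD qE0.
have: ~~ (#[E k] %| 2) by rewrite order_dvdn qEX k2 qE1_eq half_turn_neq0.
by case: #[E k] (order_gt0 (E k)) => [|[|[|[|[|]]]]] // ? _ _ /dvdn_leq; rewrite ltnNge => /(_ isT).
Qed.

Let k_neq0 : E k != 1.
Proof. by rewrite -order_eq1 order_k (order_qF Q). Qed.

Lemma not_2CI : ~ CI_group 2 gT.
Proof.
move=> CI; have [||||alpha [aA eT]] := CI [set E k; (E k)^-1] _ _ _ _ _ (cay_pair_iso order_k).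
- by rewrite !inE !(eq_sym 1) invg_eq1 orbb.
- by apply/setP=> g; rewrite !inE !eq_invg_sym orbC invgK.
- by rewrite cards2; case: (_ != _).
- by rewrite !inE !(eq_sym 1) invg_eq1 orbb qF1_eq.
have: alpha (E k) \in [set F 0%R; (F 0%R)^-1] by rewrite -eT imset_f ?set21.
by case/set2P; rewrite ?qFV; apply: aut_qE_neq_qF.
Qed.

Lemma not_2BCI : ~ BCI_group 2 gT.
Proof.
move=> BCI; have [|g [alpha [aA eT]]] := BCI [set 1; E k] _ _ (bcay_pair_iso order_k).
  by rewrite cards2; case: (_ != _).
have ak1 : alpha (E k) != 1 by rewrite -(aut_one aA) (inj_eq perm_inj).
have h z : z \in [set 1; E k] -> g * alpha z \in [set 1; F 0%R].
  by move=> zS; rewrite eT lcosetE' !imset_f.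
have := h _ (set21 _ _); have := h _ (set22 _ _); rewrite (aut_one aA) mulg1.
move=> + /set2P[] eg; rewrite eg ?mul1g => /set2P[] e.
- by rewrite e eqxx in ak1.
- exact: aut_qE_neq_qF e.
- have := canRL (mulKg _) e; rewrite mulg1 qFV; exact: aut_qE_neq_qF.
- by have := canRL (mulKg _) e; rewrite mulVg => e1; rewrite e1 eqxx in ak1.
Qed.

End EvenCase.

(** * Counting walks by evaluating words *)

Section FormalWalks.

Import GRing.Theory.

(* The triple (a, b, e) stands for [E (u * a + x * b) * F j ^+ e] for parameters u, x, j; the
   generators have e = 0 or e = 1, and [formal_mul s d] multiplies by s or by its inverse on the
   left, according to d. *)
Definition formal_gen := (int * int * bool)%type.
Definition formal_elt := (int * int * nat)%type.

Definition formal_mul (s : formal_gen) (d : bool) (a : formal_elt) : formal_elt :=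
  if s.2 then
    ((s.1.1 - a.1.1)%R, (s.1.2 - a.1.2)%R, if d then a.2.+1 else (a.2 + 3)%N)
  else if d then ((a.1.1 + s.1.1)%R, (a.1.2 + s.1.2)%R, a.2)
  else ((a.1.1 - s.1.1)%R, (a.1.2 - s.1.2)%R, a.2).

Definition formal1 : formal_elt := (0%R, 0%R, 0).

Definition cay_step gens d a := [seq formal_mul s d a | s <- gens].

Definition bcay_step gens (_ : bool) (p : formal_elt * bool) :=
  [seq (formal_mul s (~~ p.2) p.1, ~~ p.2) | s <- gens].

(** The first edge, coloured s and leaving side i, is prescribed and k free steps follow. Keeping
    the ends on side i, closed walks are the ends that evaluate to 1. *)
Definition bcay_ends gens k s i :=
  [seq p.1 | p <- formal_ends (bcay_step gens) (nseq k true)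
                    (formal_mul s (~~ i) formal1, ~~ i) & p.2 == i].

Variables (n : nat) (gT : finGroupType) (Q : quat_coords n gT).
Hypothesis n_gt1 : 1 < n.
Variables (u x j : 'Z_(2 * n)).

Local Notation E := (qE Q).
Local Notation F := (qF Q).
Local Notation nu := (half_turn n).

Definition formal_val (a : formal_elt) : gT :=
  E (u *~ a.1.1 + x *~ a.1.2)%R * F j ^+ a.2.

Definition gen_val (s : formal_gen) : gT :=
  E (u *~ s.1.1 + x *~ s.1.2)%R * (if s.2 then F j else 1).

Lemma formal1_val : formal_val formal1 = 1.
Proof. by rewrite /formal_val /= !mulr0z addr0 qE0 mul1g. Qed.

Lemma qFE_comm i : F j * E i = E (- i)%R * F j.
Proof. by rewrite qFE qEF addrC. Qed.

(** Moving F j past a power of a negates the exponent; as F j has order 4, its inverse adds 3 to the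
    last component. *)
Lemma formal_mul_val s d a :
  formal_val (formal_mul s d a) =
    (if d then gen_val s else (gen_val s)^-1) * formal_val a.
Proof.
case: s a => [[al be] ep] [[a b] e]; rewrite /formal_val /gen_val /formal_mul /=.
case: ep d => [] [] /=; rewrite ?mulg1.
- rewrite expgS -!mulgA [X in _ = _ * X]mulgA qFE_comm -!mulgA [RHS]mulgA qEE.
  by congr (E _ * _); rewrite !mulrzBr; ring.
- have -> : F j ^+ (e + 3) = (F j)^-1 * F j ^+ e.
    apply: (mulgI (F j)); rewrite mulKVg -expgS -addnS expgD qFX4 ?mulg1 //.
  rewrite invMg -!mulgA [X in _ = _ * X]mulgA qEV qEE [RHS]mulgA qFV qFE.
  rewrite mulgA qEF; congr (F _ * _).
  by rewrite !mulrzBr; ring.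
- by rewrite mulgA qEE; congr (E _ * _); rewrite !mulrzDr; ring.
by rewrite qEV mulgA qEE; congr (E _ * _); rewrite !mulrzBr; ring.
Qed.

Lemma formal_mul_valM s d a g :
  formal_val (formal_mul s d a) * g =
    (if d then gen_val s else (gen_val s)^-1) * (formal_val a * g).
Proof. by rewrite formal_mul_val; apply/esym/mulgA. Qed.

Lemma formal_val_eq1 a : (formal_val a == 1) =
  ((a.2 %% 4 == 0) && (u *~ a.1.1 + x *~ a.1.2 == 0)%R) ||
  ((a.2 %% 4 == 2) && (u *~ a.1.1 + x *~ a.1.2 == nu)%R).
Proof.
rewrite /formal_val; set i := (_ + _)%R.
have -> : F j ^+ a.2 = F j ^+ (a.2 %% 4) by rewrite expg_mod ?qFX4.
case: (a.2 %% 4) (ltn_pmod a.2 (isT : 0 < 4)) => [|[|[|[|//]]]] _ /=.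
- by rewrite mulg1 qE1_eq orbF.
- by rewrite expg1 qEF qF1_eq.
- by rewrite qFX2 qEE qE1_eq addr_eq0 half_turnN.
- by rewrite expgS qFX2 qFE qEF qF1_eq.
Qed.

Variable gens : seq formal_gen.
Hypothesis gens_uniq : uniq (map gen_val gens).

Lemma cay_walks ds a g :
  walks (cay [set:: map gen_val gens]) ds (formal_val a * g) g =
  count (fun b => formal_val b == 1) (formal_ends (cay_step gens) ds a).
Proof.
rewrite (@walks_formal _ _ _ (cay_step gens) (fun b => formal_val b * g)).
- by apply: eq_count => b /=; rewrite -[X in _ == X]mul1g (inj_eq (mulIg g)).
- move=> d b; rewrite -map_comp.
  rewrite (eq_map (_ : _ =1 (fun t => (if d then t else t^-1) * (formal_val b * g)) \o gen_val)).
    by rewrite map_comp map_inj_uniq //; case: d => t t' /= /mulIg // /invg_inj.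
  by move=> t /=; apply: formal_mul_valM.
move=> d b y; rewrite -map_comp; apply/mapP/idP => [[t t_gens -> /=] | ].
  rewrite formal_mul_valM; move: (_ * g) (map_f gen_val t_gens) => w.
  move: (gen_val t) => z zS.
  by case: d; rewrite cayE ?mulgK ?invMg ?invgK ?mulKVg inE.
case: d; rewrite cayE inE => /mapP[t t_gens /(canRL (mulgKV _)) e]; exists t => //=.
  by rewrite formal_mul_valM.
by rewrite formal_mul_valM e mulKg.
Qed.

(** Multiplying the half of index 1 by c turns the graph of the generators into the graph of their
    translate by c, so the evaluation never has to know c. *)
Lemma bcay_walks c k s v :
  walks (bcay [set:: [seq c * gen_val t | t <- gens]]) (nseq k true)
    (nb (c * gen_val s) v) v =
  count (fun a => formal_val a == 1) (bcay_ends gens k s v.2).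
Proof.
pose g := if v.2 then c^-1 * v.1 else v.1.
pose phi (p : formal_elt * bool) :=
  ((if p.2 then c else 1) * (formal_val p.1 * g), p.2).
have phiE t p : phi (formal_mul t (~~ p.2) p.1, ~~ p.2) = nb (c * gen_val t) (phi p).
  case: p => a i; rewrite /phi /nb /= formal_mul_valM.
  move: (_ * g) (gen_val t) => w z.
  by case: i; rewrite /= !mul1g ?mulgA // invMg mulgKV.
have phi1 : phi (formal1, v.2) = v.
  rewrite /phi /= formal1_val mul1g /g; case: (v) => y [] /=; by rewrite ?mulKVg ?mul1g.
have -> : nb (c * gen_val s) v = phi (formal_mul s (~~ v.2) formal1, ~~ v.2).
  by rewrite (phiE s (formal1, v.2)) phi1.
rewrite (@walks_formal _ _ _ (bcay_step gens) phi).
- rewrite /bcay_ends count_map count_filter; apply: eq_count => -[a i] /=.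
  rewrite -[in LHS]phi1 /phi xpair_eqE formal1_val mul1g /=.
  case: (i =P v.2) => [->|_]; rewrite ?andbT ?andbF // (inj_eq (mulgI _)).
  by rewrite -[X in _ == X]mul1g (inj_eq (mulIg g)).
- move=> d p; rewrite -map_comp (eq_map (_ : _ =1 (fun t => nb (c * t) (phi p)) \o gen_val)).
    by rewrite map_comp map_inj_uniq // => t t' /nb_inj/mulgI.
  by move=> t; apply: phiE.
move=> d p w; rewrite -map_comp.
have -> : (if d then bcay [set:: [seq c * gen_val t | t <- gens]] (phi p) w
    else bcay [set:: [seq c * gen_val t | t <- gens]] w (phi p)) =
      bcay [set:: [seq c * gen_val t | t <- gens]] (phi p) w.
  by case: d; rewrite // bcay_sym.
apply/mapP/bcayP=> [[t t_gens ->] | [t]].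
  by exists (c * gen_val t); [rewrite inE (map_f (fun t => c * gen_val t)) | apply: phiE].
rewrite inE => /mapP[t' t_gens ->] ->; exists t' => //.
exact/esym/phiE.
Qed.

(** [bound] restricts the exponents that occur, so P has to decide triviality for a bounded range of
    multiples only; the other two premises are left to evaluation. *)
Lemma count_formal (P : pred formal_elt) (bound : pred formal_elt) ends N :
    (forall a, bound a -> (formal_val a == 1) = P a) ->
    all bound ends -> count P ends = N ->
  count (fun a => formal_val a == 1) ends = N.
Proof.
move=> boundP /allP ends_bound <-; apply: eq_in_count => a /ends_bound.
exact: boundP.
Qed.

End FormalWalks.

(** * Closed walks in the bi-Cayley graphs of {c, c E x, c F j}, for n odd *)

Section OddCase.

Import GRing.Theory.

Variables (n : nat) (gT : finGroupType) (Q : quat_coords n gT).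
Hypotheses (n_gt1 : 1 < n) (n_odd : odd n).

Local Notation E := (qE Q).
Local Notation F := (qF Q).
Local Notation nu := (half_turn n).
Local Notation R := 'Z_(2 * n).
Implicit Types (x y i j t w k : R) (S T : {set gT}) (v : gT * bool).

Let nu0 : nu != 0%R := half_turn_neq0 n_gt1.

Lemma half_turn_mulrn m : (nu *+ m = if odd m then nu else 0)%R.
Proof.
by elim: m => // m IHm; rewrite mulrS IHm /=; case: (odd m); rewrite ?half_turnD ?addr0.
Qed.

Lemma Zp_mulrz_eq0 x (b : int) : (x *~ b == 0)%R = (x *+ `|b|%N == 0)%R.
Proof. by case: b => m //=; rewrite NegzE mulrNz oppr_eq0. Qed.

Lemma Zp_mulrz_eq_half x (b : int) : (x *~ b == nu)%R = (x *+ `|b|%N == nu)%R.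
Proof. by case: b => m //=; rewrite NegzE mulrNz eqr_oppLR half_turnN. Qed.

Lemma double_neq_half x : (x *+ 2 != nu)%R.
Proof.
apply/eqP=> x2; have /(four_torsion n_gt1 n_odd) : (x *+ 4 = 0)%R.
  by rewrite (mulrnA _ 2 2) x2 mulr2n half_turnD.
by rewrite x2 => /eqP; rewrite (negPf nu0).
Qed.

Lemma Zp_double_neq0 x : x != 0%R -> x != nu -> (x *+ 2 != 0)%R.
Proof. by move=> x0 xnu; apply/eqP=> /(two_torsion n_gt1)[] /eqP; apply/negP. Qed.

Lemma mulrn_order3 x m :
  x != 0%R -> (x *+ 3 = 0 -> (x *+ m == 0) = (3 %| m)%N)%R.
Proof.
move=> x0 x3; rewrite {1}(divn_eq m 3) [(m %/ 3 * 3)%N]mulnC mulrnDr mulrnA x3 mul0rn add0r /dvdn.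
case: (m %% 3) (ltn_pmod m (isT : 0 < 3)) => [|[|[|//]]] _ /=.
- by rewrite mulr0n eqxx.
- by rewrite mulr1n (negPf x0).
by apply/eqP=> x2; move/eqP: x3; rewrite mulrSr x2 add0r (negPf x0).
Qed.

Lemma mulrn_order6 x m :
  x != nu -> (x *+ 3 = nu -> (x *+ m == 0) = (6 %| m)%N)%R.
Proof.
move=> xnu x3; have x6 : (x *+ 6 = 0)%R by rewrite (mulrnA _ 3 2) x3 mulr2n half_turnD.
have x0 : x != 0%R by apply: contraNneq nu0 => x0; rewrite -x3 x0 mul0rn.
have x2 := Zp_double_neq0 x0 xnu.
rewrite {1}(divn_eq m 6) [(m %/ 6 * 6)%N]mulnC mulrnDr mulrnA x6 mul0rn add0r /dvdn.
case: (m %% 6) (ltn_pmod m (isT : 0 < 6)) => [|[|[|[|[|[|//]]]]]] _ /=.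
- by rewrite mulr0n eqxx.
- by rewrite mulr1n (negPf x0).
- exact: negbTE.
- by rewrite x3 (negPf nu0).
- by apply/eqP=> /(four_torsion n_gt1 n_odd) /eqP; apply/negP.
rewrite (mulrnDr x 3 2) x3 addr_eq0; apply/negbTE; rewrite -eqr_oppLR half_turnN eq_sym.
exact: double_neq_half.
Qed.

Definition gensII : seq formal_gen :=
  [:: (0%R, 0%R, false); (0%R, 1%R, false); (0%R, 0%R, true)].

(* The numbers of closed walks of length 8 starting along an edge coloured [c] or [c * E x], and
   along an edge coloured [c * F j], in the bi-Cayley graph of {c, c E x, c F j}. *)
Definition walk_countsII x : nat * nat :=
  if x == nu then (547, 547) else
  if (x *+ 3 == 0)%R then (236, 227) else
  if (x *+ 3 == nu)%R then (225, 225) else (216, 219).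

Lemma count_walksII x j : x != 0%R ->
  [/\ forall i : bool, count (fun a => formal_val Q 0%R x j a == 1)
        (bcay_ends gensII 7 (0%R, 0%R, false) i) = (walk_countsII x).1,
      forall i : bool, count (fun a => formal_val Q 0%R x j a == 1)
        (bcay_ends gensII 7 (0%R, 1%R, false) i) = (walk_countsII x).1 &
      forall i : bool, count (fun a => formal_val Q 0%R x j a == 1)
        (bcay_ends gensII 7 (0%R, 0%R, true) i) = (walk_countsII x).2].
Proof.
move=> x0; have test a : (formal_val Q 0%R x j a == 1) =
    ((a.2 %% 4 == 0) && (x *+ `|a.1.2|%N == 0)%R) ||
    ((a.2 %% 4 == 2) && (x *+ `|a.1.2|%N == nu)%R).
  by rewrite formal_val_eq1 // !mul0rz !add0r Zp_mulrz_eq0 Zp_mulrz_eq_half.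
rewrite /walk_countsII; have [x_nu | x_nu] := eqVneq x nu.
  pose P (a : formal_elt) := ((a.2 %% 4 == 0) && ~~ odd `|a.1.2|%N) ||
                             ((a.2 %% 4 == 2) && odd `|a.1.2|%N).
  have PE a : predT a -> (formal_val Q 0%R x j a == 1) = P a.
    rewrite test x_nu half_turn_mulrn /P; case: (odd _); rewrite /= ?eqxx.
      by rewrite (negPf nu0).
    by rewrite [0%R == _]eq_sym (negPf nu0).
  by split=> i; apply: (count_formal PE); case: i; vm_compute.
have [x3 | x3] := eqVneq (x *+ 3)%R 0%R.
  pose P (a : formal_elt) := (a.2 %% 4 == 0) && (3 %| `|a.1.2|%N)%N.
  have PE a : predT a -> (formal_val Q 0%R x j a == 1) = P a.
    rewrite test mulrn_order3 // /P (_ : (x *+ _ == nu)%R = false) ?andbF ?orbF //.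
    apply/eqP=> xm; have : (x *+ 3 *+ `|a.1.2|%N = nu)%R.
      by rewrite mulrnAC xm half_turn_mulrn.
    by move/eqP; rewrite x3 mul0rn eq_sym (negPf nu0).
  by split=> i; apply: (count_formal PE); case: i; vm_compute.
have [x3nu | x3nu] := eqVneq (x *+ 3)%R nu.
  pose P (a : formal_elt) := ((a.2 %% 4 == 0) && (6 %| `|a.1.2|)%N) ||
                             ((a.2 %% 4 == 2) && (6 %| `|a.1.2| + 3)%N).
  have PE a : predT a -> (formal_val Q 0%R x j a == 1) = P a.
    by rewrite test /P -!(mulrn_order6 _ x_nu x3nu) mulrnDr x3nu addr_eq0 half_turnN.
  by split=> i; apply: (count_formal PE); case: i; vm_compute.
(* In words of length 8 the multiples of x in question do not exceed 4. For 1 <= m <= 4, m x = 0 or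
   m x = [nu] would lead back to the excluded cases, because 2x and 4x are never [nu] and 4x = 0
   gives 2x = 0. *)
pose P (a : formal_elt) := (a.2 %% 4 == 0) && (a.1.2 == 0%R).
have PE a : (`|a.1.2| <= 4)%N -> (formal_val Q 0%R x j a == 1) = P a.
  rewrite test /P -absz_eq0; have x2 := Zp_double_neq0 x0 x_nu.
  have x4 : (x *+ 4 != 0)%R by apply: contraNneq x2 => /(four_torsion n_gt1 n_odd)->.
  have x4nu : (x *+ 4 != nu)%R by rewrite (mulrnA _ 2 2) double_neq_half.
  case: `|a.1.2|%N => [|[|[|[|[|//]]]]] _; rewrite ?mulr0n ?eqxx ?mulr1n.
  - by rewrite [0%R == _]eq_sym (negPf nu0) andbF orbF.
  - by rewrite (negPf x0) (negPf x_nu) !andbF.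
  - by rewrite (negPf x2) (negPf (double_neq_half x)) !andbF.
  - by rewrite (negPf x3) (negPf x3nu) !andbF.
  by rewrite (negPf x4) (negPf x4nu) !andbF.
by split=> i; apply: (count_formal PE); case: i; vm_compute.
Qed.

Lemma set3_seq (a b c : gT) : [set a; b; c] = [set:: [:: a; b; c]].
Proof. by apply/setP=> z; rewrite !inE -orbA. Qed.

Lemma walksII x j c v : x != 0%R ->
  let W s := walks (bcay [set c; c * E x; c * F j]) (nseq 7 true) (nb s v) v in
  [/\ W c = (walk_countsII x).1, W (c * E x) = (walk_countsII x).1 &
      W (c * F j) = (walk_countsII x).2].
Proof.
move=> x0; have [h0 h1 h2] := count_walksII j x0.
have gE : map (gen_val Q 0%R x j) gensII = [:: 1; E x; F j].
  by rewrite /= /gen_val /= !mul0rz !mulr0z mulr1z !add0r qE0 !mulg1 mul1g.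
have gU : uniq (map (gen_val Q 0%R x j) gensII).
  by rewrite gE /= !inE !(eq_sym 1) !q_eqs (negPf x0).
have cE : [seq c * gen_val Q 0%R x j s | s <- gensII] = [:: c; c * E x; c * F j].
  by rewrite (map_comp (mulg c)) gE /= mulg1.
case: gE cE => g0 g1 g2 cE; rewrite set3_seq -cE.
have W s := bcay_walks gU c 7 s v; split.
- by rewrite -{2}[c]mulg1 -g0 W h0.
- by rewrite -g1 W h1.
- by rewrite -g2 W h2.
Qed.

End OddCase.

Lemma bcay_iso_walks (gT : finGroupType) (S T : {set gT}) (h : gT * bool -> gT * bool) :
    bijective h -> (forall u v, bcay T (h u) (h v) = bcay S u v) ->
  forall s v, s \in S -> exists2 t, t \in T & h (nb s v) = nb t (h v) /\
    forall ds, walks (bcay T) ds (nb t (h v)) (h v) = walks (bcay S) ds (nb s v) v.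
Proof.
move=> h_bij h_iso s v /(bcay_iso_nb h_iso v)[t tT ht]; exists t => //.
by split=> // ds; rewrite -ht (walks_iso _ _ _ h_bij h_iso).
Qed.

Lemma iter_cancel (T : Type) (f g : T -> T) m : cancel g f ->
  cancel (iter m g) (iter m f).
Proof. by move=> gK x; elim: m => // m IHm; rewrite iterSr iterS gK. Qed.

(** Edges of the two kinds form closed alternating paths. If h preserves the pair of kinds at each
    vertex, the choice made at v propagates along the path, since an edge is shared by both of its
    ends. A swap only reverses the direction: p' \o q' is inverse to q' \o p' and returns to its
    start after the same number of rounds. *)
Lemma iter_alternate (V W : Type) (p q : V -> V) (p' q' : W -> W) (h : V -> W) v m :
    involutive p -> involutive q -> involutive p' -> involutive q' ->
    (forall w, p' w <> q' w) -> injective h ->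
    (forall u, h (p u) = p' (h u) /\ h (q u) = q' (h u) \/
               h (p u) = q' (h u) /\ h (q u) = p' (h u)) ->
  iter m (q \o p) v = v <-> iter m (q' \o p') (h v) = h v.
Proof.
move=> pK qK p'K q'K pq' h_inj h_pq.
have iter_sym r s w : involutive r -> involutive s ->
    iter m (s \o r) w = w -> iter m (r \o s) w = w :> W.
  by move=> rK sK {1}<-; apply: iter_cancel => u /=; rewrite sK rK.
have walk (r s : W -> W) k : involutive r -> involutive s ->
    (forall u, h (p u) = r (h u) /\ h (q u) = s (h u) \/
               h (p u) = s (h u) /\ h (q u) = r (h u)) ->
    (forall w, r w <> s w) -> h (p v) = r (h v) ->
    h (iter k (q \o p) v) = iter k (s \o r) (h v) /\
    h (p (iter k (q \o p) v)) = r (h (iter k (q \o p) v)).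
  move=> rK sK h_rs rs pv; elim: k => //= k [IHk pk].
  set u := iter k _ v in IHk pk *.
  have qp : h (q (p u)) = s (h (p u)).
    by case: (h_rs (p u)) => -[] //; rewrite pK pk => e; case: (rs (s (r (h u)))); rewrite sK -e.
  split; first by rewrite qp pk IHk.
  case: (h_rs (q (p u))) => -[] // _; rewrite qK qp => e.
  by case: (rs (r (s (h (p u))))); rewrite rK -e.
case: (h_pq v) => -[pv _].
  by have [<- _] := walk _ _ m p'K q'K h_pq pq' pv; split=> [->|/h_inj].
have [||hm _] := walk _ _ m q'K p'K _ _ pv.
- by move=> u; case: (h_pq u); [right | left].
- by move=> w e; apply: (pq' w).
split=> [e | /iter_sym e]; first by apply: iter_sym => //; rewrite -hm e.
by apply: h_inj; rewrite hm e.
Qed.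

Lemma nb_neq (gT : finGroupType) (s t : gT) u : s != t -> nb s u <> nb t u.
Proof. by move=> + e; rewrite (nb_inj e) eqxx. Qed.

Section OddBCI.

Import GRing.Theory.

Variables (n : nat) (gT : finGroupType) (Q : quat_coords n gT).
Hypotheses (n_gt1 : 1 < n) (n_odd : odd n).

Local Notation E := (qE Q).
Local Notation F := (qF Q).
Local Notation nu := (half_turn n).
Local Notation R := 'Z_(2 * n).
Implicit Types (x y i j k l : R) (c d g : gT) (S T : {set gT}) (v : gT * bool).

Let N_gt1 : 1 < 2 * n. Proof. by rewrite mul2n -addnn ltn_addl. Qed.

(** The colours c and c E x alternate along a cycle whose length is twice the order of x, so this
    cycle recovers the order. *)
Lemma iter_nb c x m v :
  iter m (nb (c * E x) \o nb c) v = v <-> (x *+ m = 0)%R.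
Proof.
case: v => g i; have -> : iter m (nb (c * E x) \o nb c) (g, i) =
    (if i then c * E (x *+ m)%R * c^-1 * g else E (- (x *+ m))%R * g, i).
  elim: m => [|m /= ->]; first by rewrite mulr0n oppr0 qE0 /= mulg1 mulgV !mul1g; case: i.
  case: i; rewrite /nb /=; congr (_, _).
    by rewrite mulrS -qEE !mulgA mulgKV.
  by rewrite mulrS opprD -qEE -(qEV _ x) invMg !mulgA mulgKV.
have fixE z g0 : z * g0 = g0 <-> z = 1 :> gT by split=> [/(canRL (mulgK _))|->]; rewrite ?mulgV ?mul1g.
have E1 z : E z = 1 <-> z = 0%R by rewrite -(qE0 Q); split=> [/qE_inj | ->].
case: i => /=; split=> [/(congr1 fst) /= e | xm].
- move: (proj1 (fixE _ _) e) => /(canRL (mulgK _)); rewrite invgK mul1g.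
  by rewrite -[in RHS](mulg1 c) => /mulgI/E1.
- by rewrite xm qE0 mulg1 mulgV mul1g.
- by move: (proj1 (fixE _ _) e) => /E1/eqP; rewrite oppr_eq0 => /eqP.
- by rewrite xm oppr0 qE0 mul1g.
Qed.

(** The two entries of [walk_countsII] differ unless x = [nu] or 3x = [nu]; when they differ, the
    count recognises the edges coloured by F j. *)
Lemma iso_colourII x y c d j l (h : gT * bool -> gT * bool) :
    x != 0%R -> y != 0%R ->
    bijective h ->
    (forall u v, bcay [set d; d * E y; d * F l] (h u) (h v) =
                 bcay [set c; c * E x; c * F j] u v) ->
  walk_countsII x = walk_countsII y /\
  (x != nu -> (x *+ 3 != nu)%R ->
     forall v, h (nb (c * F j) v) = nb (d * F l) (h v)).
Proof.
move=> x0 y0 h_bij h_iso.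
pose W v t := walks (bcay [set c; c * E x; c * F j]) (nseq 7 true) (nb t v) v.
have col s v : s \in [set c; c * E x; c * F j] ->
    h (nb s v) = nb (d * F l) (h v) /\ W v s = (walk_countsII y).2 \/
    h (nb s v) <> nb (d * F l) (h v) /\ W v s = (walk_countsII y).1.
  move=> sS; have [t tT [ht hW]] := bcay_iso_walks h_bij h_iso v sS.
  rewrite /W -(hW (nseq 7 true)) => {W hW}.
  have [W0 W1 W2] := walksII Q n_gt1 n_odd l d (h v) y0.
  have neq z : z != d * F l -> nb z (h v) <> nb (d * F l) (h v) by apply: nb_neq.
  move: tT; rewrite !inE -orbA => /or3P[] /eqP et; rewrite ht et; [right | right | left].
  - by split=> //; apply: neq; rewrite -{1}[d]mulg1 (inj_eq (mulgI d)) eq_sym q_eqs.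
  - by split=> //; apply: neq; rewrite (inj_eq (mulgI d)) q_eqs.
  by [].
have [W0 _ W2] := walksII Q n_gt1 n_odd j c (1, false) x0.
rewrite -/(W _ _) in W0; rewrite -/(W _ _) in W2.
have cS : c \in [set c; c * E x; c * F j] by rewrite !inE eqxx.
have FS : c * F j \in [set c; c * E x; c * F j] by rewrite !inE eqxx !orbT.
have inC (z : R) : [\/ walk_countsII z = (547, 547), walk_countsII z = (236, 227),
    walk_countsII z = (225, 225) | walk_countsII z = (216, 219)].
  by rewrite /walk_countsII; do 3?[case: ifP => _]; constructor.
(* No number occurs in two of the four pairs, so a single common value identifies the pair. *)
have Cxy : walk_countsII x = walk_countsII y.
  have := col _ (1, false) cS; have := col _ (1, false) FS; rewrite W0 W2.
  move: {col W0 W2} (walk_countsII x) (walk_countsII y) (inC x) (inC y) => p q.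
  by case=> -> [] -> [] [_ +] [] [_ +] /=.
split=> // xnu x3nu v.
have := col _ v FS; have [_ _ W2v] := walksII Q n_gt1 n_odd j c v x0.
rewrite /W W2v.
case=> -[] //; rewrite -Cxy /walk_countsII (negPf xnu) (negPf x3nu).
by case: ifP.
Qed.

(** Equal counts settle the orders 2, 3 and 6. Otherwise the colour of F j is preserved, and
    deleting its edges leaves the alternating cycles, whose lengths give the order. *)
Lemma bcay_isoII x y c d j l : x != 0%R -> y != 0%R ->
  graph_iso (bcay [set c; c * E x; c * F j]) (bcay [set d; d * E y; d * F l]) ->
  exists2 k, k \is a GRing.unit & (k * x = y)%R.
Proof.
move=> x0 y0 [h [h_bij h_iso]]; have [Cxy Fh] := iso_colourII x0 y0 h_bij h_iso.
have [x_nu | x_nu] := eqVneq x nu.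
  exists 1%R; rewrite ?unitr1 // mul1r x_nu; apply/esym/eqP.
  move: Cxy; rewrite /walk_countsII x_nu eqxx; case: eqP => // _.
  by do 2?[case: ifP => _].
have y_nu : y != nu.
  apply/eqP=> y_nu; move: Cxy; rewrite /walk_countsII y_nu eqxx (negPf x_nu).
  by do 2?[case: ifP => _].
apply: unit_ann => // m.
have [x3 | x3] := eqVneq (x *+ 3)%R 0%R.
  have y3 : (y *+ 3 = 0)%R.
    apply/eqP/negPn/negP => y3; move: Cxy.
    by rewrite /walk_countsII (negPf x_nu) (negPf y_nu) x3 eqxx (negPf y3); case: ifP.
  by split=> /eqP; rewrite !mulrn_order3 // => dm; apply/eqP; rewrite mulrn_order3.
have y3 : (y *+ 3 != 0)%R.
  apply/eqP=> y3; move: Cxy.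
  by rewrite /walk_countsII (negPf x_nu) (negPf y_nu) y3 eqxx (negPf x3); case: ifP.
have [x3nu | x3nu] := eqVneq (x *+ 3)%R nu.
  have y3nu : (y *+ 3 = nu)%R.
    apply/eqP/negPn/negP => y3nu; move: Cxy.
    rewrite /walk_countsII (negPf x_nu) (negPf y_nu) (negPf y3) (negPf x3) x3nu eqxx.
    by rewrite (negPf y3nu).
  by split=> /eqP; rewrite !mulrn_order6 // => dm; apply/eqP; rewrite mulrn_order6.
have cEx z (a : gT) : z != 0%R -> a != a * E z.
  by move=> z0; rewrite -{1}[a]mulg1 (inj_eq (mulgI a)) eq_sym q_eqs.
rewrite -(iter_nb c x m (1, false)) -(iter_nb d y m (h (1, false))).
apply: iter_alternate; try exact: nbK.
- by move=> w; apply/nb_neq/cEx.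
- exact: (bij_inj h_bij).
move=> u; have Fu := Fh x_nu x3nu u.
have col s : s \in [set c; c * E x; c * F j] -> s != c * F j ->
    h (nb s u) = nb d (h u) \/ h (nb s u) = nb (d * E y) (h u).
  move=> sS sF; have [t tT ht] := bcay_iso_nb h_iso u sS.
  move: tT; rewrite !inE -orbA => /or3P[] /eqP et; rewrite ht et; [by left | by right |].
  by case: (@nb_neq _ s (c * F j) u sF); apply: (bij_inj h_bij); rewrite Fu ht et.
have cS : c \in [set c; c * E x; c * F j] by rewrite !inE eqxx.
have xS : c * E x \in [set c; c * E x; c * F j] by rewrite !inE eqxx orbT.
have cF : c != c * F j by rewrite -{1}[c]mulg1 (inj_eq (mulgI c)) eq_sym q_eqs.
have xF : c * E x != c * F j by rewrite (inj_eq (mulgI c)) q_eqs.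
have no e : h (nb c u) = e -> h (nb (c * E x) u) = e -> False.
  by move=> <- /(bij_inj h_bij)/esym; apply: nb_neq (cEx _ c x0).
case: (col c cS cF) => e0; case: (col _ xS xF) => e1; [|by left|by right|];
  by case: (no _ e0 e1).
Qed.

End OddBCI.

Lemma card3_set (T : finType) (A : {set T}) : #|A| = 3 ->
  exists a b c, [/\ A = [set a; b; c], a != b, a != c & b != c].
Proof.
rewrite cardE; move: (enum_uniq A) (set_enum A).
case: (enum A) => [|a [|b [|c []]]] //= /and3P[]; rewrite !inE negb_or.
move=> /andP[ab ac] bc _ AE _; exists a, b, c; split=> //.
by apply/setP=> x; rewrite -AE !inE orbA.
Qed.

(** * Bi-Cayley graphs of subsets of the cyclic subgroup *)

Section ColourI.

Import GRing.Theory.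

Variables (n : nat) (gT : finGroupType) (Q : quat_coords n gT).
Hypotheses (n_gt1 : 1 < n) (n_odd : odd n).

Local Notation E := (qE Q).
Local Notation R := 'Z_(2 * n).
Implicit Types (a b c i j k l p q r : R) (A B : {set R}) (v w : gT * bool).

Let N_gt1 : 1 < 2 * n. Proof. by rewrite mul2n -addnn ltn_addl. Qed.

Lemma nb_comp3 i j k v :
  nb (E k) (nb (E j) (nb (E i) v)) = nb (E (i - j + k)%R) v.
Proof.
by case: v => g []; rewrite /nb /= ?mulgA !qM; congr (E _ * _, _); ring.
Qed.

Lemma nbE_inj v : injective (fun i => nb (E i) v).
Proof. by move=> i j /nb_inj/qE_inj. Qed.

Definition affine_equiv A B :=
  exists2 k, k \is a GRing.unit & exists c, B = [set (k * i + c)%R | i in A].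

Lemma affine_equiv_trans A B C :
  affine_equiv A B -> affine_equiv B C -> affine_equiv A C.
Proof.
case=> k kU [c ->] [l lU [d ->]]; exists (l * k)%R; first by rewrite unitrM lU.
exists (l * c + d)%R; rewrite -imset_comp; apply: eq_imset => i /=.
by ring.
Qed.

Lemma affine_equiv_sym A B : affine_equiv A B -> affine_equiv B A.
Proof.
case=> k kU [c ->]; exists (k^-1)%R; first by rewrite unitrV.
exists (- (k^-1 * c))%R; rewrite -imset_comp -[LHS]imset_id; apply: eq_imset => i /=.
by rewrite mulrDr mulKr // addrK.
Qed.

Lemma affine_bequiv A B : affine_equiv A B -> bequiv (E @: A) (E @: B).
Proof.
case=> k kU [c ->]; have [alpha aA [aE _]] := qaut Q n_gt1 0%R kU.
exists (E c), alpha; split=> //; rewrite lcosetE' -!imset_comp.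
by apply: eq_imset => i /=; rewrite aE qEE addrC.
Qed.

Variables (A B : {set R}) (h : gT * bool -> gT * bool).
Hypotheses (h_bij : bijective h)
  (h_iso : forall u v, bcay (E @: B) (h u) (h v) = bcay (E @: A) u v).

(** The colour is recorded vertex by vertex, since h may permute colours differently at different
    vertices. The default 0 never arises for i in A. *)
Definition colour v i : R :=
  odflt 0%R [pick j in B | h (nb (E i) v) == nb (E j) (h v)].

Lemma colourP v i : i \in A ->
  colour v i \in B /\ h (nb (E i) v) = nb (E (colour v i)) (h v).
Proof.
move=> iA; have [_ /imsetP[j jB ->] hj] := bcay_iso_nb h_iso v (imset_f E iA).
rewrite /colour; case: pickP => [j' /andP[j'B /eqP hj'] | /(_ j)] //.
by rewrite jB hj eqxx.
Qed.

Lemma colour_eq v i j : i \in A -> h (nb (E i) v) = nb (E j) (h v) -> colour v i = j.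
Proof.
move=> iA hj; have [_ hc] := colourP v iA; apply: (@nbE_inj (h v)).
by rewrite -hc hj.
Qed.

Lemma colour_inj v : {in A &, injective (colour v)}.
Proof.
move=> i j iA jA e; apply: (@nbE_inj v); apply: (bij_inj h_bij).
by have [_ ->] := colourP v iA; have [_ ->] := colourP v jA; rewrite e.
Qed.

Lemma colour_onto v j : j \in B -> exists2 i, i \in A & h (nb (E i) v) = nb (E j) (h v).
Proof.
move=> jB; have [g hK gK] := h_bij.
have: bcay (E @: A) v (g (nb (E j) (h v))).
  by rewrite -h_iso gK; apply/bcayP; exists (E j); rewrite ?imset_f.
by case/bcayP=> _ /imsetP[i iA ->] e; exists i; rewrite // -e gK.
Qed.

Lemma colour_back v i : i \in A -> colour (nb (E i) v) i = colour v i.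
Proof.
move=> iA; apply: colour_eq => //; have [_ ->] := colourP v iA.
by rewrite !nbK.
Qed.

(** The path i, j, i has an image coloured p, q, r. Exponents commute, so the path r, q, p has the
    same ends; its preimage is a walk from v with the ends of i, j, i, hence starts with i, and its
    first edge goes to colour r. So r = p. *)
Lemma colour_unique_path v i j : i \in A -> j \in A ->
    (forall a b c, a \in A -> b \in A -> c \in A ->
       (a - b + c = i - j + i)%R -> a = i) ->
  colour (nb (E j) (nb (E i) v)) i = colour v i.
Proof.
move=> iA jA uniq_path; set r := colour _ i.
pose p := colour v i; pose q := colour (nb (E i) v) j.
have [pB hp] := colourP v iA; have [qB hq] := colourP (nb (E i) v) jA.
have [rB hr] := colourP (nb (E j) (nb (E i) v)) iA.
have [a aA ha] := colour_onto v rB; have [b bA hb] := colour_onto (nb (E a) v) qB.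
have [c cA hc] := colour_onto (nb (E b) (nb (E a) v)) pB.
have a_i : a = i.
  apply: (uniq_path a b c) => //; apply: (@nbE_inj v); apply: (bij_inj h_bij).
  rewrite /= -!nb_comp3 hc hb ha hr hq hp !nb_comp3 -/p -/q -/r.
  by congr (nb (E _) _); ring.
by have := colour_eq aA ha; rewrite a_i => ->.
Qed.

Hypothesis colour_two : forall v i j, i \in A -> j \in A -> i != j ->
  colour (nb (E j) (nb (E i) v)) i = colour v i.

(** The i-edges at the two ends of a j-edge are the first and the last edge of a path i, j, i, and
    an edge has the same colour seen from either end. *)
Lemma colour_const v i j : i \in A -> j \in A -> colour (nb (E j) v) i = colour v i.
Proof.
move=> iA jA; have [-> | ij] := eqVneq i j; first exact: colour_back.
rewrite -[in RHS](nbK (E j) v); set w := nb (E j) v.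
rewrite -[in RHS](nbK (E i) w) colour_two //.
by rewrite colour_back.
Qed.

(** With constant colours, h sends the displacement by i - a0 to the displacement by f i - f a0. So
    the differences on both sides satisfy the same relations, and [unit_rel3] provides the unit. *)
Lemma colour_affine : #|A| = 3 -> #|B| = 3 -> affine_equiv A B.
Proof.
move=> A3 B3; have [a0 [a1 [a2 [AE _ _ _]]]] := card3_set A3.
have [a0A a1A a2A] : [/\ a0 \in A, a1 \in A & a2 \in A].
  by rewrite AE !inE !eqxx !orbT.
pose v0 : gT * bool := (1, false); pose f := colour v0.
pose pt (d : R) : gT * bool := (E d, false).
(* If h exchanges the two halves, a pair of steps first divides and then multiplies, which reverses
   the displacement. *)
pose im (d : R) : gT * bool :=
  (E (if (h v0).2 then - d else d)%R * (h v0).1, (h v0).2).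
pose X1 := (f a1 - f a0)%R; pose X2 := (f a2 - f a0)%R.
have step d e i : i \in A -> h (pt d) = im e ->
    (forall l, l \in A -> colour (pt d) l = f l) ->
    h (pt (d + (i - a0))%R) = im (e + (f i - f a0))%R /\
    (forall l, l \in A -> colour (pt (d + (i - a0))%R) l = f l).
  move=> iA hd cd; have -> : pt (d + (i - a0))%R = nb (E a0) (nb (E i) (pt d)).
    by rewrite /pt /nb /= !qM; congr (E _, _); ring.
  split; last by move=> l lA; rewrite !colour_const // cd.
  have [_ ->] := colourP (nb (E i) (pt d)) a0A; have [_ ->] := colourP (pt d) iA.
  rewrite colour_const // !cd // hd /im; case: (h v0) => g [] /=; rewrite /nb /= !mulgA !qM;
    by congr (E _ * _, _); ring.
have walk (l m : nat) : h (pt ((a1 - a0) *+ l + (a2 - a0) *+ m)%R) = im (X1 *+ l + X2 *+ m)%R /\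
    (forall i, i \in A -> colour (pt ((a1 - a0) *+ l + (a2 - a0) *+ m)%R) i = f i).
  elim: l => [|l [IHl cl]]; last first.
    have [] := step _ _ a1 a1A IHl cl; rewrite -/X1.
    by rewrite ![(_ + (a1 - a0))%R]addrC ![(_ + X1)%R]addrC !addrA -!mulrS.
  elim: m => [|m [IHm cm]]; last first.
    have [] := step _ _ a2 a2A IHm cm; rewrite -/X2.
    by rewrite -!addrA -!mulrSr.
  rewrite !mulr0n addr0 /pt /im qE0 -/v0; split=> //.
  by case: (h v0) => g []; rewrite /= ?oppr0 qE0 mul1g.
have rel (l m p : nat) : ((a1 - a0) *+ l + (a2 - a0) *+ m + 0 *+ p = 0 <->
                  X1 *+ l + X2 *+ m + 0 *+ p = 0)%R.
  rewrite !mul0rn !addr0; have [hlm _] := walk l m; have [h0 _] := walk 0 0.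
  rewrite !mulr0n !addr0 in h0; split=> e.
    have := hlm; rewrite e h0 => -[]; case: (h v0).2 => /mulIg/qE_inj; rewrite ?oppr0 => // /eqP.
    by rewrite eq_sym oppr_eq0 => /eqP.
  have : h (pt ((a1 - a0) *+ l + (a2 - a0) *+ m)%R) = h (pt 0%R) by rewrite hlm h0 e.
  by move/(bij_inj h_bij) => -[/qE_inj].
have [k kU [k1 k2 _]] := unit_rel3 N_gt1 rel.
have fB i : i \in A -> f i \in B by move=> iA; have [] := colourP v0 iA.
have fI := @colour_inj v0.
have BE : B = f @: A.
  apply/esym/eqP; rewrite eqEcard card_in_imset // A3 B3 leqnn andbT.
  by apply/subsetP=> _ /imsetP[i iA ->]; apply: fB.
exists k => //; exists (f a0 - k * a0)%R; rewrite BE; apply: eq_in_imset => i.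
rewrite AE !inE -orbA => /or3P[] /eqP ->.
- by rewrite addrC subrK.
- by move: k1; rewrite /X1 mulrBr => /(canRL (subrK _)) ->; ring.
by move: k2; rewrite /X2 mulrBr => /(canRL (subrK _)) ->; ring.
Qed.

End ColourI.

Section ClassesI.

Import GRing.Theory.

Variables (n : nat) (gT : finGroupType) (Q : quat_coords n gT).
Hypotheses (n_gt1 : 1 < n) (n_odd : odd n).

Local Notation nu := (half_turn n).
Local Notation R := 'Z_(2 * n).
Implicit Types (a b c d e i j l s t u w x y z : R) (A B : {set R}) (v : gT * bool).

(* A is rigid if, for i != j, every walk of length 3 with the same ends as the walk coloured
   i, j, i also starts with the colour i. The non-rigid triples form the classes 1 to 4. *)
Definition rigid A :=
  [forall i in A, forall j in A, (i != j) ==>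
    [forall a in A, forall b in A, forall c in A,
      (a - b + c == i - j + i)%R ==> (a == i)]].

(** The four classes encode the relations 2x = 2y, 2x = y + z, 3x = 3y and 3x = 2y + z between
    distinct members of the triple. *)
Definition class1 A := exists s t, [/\ A = [set s; (s + nu)%R; t], t != s & t != (s + nu)%R].
Definition class2 A := exists s e,
  [/\ A = [set s; (s + e)%R; (s - e)%R], e != 0%R & (e *+ 2 != 0)%R].
Definition class3 A := exists s w t,
  [/\ A = [set s; (s + w)%R; t], w != 0%R, (w *+ 3 = 0)%R, t != s & t != (s + w)%R].
Definition class4 A := exists s e,
  [/\ A = [set s; (s + e)%R; (s - e *+ 2)%R], e != 0%R, (e *+ 2 != 0)%R & (e *+ 3 != 0)%R].

Section Triple.

Variables (A : {set R}) (x y z : R).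
Hypotheses (AE : A = [set x; y; z]) (xy : x != y) (xz : x != z) (yz : y != z).

Lemma double_class1 : (x *+ 2 = y *+ 2)%R -> class1 A.
Proof.
move=> e; have [] := @two_torsion n n_gt1 (y - x)%R; first by rewrite mulrnBl e subrr.
  by move/eqP; rewrite subr_eq0 eq_sym (negPf xy).
by move/eqP; rewrite subr_eq addrC => /eqP yE; exists x, z; rewrite -yE !(eq_sym z).
Qed.

Lemma double_class2 : (x *+ 2 = y + z)%R -> class2 A.
Proof.
move=> e; exists x, (y - x)%R; have zE : z = (x - (y - x))%R.
  by apply: (addrI y); rewrite -e; ring.
rewrite -zE addrC subrK subr_eq0 eq_sym; split=> //.
apply: contraNneq yz => e2; rewrite -subr_eq0 zE -e2; apply/eqP; ring.
Qed.

Lemma triple_class3 : (x *+ 3 = y *+ 3)%R -> class3 A.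
Proof.
move=> e; exists x, (y - x)%R, z; rewrite [(x + _)%R]addrC subrK subr_eq0 !(eq_sym z) eq_sym.
by split; rewrite // 1?eq_sym // mulrnBl e subrr.
Qed.

Lemma triple_class4 : (x *+ 3 = y *+ 2 + z)%R -> class4 A.
Proof.
move=> e; exists x, (y - x)%R; have zE : z = (x - (y - x) *+ 2)%R.
  by apply: (addrI (y *+ 2)%R); rewrite -e; ring.
rewrite -zE [(x + _)%R]addrC subrK subr_eq0 eq_sym; split=> //.
  by apply: contraNneq xz => e2; rewrite zE e2 subr0.
by apply: contraNneq yz => e3; rewrite -subr_eq0 zE -e3; apply/eqP; ring.
Qed.

End Triple.

(** Proves an equation the difference of whose sides is, up to sign, the left side of
    [e : _ = 0]. *)
Local Ltac lin0 e := apply/eqP; rewrite -subr_eq0;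
  first [by apply/eqP; rewrite -e; ring | by rewrite -oppr_eq0; apply/eqP; rewrite -e; ring].

Lemma card3_third A i j : #|A| = 3 -> i \in A -> j \in A -> i != j ->
  exists l, [/\ A = [set i; j; l], i != l & j != l].
Proof.
move=> A3 iA jA ij; have [p [q [r [AE pq pr qr]]]] := card3_set A3.
move: iA jA; rewrite {1 2}AE !inE -!orbA => /or3P[] /eqP ei /or3P[] /eqP ej;
  rewrite ei ej ?eqxx // in ij *;
  [exists r | exists q | exists r | exists p | exists q | exists p];
  split; rewrite // 1?eq_sym //; rewrite AE; apply/setP=> z; rewrite !inE;
  by do 3?[case: (z == _)].
Qed.

(** Each choice of a, b, c in {i, j, l} with a != i turns the equation into a contradiction or one
    of the four relations. The third alternative keeps the pair (i, j), because the treatment of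
    class 3 has to exclude it for j = t. *)
Lemma path_class A i j a b c : #|A| = 3 -> i \in A -> j \in A -> i != j ->
    a \in A -> b \in A -> c \in A -> (a - b + c = i - j + i)%R -> a != i ->
  [\/ class1 A, class2 A, (i *+ 3 = j *+ 3)%R | class4 A].
Proof.
move=> A3 iA jA ij aA bA cA eq ai.
have [l [AE il jl]] := card3_third A3 iA jA ij.
have AE1 : A = [set j; i; l].
  by rewrite AE; apply/setP=> z; rewrite !inE; do 3?[case: (z == _)].
have AE2 : A = [set i; l; j].
  by rewrite AE; apply/setP=> z; rewrite !inE; do 3?[case: (z == _)].
have AE3 : A = [set l; i; j].
  by rewrite AE; apply/setP=> z; rewrite !inE; do 3?[case: (z == _)].
have AE4 : A = [set j; l; i].
  by rewrite AE; apply/setP=> z; rewrite !inE; do 3?[case: (z == _)].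
have AE5 : A = [set l; j; i].
  by rewrite AE; apply/setP=> z; rewrite !inE; do 3?[case: (z == _)].
have [ji li lj] : [/\ j != i, l != i & l != j] by split; rewrite eq_sym.
have eq0 : (a - b + c - (i - j + i) = 0)%R by rewrite eq subrr.
move: aA bA cA ai; rewrite {1 2 3}AE !inE -!orbA.
by move=> /or3P[] /eqP ea /or3P[] /eqP eb /or3P[] /eqP ec; rewrite ea eb ec ?eqxx // in eq0 *; move=> _;
  first [ by case/eqP: ij; lin0 eq0
  | by case/eqP: il; lin0 eq0
  | by case/eqP: jl; lin0 eq0
  | by apply: Or41; apply: (double_class1 AE) => //; lin0 eq0
  | by apply: Or41; apply: (double_class1 AE2) => //; lin0 eq0
  | by apply: Or41; apply: (double_class1 AE4) => //; lin0 eq0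
  | by apply: Or42; apply: (double_class2 AE) => //; lin0 eq0
  | by apply: Or42; apply: (double_class2 AE1) => //; lin0 eq0
  | by apply: Or42; apply: (double_class2 AE3) => //; lin0 eq0
  | by apply: Or43; lin0 eq0
  | by apply: Or44; apply: (triple_class4 AE) => //; lin0 eq0
  | by apply: Or44; apply: (triple_class4 AE1) => //; lin0 eq0
  | by apply: Or44; apply: (triple_class4 AE2) => //; lin0 eq0
  | by apply: Or44; apply: (triple_class4 AE3) => //; lin0 eq0
  | by apply: Or44; apply: (triple_class4 AE4) => //; lin0 eq0
  | by apply: Or44; apply: (triple_class4 AE5) => //; lin0 eq0 ].
Qed.

Lemma nonrigid_class A : #|A| = 3 -> ~~ rigid A ->
  [\/ class1 A, class2 A, class3 A | class4 A].
Proof.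
move=> A3; rewrite negb_forall_in => /exists_inP[i iA].
rewrite negb_forall_in => /exists_inP[j jA]; rewrite negb_imply => /andP[ij].
rewrite negb_forall_in => /exists_inP[a aA]; rewrite negb_forall_in => /exists_inP[b bA].
rewrite negb_forall_in => /exists_inP[c cA]; rewrite negb_imply => /andP[/eqP eq ai].
have [l [AE il jl]] := card3_third A3 iA jA ij.
have [||e3|] := path_class A3 iA jA ij aA bA cA eq ai.
- by apply: Or41.
- by apply: Or42.
- by apply/Or43/(triple_class3 AE).
by apply: Or44.
Qed.

End ClassesI.

(** * Closed walks in the bi-Cayley graphs of non-rigid triples *)

Section CountsI.

Import GRing.Theory.

Variables (n : nat) (gT : finGroupType) (Q : quat_coords n gT).
Hypotheses (n_gt1 : 1 < n) (n_odd : odd n).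

Local Notation E := (qE Q).
Local Notation F := (qF Q).
Local Notation nu := (half_turn n).
Local Notation R := 'Z_(2 * n).
Implicit Types (d e i s t u w x y : R) (A B : {set R}) (v : gT * bool).

Let N_gt1 : 1 < 2 * n. Proof. by rewrite mul2n -addnn ltn_addl. Qed.
Let nu0 : nu != 0%R := half_turn_neq0 n_gt1.

(** The first edge is prescribed, so these closed walks have length k + 1: they are used with length
    4 and length 6. *)
Definition closed_walks A k v i := walks (bcay (E @: A)) (nseq k true) (nb (E i) v) v.

Definition gensI (al be : int) : seq formal_gen :=
  [:: (0%R, 0%R, false); (1%R, 0%R, false); (al, be, false)].

Definition formal_sum u x (a : formal_elt) : R := (u *~ a.1.1 + x *~ a.1.2)%R.

(* The colour of the edges is listed by its position in [gensI]. *)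
Lemma closed_walksI s s1 s2 u x al be k v (P : pred formal_elt) (bound : pred formal_elt)
    (N0 N1 N2 : nat) :
    s1 = (s + u)%R -> s2 = (s + (u *~ al + x *~ be))%R -> uniq [:: s; s1; s2] ->
    (forall a, bound a -> (formal_sum u x a == 0)%R = P a) ->
    (forall i : bool, all (fun a : formal_elt => (a.2 == 0) && bound a)
       (flatten [seq bcay_ends (gensI al be) k g i | g <- gensI al be])) ->
    (forall i : bool, [seq count P (bcay_ends (gensI al be) k g i) | g <- gensI al be]
       = [:: N0; N1; N2]) ->
  [/\ closed_walks [set s; s1; s2] k v s = N0,
      closed_walks [set s; s1; s2] k v s1 = N1 &
      closed_walks [set s; s1; s2] k v s2 = N2].
Proof.
move=> -> ->; set t := (_ + x *~ be)%R; move=> st_uniq boundP ends_bound endsP.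
have gE : map (gen_val Q u x 0%R) (gensI al be) = [:: 1; E u; E t].
  by rewrite /= /gen_val /= !mulr0z mulr1z !addr0 qE0 !mulg1.
have gU : uniq (map (gen_val Q u x 0%R) (gensI al be)).
  have: uniq [:: s + 0; s + u; s + t]%R by rewrite addr0.
  by rewrite gE /= !inE !negb_or !andbT !(inj_eq (addrI s)) !(eq_sym 1) !q_eqs.
have SE : E @: [set s; s + u; s + t]%R =
    [set:: [seq E s * gen_val Q u x 0%R g | g <- gensI al be]].
  rewrite (map_comp (mulg (E s))) gE /= mulg1 !qEE.
  by rewrite !imsetU !imset_set1 set3_seq.
have cnt g : g \in gensI al be ->
    count (fun a => formal_val Q u x 0%R a == 1) (bcay_ends (gensI al be) k g v.2) =
    count P (bcay_ends (gensI al be) k g v.2).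
  move=> g_in; apply: eq_in_count => a a_in.
  have /allP/(_ a) := ends_bound v.2; have -> : a \in flatten
      [seq bcay_ends (gensI al be) k g0 v.2 | g0 <- gensI al be].
    by apply/flatten_mapP; exists g.
  move=> /(_ isT) /andP[/eqP a2 /boundP <-]; rewrite formal_val_eq1 // a2 /=.
  by rewrite orbF.
have Wg g : g \in gensI al be -> walks (bcay (E @: [set s; s + u; s + t]%R))
    (nseq k true) (nb (E s * gen_val Q u x 0%R g) v) v =
    count P (bcay_ends (gensI al be) k g v.2).
  by move=> g_in; rewrite SE bcay_walks // cnt.
case: gE (endsP v.2) => g0 g1 g2 [<- <- <-]; rewrite /closed_walks.
rewrite -!Wg ?inE ?eqxx ?orbT // g0 g1 g2 mulg1 !qEE.
by [].
Qed.

Lemma uniq3 (T : eqType) (a b c : T) : a != b -> a != c -> b != c -> uniq [:: a; b; c].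
Proof. by move=> ab ac bc; rewrite /= !inE negb_or ab ac bc. Qed.

Lemma half_turn_mulrz (b : int) : (nu *~ b = if odd `|b|%N then nu else 0)%R.
Proof.
case: b => m; first exact: half_turn_mulrn.
rewrite NegzE mulrNz [X in (- X)%R]half_turn_mulrn -[absz _]/(m.+1).
by case: (odd _); rewrite ?oppr0 ?half_turnN.
Qed.

(** In a cubic graph 5 closed walks of length 4 with a given first edge retrace their edges. The
    only 4-cycles alternate between s and s + [nu], and add one for these two colours. *)
Lemma walks_class1 s t v (W := closed_walks [set s; (s + nu)%R; t] 3 v) :
  t != s -> t != (s + nu)%R ->
  [/\ W s = 6, W (s + nu)%R = 6 & W t = 5].
Proof.
move=> ts tsnu; pose x := (t - s)%R.
have x0 : x != 0%R by rewrite subr_eq0.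
have xnu : x != nu by rewrite subr_eq addrC.
have tE : t = (s + (nu *~ 0 + x *~ 1))%R by rewrite mulr0z mulr1z add0r addrC subrK.
pose bound (a : formal_elt) := (`|a.1.2| <= 2)%N.
pose P (a : formal_elt) := (`|a.1.2|%N == 0) && ~~ odd `|a.1.1|%N.
apply: (closed_walksI (P := P) (bound := bound) v erefl tE).
- by apply: uniq3; rewrite 1?eq_sym // addrC -subr_eq0 addrK.
- move=> a; rewrite /bound /P /formal_sum half_turn_mulrz => a2.
  have x2 := Zp_double_neq0 n_gt1 x0 xnu; have x2nu := double_neq_half n_gt1 n_odd x.
  case: (odd _); rewrite ?add0r ?andbF ?andbT.
    rewrite addrC addr_eq0 half_turnN Zp_mulrz_eq_half.
    by case: `|_|%N a2 => [|[|[|//]]] _; rewrite ?mulr0n ?mulr1n; apply/negbTE; rewrite // eq_sym.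
  rewrite Zp_mulrz_eq0.
  by case: `|_|%N a2 => [|[|[|//]]] _; rewrite ?mulr0n ?mulr1n ?eqxx //; apply/negbTE.
- by case; vm_compute.
by case; vm_compute.
Qed.

(** The 4-cycles are coloured s, s + e, s, s - e: two of them pass through an edge coloured s and
    one through any other edge. If 3e = 0 the components are complete bipartite graphs on 3 + 3
    vertices, whence 3 * 3 = 9. *)
Lemma walks_class2 s e v (W := closed_walks [set s; (s + e)%R; (s - e)%R] 3 v) :
  e != 0%R -> (e *+ 2 != 0)%R ->
  if (e *+ 3 == 0)%R then [/\ W s = 9, W (s + e)%R = 9 & W (s - e)%R = 9]
  else [/\ W s = 7, W (s + e)%R = 6 & W (s - e)%R = 6].
Proof.
move=> e0 e2; have enu : e != nu.
  by apply: contraNneq e2 => ->; rewrite mulr2n half_turnD.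
have tE : (s - e = s + (e *~ (- 1) + 0 *~ 0))%R by rewrite mulrNz mulr1z mulr0z addr0.
have U : uniq [:: s; s + e; s - e]%R.
  apply: uniq3; rewrite -subr_eq0.
  - by rewrite (_ : s - (s + e) = - e)%R ?oppr_eq0 //; ring.
  - by rewrite (_ : s - (s - e) = e)%R //; ring.
  by rewrite (_ : s + e - (s - e) = e *+ 2)%R //; ring.
case: eqP => [e3 | /eqP e3].
  pose P (a : formal_elt) := (3 %| `|a.1.1|)%N.
  apply: (closed_walksI (P := P) (bound := predT) v erefl tE U).
  - by move=> a _; rewrite /formal_sum mul0rz addr0 Zp_mulrz_eq0 mulrn_order3.
  - by case; vm_compute.
  by case; vm_compute.
pose bound (a : formal_elt) := (`|a.1.1| <= 4)%N.
pose P (a : formal_elt) := (`|a.1.1|%N == 0).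
apply: (closed_walksI (P := P) (bound := bound) v erefl tE U).
- move=> a a4; rewrite /formal_sum mul0rz addr0 Zp_mulrz_eq0 /P.
  have e4 : (e *+ 4 != 0)%R by apply: contraNneq e2 => /(four_torsion n_gt1 n_odd)->.
  by move: a4; rewrite /bound; case: `|_|%N => [|[|[|[|[|//]]]]] _;
     rewrite ?mulr0n ?mulr1n ?eqxx //; apply/negbTE.
- by case; vm_compute.
by case; vm_compute.
Qed.

Lemma Zp_torsion3 w y : w != 0%R -> (w *+ 3 = 0 -> y *+ 3 = 0)%R ->
  (w *+ 3 = 0)%R -> [\/ y = 0%R, y = w | y = (- w)%R].
Proof.
move=> w0 y3 w3; have [|c ->] := @ann_multiple _ N_gt1 w y.
  move=> m /eqP; rewrite mulrn_order3 // => /dvdnP[q ->].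
  by rewrite [(q * 3)%N]mulnC mulrnA y3 // mul0rn.
rewrite (divn_eq c 3) [(c %/ 3 * 3)%N]mulnC mulrnDr mulrnA w3 mul0rn add0r.
case: (c %% 3) (ltn_pmod c (isT : 0 < 3)) => [|[|[|//]]] _.
- by apply: Or31; rewrite mulr0n.
- by apply: Or32; rewrite mulr1n.
by apply: Or33; apply/eqP; rewrite -addr_eq0 -mulrSr w3.
Qed.

Lemma mulrz_mod3 w (b : int) : w != 0%R -> (w *+ 3 = 0)%R ->
  if (3 %| `|b|)%N then (w *~ b = 0)%R else (w *~ b = w \/ w *~ b = - w)%R.
Proof.
move=> w0 w3; have m3 m : if (3 %| m)%N then (w *+ m = 0)%R else (w *+ m = w \/ w *+ m = - w)%R.
  rewrite (divn_eq m 3) [(m %/ 3 * 3)%N]mulnC mulrnDr mulrnA w3 mul0rn add0r.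
  rewrite dvdn_addr ?dvdn_mulr //.
  case: (m %% 3) (ltn_pmod m (isT : 0 < 3)) => [|[|[|//]]] _ /=.
  - by rewrite mulr0n.
  - by left; rewrite mulr1n.
  by right; apply/eqP; rewrite -addr_eq0 -mulrSr w3.
case: b => m; first exact: m3.
rewrite NegzE mulrNz -pmulrn -[absz _]/(m.+1).
have := m3 m.+1; case: ifP => _; first by move->; rewrite oppr0.
by case=> ->; [right | left; rewrite opprK].
Qed.

(** For length 6, 29 walks retrace their edges and the two hexagons coloured i, j, k, i, j, k from
    commutativity make 31. The hexagon alternating between s and s + w, closed because 3w = 0, adds
    one for these colours and so singles out t. Excluding the other classes rules out further short
    cycles. *)
Lemma walks_class3 s w t v (A := [set s; (s + w)%R; t]) :
    w != 0%R -> (w *+ 3 = 0)%R -> t != s -> t != (s + w)%R ->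
    ~ class1 A -> ~ class2 A -> ~ class4 A ->
  [/\ closed_walks A 3 v s = 5, closed_walks A 3 v (s + w)%R = 5 &
      closed_walks A 3 v t = 5] /\
  [/\ closed_walks A 5 v s = 32, closed_walks A 5 v (s + w)%R = 32 &
      closed_walks A 5 v t = 31].
Proof.
move=> w0 w3 ts tsw n1 n2 n4; pose y := (t - s)%R.
have tE : t = (s + y)%R by rewrite addrC subrK.
have ssw : s != (s + w)%R by rewrite -subr_eq0 opprD addrA subrr add0r oppr_eq0.
have [st swt sws] : [/\ s != t, (s + w)%R != t & (s + w)%R != s] by split; rewrite eq_sym.
have A1 : A = [set t; s; (s + w)%R] by rewrite /A setUC setUA.
have A2 : A = [set t; (s + w)%R; s] by rewrite A1 -setUA [[set s] :|: _]setUC setUA.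
have w2 : (w *+ 2 = - w)%R by apply/eqP; rewrite -addr_eq0 -mulrSr w3.
(* None of y, 2y, 3y lies in {0, w, -w}: each coincidence would put the triple into an excluded
   class or make its members equal. *)
have y1 : [&& y != 0%R, y != w & y != (- w)%R].
  apply/and3P; split; first by rewrite subr_eq0.
    by rewrite subr_eq addrC.
  apply/eqP=> yw; apply: n2; exists s, w; rewrite -yw -tE; split=> //.
  by rewrite w2 oppr_eq0.
have y2 : [&& y *+ 2 != 0, y *+ 2 != w & y *+ 2 != - w]%R.
  apply/and3P; split; apply/eqP=> e.
  - by apply/n1/(double_class1 n_gt1 A1 ts tsw ssw); rewrite tE mulrnDl e addr0.
  - by apply/n2/(double_class2 A1 ts ssw); rewrite tE mulrnDl e mulr2n addrA.
  by apply/n1/(double_class1 n_gt1 A2 tsw ts sws); rewrite tE mulrnDl e mulrnDl w2.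
have y3 : [&& y *+ 3 != 0, y *+ 3 != w & y *+ 3 != - w]%R.
  apply/and3P; split; apply/eqP=> e.
  - by have [||] := @Zp_torsion3 w y w0 (fun _ => e) w3; move/eqP; apply/negP; case/and3P: y1.
  - by apply/n4/(triple_class4 A1 ts tsw ssw); rewrite tE mulrnDl e mulrSr addrA.
  apply/n4/(triple_class4 A2 tsw ts sws); rewrite tE mulrnDl e mulrnDl w2 mulrSr.
  by rewrite addrAC.
pose bound (a : formal_elt) := (`|a.1.2| <= 3)%N.
pose P (a : formal_elt) := (`|a.1.2|%N == 0) && (3 %| `|a.1.1|)%N.
have boundP a : bound a -> (formal_sum w y a == 0)%R = P a.
  rewrite /bound /P /formal_sum addrC addr_eq0.
  have key (z : R) : (z *~ a.1.2 == 0)%R = (z *+ `|a.1.2|%N == 0)%R by exact: Zp_mulrz_eq0.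
  have neg (z c : R) : (z *~ a.1.2 == c)%R -> (z *+ `|a.1.2|%N == c)%R || (z *+ `|a.1.2|%N == - c)%R.
    case: a.1.2 => m /=; first by move->.
    by rewrite NegzE mulrNz eqr_oppLR => ->; rewrite orbT.
  have := @mulrz_mod3 w a.1.1 w0 w3; case: ifP => _ => [-> | wa].
    rewrite oppr0 key andbT; case/and3P: y1 y2 y3 => y1 _ _ /and3P[y2 _ _] /and3P[y3 _ _].
    by case: `|a.1.2|%N => [|[|[|[|//]]]] _; rewrite ?mulr0n ?mulr1n ?eqxx //; apply/negbTE.
  move=> b3; rewrite andbF; apply/negbTE/negP=> e.
  have : (y *+ `|a.1.2|%N == w)%R || (y *+ `|a.1.2|%N == - w)%R.
    by have := neg _ _ e; case: wa => ->; rewrite ?opprK // orbC.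
  case/and3P: y1 y2 y3 => _ y1 y1' /and3P[_ y2 y2'] /and3P[_ y3 y3'].
  case: `|a.1.2|%N b3 => [|[|[|[|//]]]] _; rewrite ?mulr0n ?mulr1n.
  - by rewrite eq_sym (negPf w0) eq_sym oppr_eq0 (negPf w0).
  - by rewrite (negPf y1) (negPf y1').
  - by rewrite (negPf y2) (negPf y2').
  by rewrite (negPf y3) (negPf y3').
have tE' : t = (s + (w *~ 0 + y *~ 1))%R by rewrite mulr0z mulr1z add0r.
split; apply: (closed_walksI (P := P) (bound := bound) v erefl tE' (uniq3 ssw st swt) boundP);
  by case; vm_compute.
Qed.

(** The relation 3s = 2(s + e) + (s - 2e) gives three more hexagons through an edge coloured s,
    hence at least 34 walks of length 6, against at most 32 in class 3. *)
Lemma walks_class4 s e v (A := [set s; (s + e)%R; (s - e *+ 2)%R]) :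
    e != 0%R -> (e *+ 2 != 0)%R -> (e *+ 3 != 0)%R -> ~ class1 A -> ~ class2 A ->
  [/\ closed_walks A 3 v s = 5, closed_walks A 3 v (s + e)%R = 5 &
      closed_walks A 3 v (s - e *+ 2)%R = 5] /\
  (32 < closed_walks A 5 v s)%N.
Proof.
move=> e0 e2 e3 n1 n2; set t := (s - e *+ 2)%R in A n1 n2 *.
have sse : s != (s + e)%R by rewrite -subr_eq0 opprD addrA subrr add0r oppr_eq0.
have st : s != t by rewrite -subr_eq0 /t (_ : s - (s - e *+ 2) = e *+ 2)%R //; ring.
have set' : (s + e)%R != t.
  by rewrite -subr_eq0 /t (_ : s + e - (s - e *+ 2) = e *+ 3)%R //; ring.
have A1 : A = [set t; s; (s + e)%R] by rewrite /A setUC setUA.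
have A2 : A = [set t; (s + e)%R; s] by rewrite A1 -setUA [[set s] :|: _]setUC setUA.
have [ts tse ses] : [/\ t != s, t != (s + e)%R & (s + e)%R != s] by split; rewrite eq_sym.
have e4 : (e *+ 4 != 0)%R by apply: contraNneq e2 => /(four_torsion n_gt1 n_odd)->.
have e5 : (e *+ 5 != 0)%R.
  apply/eqP=> e5; apply/n2/(double_class2 A1 ts sse); rewrite /t.
  by apply/eqP; rewrite -subr_eq0 -oppr_eq0 -e5; apply/eqP; ring.
have e6 : (e *+ 6 != 0)%R.
  apply/eqP=> e6; apply/n1/(double_class1 n_gt1 A2 tse ts ses); rewrite /t.
  by apply/eqP; rewrite -subr_eq0 -oppr_eq0 -e6; apply/eqP; ring.
have e8 : (e *+ 8 != 0)%R.
  rewrite (mulrnA _ 2 4); apply: contraNneq e4 => /(four_torsion n_gt1 n_odd).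
  by rewrite -mulrnA => ->.
have tE : t = (s + (e *~ (- 2) + 0 *~ 0))%R by rewrite mulr0z addr0 mulrNz.
have U := uniq3 sse st set'.
have fE a : (formal_sum e 0%R a == 0)%R = (e *+ `|a.1.1|%N == 0)%R.
  by rewrite /formal_sum mul0rz addr0 Zp_mulrz_eq0.
split.
  pose bound (a : formal_elt) := (`|a.1.1| <= 6)%N.
  pose P (a : formal_elt) := (`|a.1.1|%N == 0).
  apply: (closed_walksI (P := P) (bound := bound) v erefl tE U); try by case; vm_compute.
  move=> a; rewrite fE /bound /P; case: `|a.1.1|%N => [|[|[|[|[|[|[|//]]]]]]] _;
  by rewrite ?mulr0n ?mulr1n ?eqxx //; apply/negbTE.
pose bound (a : formal_elt) := (`|a.1.1| <= 9)%N.
(* Among the multiples up to 9 that occur, only 7e and 9e can still vanish. For 7e = 0 the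
   components are Heawood graphs. *)
have [e7 | e7] := eqVneq (e *+ 7)%R 0%R.
  have e9 : (e *+ 9 != 0)%R by rewrite (mulrnDr e 7 2) e7 add0r.
  pose P (a : formal_elt) := (7 %| `|a.1.1|)%N.
  have bP a : bound a -> (formal_sum e 0%R a == 0)%R = P a.
    rewrite fE /bound /P; case: `|a.1.1|%N => [|[|[|[|[|[|[|[|[|[|//]]]]]]]]]] _;
    by rewrite ?mulr0n ?mulr1n ?e7 ?eqxx //; apply/negbTE.
  by have [||-> _ _] := closed_walksI (P := P) (bound := bound) (k := 5)
    (N0 := 37) (N1 := 37) (N2 := 37) v erefl tE U bP; try by case; vm_compute.
have [e9 | e9] := eqVneq (e *+ 9)%R 0%R.
  pose P (a : formal_elt) := (9 %| `|a.1.1|)%N.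
  have bP a : bound a -> (formal_sum e 0%R a == 0)%R = P a.
    rewrite fE /bound /P; case: `|a.1.1|%N => [|[|[|[|[|[|[|[|[|[|//]]]]]]]]]] _;
    by rewrite ?mulr0n ?mulr1n ?e9 ?eqxx //; apply/negbTE.
  by have [||-> _ _] := closed_walksI (P := P) (bound := bound) (k := 5)
    (N0 := 34) (N1 := 34) (N2 := 33) v erefl tE U bP; try by case; vm_compute.
pose P (a : formal_elt) := (`|a.1.1|%N == 0).
have bP a : bound a -> (formal_sum e 0%R a == 0)%R = P a.
  rewrite fE /bound /P; case: `|a.1.1|%N => [|[|[|[|[|[|[|[|[|[|//]]]]]]]]]] _;
  by rewrite ?mulr0n ?mulr1n ?eqxx //; apply/negbTE.
by have [||-> _ _] := closed_walksI (P := P) (bound := bound) (k := 5)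
  (N0 := 34) (N1 := 33) (N2 := 32) v erefl tE U bP; try by case; vm_compute.
Qed.

End CountsI.

Section TypeI.

Import GRing.Theory.

Variables (n : nat) (gT : finGroupType) (Q : quat_coords n gT).
Hypotheses (n_gt1 : 1 < n) (n_odd : odd n).

Local Notation E := (qE Q).
Local Notation nu := (half_turn n).
Local Notation R := 'Z_(2 * n).
Implicit Types (a b c d e i j s t w x y : R) (A B : {set R}) (u v : gT * bool).

Let N_gt1 : 1 < 2 * n. Proof. by rewrite mul2n -addnn ltn_addl. Qed.

Lemma affine_iso A B : affine_equiv A B -> graph_iso (bcay (E @: A)) (bcay (E @: B)).
Proof. by move=> AB; apply/bequiv_iso/affine_bequiv. Qed.

Lemma closed_walks_colour A B (h : gT * bool -> gT * bool) k v i :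
    bijective h -> (forall u v, bcay (E @: B) (h u) (h v) = bcay (E @: A) u v) ->
  i \in A -> closed_walks Q B k (h v) (colour Q B h v i) = closed_walks Q A k v i.
Proof.
move=> h_bij h_iso iA; have [_ hc] := colourP h_iso v iA.
by rewrite /closed_walks -hc (walks_iso _ _ _ h_bij h_iso).
Qed.

Lemma rigid_affine A B : #|A| = 3 -> #|B| = 3 -> rigid A ->
  graph_iso (bcay (E @: A)) (bcay (E @: B)) -> affine_equiv A B.
Proof.
move=> A3 B3 rigA [h [h_bij h_iso]].
apply: (colour_affine n_gt1 h_bij h_iso) => // v i j iA jA ij.
apply: (colour_unique_path h_bij h_iso) => // a b c aA bA cA eq.
move/forall_inP/(_ i iA)/forall_inP/(_ j jA): rigA; rewrite ij /=.
move/forall_inP/(_ a aA)/forall_inP/(_ b bA)/forall_inP/(_ c cA).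
by rewrite eq eqxx => /eqP.
Qed.

Lemma affine_shift A c : affine_equiv A [set (i + c)%R | i in A].
Proof.
exists 1%R; rewrite ?unitr1 //; exists c.
by apply: eq_imset => i /=; rewrite mul1r.
Qed.

Lemma affine_scale A (k : R) : k \is a GRing.unit -> affine_equiv A [set (k * i)%R | i in A].
Proof.
by move=> kU; exists k => //; exists 0%R; apply: eq_imset => i /=; rewrite addr0.
Qed.

Lemma imset3 (T U : finType) (f : T -> U) (x y z : T) :
  f @: [set x; y; z] = [set f x; f y; f z].
Proof. by rewrite !imsetU !imset_set1. Qed.

(** As n is odd, exactly one of t - s and t - s - [nu] has order dividing n. With that choice [nu]
    and y are both multiples of [nu + y], so the order of the generated subgroup determines y up to
    units. *)
Lemma class1_normal A : class1 A -> exists y,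
  [/\ (y *+ n = 0)%R, y != 0%R & affine_equiv A [set 0%R; nu; y]].
Proof.
case=> s [t [-> ts tsnu]]; pose y := (t - s)%R.
have y0 : y != 0%R by rewrite subr_eq0.
have ynu : y != nu by rewrite subr_eq addrC.
have [|yn|yn] := @two_torsion n n_gt1 (y *+ n)%R.
- by apply/eqP; rewrite -mulrnA Zp_mulrn_eq0 // [(n * 2)%N]mulnC dvdn_mull.
- exists y; split=> //; have := affine_shift [set s; (s + nu)%R; t] (- s)%R.
  by rewrite imset3 subrr addrAC subrr add0r.
exists (y + nu)%R; split.
- by rewrite mulrnDl yn half_turn_mulrn n_odd half_turnD.
- by rewrite addr_eq0 half_turnN.
have := affine_shift [set s; (s + nu)%R; t] (nu - s)%R.
rewrite imset3 (_ : s + (nu - s) = nu)%R; last by ring.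
rewrite (_ : s + nu + (nu - s) = nu + nu)%R; last by ring.
by rewrite half_turnD (_ : t + (nu - s) = y + nu)%R 1?setUC ?setUA 1?(setUC [set nu]) // /y; ring.
Qed.

Lemma class2_normal A : class2 A -> exists e, affine_equiv A [set 0%R; e; (- e)%R].
Proof.
case=> s [e [-> _ _]]; exists e; have := affine_shift [set s; (s + e)%R; (s - e)%R] (- s)%R.
by rewrite imset3 subrr (addrAC s) subrr add0r (addrAC s) subrr add0r.
Qed.

Lemma class4_normal A : class4 A -> exists e, affine_equiv A [set 0%R; e; (- (e *+ 2))%R].
Proof.
case=> s [e [-> _ _ _]]; exists e.
have := affine_shift [set s; (s + e)%R; (s - e *+ 2)%R] (- s)%R.
by rewrite imset3 subrr (addrAC s) subrr add0r (addrAC s) subrr add0r.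
Qed.

Lemma gen_cycle A e : E e \in <<E @: A>> -> (forall i, i \in A -> exists m, i = (e *+ m)%R) ->
  <<E @: A>> = <[E e]>.
Proof.
move=> eA Ae; apply/eqP; rewrite eqEsubset cycle_subG eA gen_subG andbT.
apply/subsetP=> _ /imsetP[i /Ae[m ->] ->]; rewrite -qEX; exact: mem_cycle.
Qed.

Lemma order_unit e e' : #[E e] = #[E e'] -> exists2 k, k \is a GRing.unit & (k * e = e')%R.
Proof.
move=> oe; apply: unit_ann => // m.
have zE d : (d *+ m = 0)%R <-> #[E d] %| m.
  by rewrite order_dvdn qEX qE1_eq; split=> /eqP.
by rewrite !zE oe.
Qed.

Lemma gen_class1 y : (y *+ n = 0)%R ->
  <<E @: [set 0%R; nu; y]>> = <[E (nu + y)%R]>.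
Proof.
move=> yn; have nE : ((nu + y) *+ n = nu)%R by rewrite mulrnDl yn addr0 half_turn_mulrn n_odd.
apply: gen_cycle.
  by rewrite -qEE groupM // mem_gen // imset_f // !inE eqxx ?orbT.
move=> i; rewrite !inE -orbA => /or3P[] /eqP ->.
- by exists 0; rewrite mulr0n.
- by exists n.
by exists n.+1; rewrite mulrSr nE addrA half_turnD add0r.
Qed.

Lemma gen_class2 e : <<E @: [set 0%R; e; (- e)%R]>> = <[E e]>.
Proof.
apply: gen_cycle; first by rewrite mem_gen // imset_f // !inE eqxx ?orbT.
move=> i; rewrite !inE -orbA => /or3P[] /eqP ->.
- by exists 0; rewrite mulr0n.
- by exists 1%N; rewrite mulr1n.
by exists (1 * (2 * n).-1)%N; rewrite (Zp_mulrn_opp N_gt1) mulr1n.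
Qed.

Lemma gen_class4 e : <<E @: [set 0%R; e; (- (e *+ 2))%R]>> = <[E e]>.
Proof.
apply: gen_cycle; first by rewrite mem_gen // imset_f // !inE eqxx ?orbT.
move=> i; rewrite !inE -orbA => /or3P[] /eqP ->.
- by exists 0; rewrite mulr0n.
- by exists 1%N; rewrite mulr1n.
by exists (2 * (2 * n).-1)%N; rewrite (Zp_mulrn_opp N_gt1).
Qed.

Lemma iso_gen_normal A B A' B' : 0%R \in A' -> 0%R \in B' ->
    affine_equiv A A' -> affine_equiv B B' ->
    graph_iso (bcay (E @: A)) (bcay (E @: B)) ->
  #|<<E @: A'>>| = #|<<E @: B'>>|.
Proof.
move=> A0 B0 AA BB AB; apply: bcay_iso_gen; try by rewrite -(qE0 Q) imset_f.
apply: graph_iso_trans (affine_iso BB); apply: graph_iso_trans AB.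
exact/graph_iso_sym/affine_iso.
Qed.

Lemma class1_affine A B : class1 A -> class1 B ->
  graph_iso (bcay (E @: A)) (bcay (E @: B)) -> affine_equiv A B.
Proof.
move=> /class1_normal[y [yn _ AA]] /class1_normal[y' [y'n _ BB]] AB.
have := iso_gen_normal _ _ AA BB AB; rewrite !inE eqxx => /(_ isT isT).
rewrite !gen_class1 // => /order_unit[k kU kE].
have nE z : (z *+ n = 0)%R -> ((nu + z) *+ n = nu)%R.
  by move=> zn; rewrite mulrnDl zn addr0 half_turn_mulrn n_odd.
have knu : (k * nu = nu)%R by rewrite -{1}(nE y yn) mulrnAr kE nE.
have ky : (k * y = y')%R by apply: (addrI nu); rewrite -{1}knu -mulrDr.
apply: affine_equiv_trans AA _; apply: affine_equiv_trans (affine_equiv_sym BB).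
by have := affine_scale [set 0%R; nu; y] kU; rewrite imset3 mulr0 knu ky.
Qed.

Lemma class2_affine A B : class2 A -> class2 B ->
  graph_iso (bcay (E @: A)) (bcay (E @: B)) -> affine_equiv A B.
Proof.
move=> /class2_normal[e AA] /class2_normal[e' BB] AB.
have := iso_gen_normal _ _ AA BB AB; rewrite !inE eqxx => /(_ isT isT).
rewrite !gen_class2 => /order_unit[k kU kE].
apply: affine_equiv_trans AA _; apply: affine_equiv_trans (affine_equiv_sym BB).
by have := affine_scale [set 0%R; e; (- e)%R] kU; rewrite imset3 mulr0 mulrN kE.
Qed.

Lemma class4_affine A B : class4 A -> class4 B ->
  graph_iso (bcay (E @: A)) (bcay (E @: B)) -> affine_equiv A B.
Proof.
move=> /class4_normal[e AA] /class4_normal[e' BB] AB.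
have := iso_gen_normal _ _ AA BB AB; rewrite !inE eqxx => /(_ isT isT).
rewrite !gen_class4 => /order_unit[k kU kE].
apply: affine_equiv_trans AA _; apply: affine_equiv_trans (affine_equiv_sym BB).
have := affine_scale [set 0%R; e; (- (e *+ 2))%R] kU.
by rewrite imset3 mulr0 mulrN mulrnAr kE.
Qed.

(** Walks of length 6 recognise t, so its colour is constant. A path i, t, i with a competitor would
    need 3i = 3t, which makes t a member of the coset of <w> and the triple a progression. *)
Lemma class3_affine A B : #|A| = 3 -> #|B| = 3 -> class3 A -> class3 B ->
    ~ class1 A -> ~ class2 A -> ~ class4 A ->
    ~ class1 B -> ~ class2 B -> ~ class4 B ->
  graph_iso (bcay (E @: A)) (bcay (E @: B)) -> affine_equiv A B.
Proof.
move=> A3 B3 [s [w [t [AE w0 w3 ts tsw]]]] [s' [w' [t' [BE w'0 w'3 ts' tsw']]]].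
move=> A1 A2 A4 B1 B2 B4 [h [h_bij h_iso]].
have tA : t \in A by rewrite AE !inE eqxx !orbT.
have col v i : i \in A -> colour Q B h v i \in B by move=> iA; have [] := colourP h_iso v iA.
have colt v : colour Q B h v t = t'.
  have := closed_walks_colour 5 v h_bij h_iso tA.
  move: A1 A2 A4; rewrite AE => A1 A2 A4.
  have [_ [_ _ ->]] := walks_class3 Q n_gt1 v w0 w3 ts tsw A1 A2 A4.
  have := col v t tA; move: B1 B2 B4; rewrite BE => B1 B2 B4.
  have [_ [W0 W1 _]] := walks_class3 Q n_gt1 (h v) w'0 w'3 ts' tsw' B1 B2 B4.
  by rewrite !inE -orbA => /or3P[] /eqP -> //; rewrite ?W0 ?W1.
apply: (colour_affine n_gt1 h_bij h_iso) => // v i j iA jA ij.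
have [-> | it] := eqVneq i t; first by rewrite !colt.
have [jt | jt] := eqVneq j t.
  rewrite jt in jA ij *; apply: (colour_unique_path h_bij h_iso) => // a b c aA bA cA eq.
  apply/eqP/negPn/negP=> ai; have [//|//|e3|//] := path_class n_gt1 A3 iA tA ij aA bA cA eq ai.
  have t3 : ((t - s) *+ 3 = 0)%R.
    rewrite mulrnBl -e3; move: iA; rewrite AE !inE (negPf it) orbF => /orP[] /eqP ->.
      by rewrite subrr.
    by rewrite mulrnDl w3 addr0 subrr.
  have [||] := Zp_torsion3 n_gt1 w0 (fun _ => t3) w3 => /eqP.
  - by rewrite subr_eq0 (negPf ts).
  - by rewrite subr_eq addrC (negPf tsw).
  rewrite subr_eq addrC => /eqP te; apply: A2; exists s, w; rewrite AE te; split=> //.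
  by apply: contraNneq w0 => w2; move: w3; rewrite mulrSr w2 add0r => ->.
have colj v0 : colour Q B h (nb (E j) v0) j = colour Q B h v0 j by apply: colour_back h_iso v0 j jA.
(* Three colours are available: that of t is fixed and that of j is the same from both ends of the
   j-edge, so that of i is forced. *)
have colij v0 : colour Q B h (nb (E j) v0) i = colour Q B h v0 i.
  apply/eqP/negPn/negP=> ne.
  have inj := colour_inj h_bij h_iso.
  have neq v1 i0 j0 : i0 \in A -> j0 \in A -> i0 != j0 ->
      colour Q B h v1 i0 != colour Q B h v1 j0.
    by move=> i0A j0A; apply: contraNneq => /(inj v1 _ _ i0A j0A) ->.
  have U : uniq [:: t'; colour Q B h v0 j; colour Q B h v0 i; colour Q B h (nb (E j) v0) i].
    have [ti tj ji] : [/\ t != i, t != j & j != i] by split; rewrite eq_sym.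
    have f1 v1 i0 : i0 \in A -> t != i0 -> t' != colour Q B h v1 i0.
      by move=> i0A ti0; rewrite -(colt v1) neq.
    have f2 : colour Q B h v0 j != colour Q B h (nb (E j) v0) i by rewrite -colj neq.
    by rewrite /= !inE !negb_or !f1 // f2 neq // eq_sym ne.
  have := uniq_leq_size (s2 := enum B) U; rewrite -cardE B3 => /(_ _)/negP[] //.
  by move=> z; rewrite !inE mem_enum => /or4P[] /eqP->; rewrite ?col // -(colt v0) col.
by rewrite colij (colour_back h_iso v iA).
Qed.

(** The reflections make membership in the classes decidable, as the case distinctions below
    require. *)
Lemma class1P A : reflect (class1 A)
  [exists s, exists t, [&& A == [set s; (s + nu)%R; t], t != s & t != (s + nu)%R]].
Proof.
apply: (iffP existsP) => [[s /existsP[t /and3P[/eqP AE ts tsn]]] | [s [t [AE ts tsn]]]].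
  by exists s, t.
by exists s; apply/existsP; exists t; rewrite -AE eqxx ts.
Qed.

Lemma class2P A : reflect (class2 A)
  [exists s, exists e, [&& A == [set s; (s + e)%R; (s - e)%R], e != 0%R & (e *+ 2 != 0)%R]].
Proof.
apply: (iffP existsP) => [[s /existsP[e /and3P[/eqP AE e0 e2]]] | [s [e [AE e0 e2]]]].
  by exists s, e.
by exists s; apply/existsP; exists e; rewrite -AE eqxx e0.
Qed.

Lemma class4P A : reflect (class4 A)
  [exists s, exists e, [&& A == [set s; (s + e)%R; (s - e *+ 2)%R],
     e != 0%R, (e *+ 2 != 0)%R & (e *+ 3 != 0)%R]].
Proof.
apply: (iffP existsP) => [[s /existsP[e /and4P[/eqP AE e0 e2 e3]]] | [s [e [AE e0 e2 e3]]]].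
  by exists s, e.
by exists s; apply/existsP; exists e; rewrite -AE eqxx e0 e2.
Qed.

Section Transfer.

Variables A B : {set R}.
Hypotheses (A3 : #|A| = 3) (B3 : #|B| = 3) (A_flex : ~~ rigid A) (B_flex : ~~ rigid B).
Hypothesis AB : graph_iso (bcay (E @: A)) (bcay (E @: B)).

Lemma closed_walks_transfer k i : i \in A ->
  exists v u, exists2 j, j \in B & closed_walks Q B k u j = closed_walks Q A k v i.
Proof.
move=> iA; case: AB => h [h_bij h_iso]; exists (1, false), (h (1, false)).
exists (colour Q B h (1, false) i); first by have [] := colourP h_iso (1, false) iA.
exact: closed_walks_colour.
Qed.

Lemma closed_walks_class34 v i : ~ class1 B -> ~ class2 B -> i \in B ->
  closed_walks Q B 3 v i = 5.
Proof.
move=> n1 n2; have [//|//||] := nonrigid_class n_gt1 B3 B_flex; last first.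
  case=> s [e [BE e0 e2 e3]]; move: n1 n2; rewrite BE => n1 n2.
  have [[W0 W1 W2] _] := walks_class4 Q n_gt1 n_odd v e0 e2 e3 n1 n2.
  by rewrite !inE -orbA => /or3P[] /eqP->.
case: (class4P B) => [[s [e [BE e0 e2 e3]]] _ | n4 [s [w [t [BE w0 w3 ts tsw]]]]].
  move: n1 n2; rewrite BE => n1 n2.
  have [[W0 W1 W2] _] := walks_class4 Q n_gt1 n_odd v e0 e2 e3 n1 n2.
  by rewrite !inE -orbA => /or3P[] /eqP->.
move: n1 n2 n4; rewrite BE => n1 n2 n4.
have [[W0 W1 W2] _] := walks_class3 Q n_gt1 v w0 w3 ts tsw n1 n2 n4.
by rewrite !inE -orbA => /or3P[] /eqP->.
Qed.

(** Only class 1 shows both counts 6 and 5: class 2 never shows 5, and the remaining triples show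
    nothing else. *)
Lemma class1_transfer : class1 A -> class1 B.
Proof.
move=> [s [t [AE ts tsnu]]]; case: (class1P B) => // n1.
have [v [w [j jB]]] : exists v u, exists2 j, j \in B &
    closed_walks Q B 3 u j = closed_walks Q A 3 v s.
  by apply: closed_walks_transfer; rewrite AE !inE eqxx.
have [v' [w' [j' j'B]]] : exists v u, exists2 j, j \in B &
    closed_walks Q B 3 u j = closed_walks Q A 3 v t.
  by apply: closed_walks_transfer; rewrite AE !inE eqxx !orbT.
rewrite AE; have [_ _ ->] := walks_class1 Q n_gt1 n_odd v' ts tsnu.
have [-> _ _] := walks_class1 Q n_gt1 n_odd v ts tsnu.
case: (class2P B) => [[s' [e [BE e0 e2]]] | n2]; last first.
  by rewrite !closed_walks_class34.
move: j'B; rewrite BE; have := walks_class2 Q n_gt1 n_odd s' w' e0 e2.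
by case: ifP => _ [W0 W1 W2]; rewrite !inE -orbA => /or3P[] /eqP ->; rewrite ?W0 ?W1 ?W2.
Qed.

Lemma class2_transfer : class2 A -> ~ class1 B -> class2 B.
Proof.
move=> [s [e [AE e0 e2]]] n1; case: (class2P B) => // n2.
have [v [w [j jB]]] : exists v u, exists2 j, j \in B &
    closed_walks Q B 3 u j = closed_walks Q A 3 v s.
  by apply: closed_walks_transfer; rewrite AE !inE eqxx.
rewrite closed_walks_class34 // AE; have := walks_class2 Q n_gt1 n_odd s v e0 e2.
by case: ifP => _ [-> _ _].
Qed.

Lemma class4_transfer : class4 A -> ~ class1 A -> ~ class2 A -> ~ class1 B -> ~ class2 B ->
  class4 B.
Proof.
move=> [s [e [AE e0 e2 e3]]] A1 A2 n1 n2; case: (class4P B) => // n4.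
have [//|//|[s' [w [t [BE w0 w3 ts tsw]]]]|//] := nonrigid_class n_gt1 B3 B_flex.
have [v [u [j jB]]] : exists v u, exists2 j, j \in B &
    closed_walks Q B 5 u j = closed_walks Q A 5 v s.
  by apply: closed_walks_transfer; rewrite AE !inE eqxx.
move: A1 A2; rewrite AE => A1 A2.
have [_] := walks_class4 Q n_gt1 n_odd v e0 e2 e3 A1 A2.
move: n1 n2 n4 jB; rewrite BE => n1 n2 n4.
have [_ [W0 W1 W2]] := walks_class3 Q n_gt1 u w0 w3 ts tsw n1 n2 n4.
by rewrite !inE -orbA => /or3P[] /eqP-> + e5; rewrite -e5 ?W0 ?W1 ?W2.
Qed.

End Transfer.

(** The classes overlap, so each of them is treated only after the preceding ones have been excluded
    for both sets. *)
Lemma typeI_affine A B : #|A| = 3 ->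
  graph_iso (bcay (E @: A)) (bcay (E @: B)) -> affine_equiv A B.
Proof.
move=> A3 AB; have BA := graph_iso_sym AB.
have B3 : #|B| = 3.
  by have := bcay_iso_card AB; rewrite !card_imset ?A3 //; apply: qE_inj.
have [A_rigid | A_flex] := boolP (rigid A); first exact: rigid_affine.
have [B_rigid | B_flex] := boolP (rigid B).
  exact/affine_equiv_sym/rigid_affine.
case: (class1P A) => [A1 | A1].
  by apply: class1_affine; rewrite //; apply: class1_transfer AB A1.
have B1 : ~ class1 B by move=> B1; apply: A1; apply: class1_transfer BA B1.
case: (class2P A) => [A2 | A2].
  by apply: class2_affine; rewrite //; apply: class2_transfer AB A2 B1.
have B2 : ~ class2 B by move=> B2; apply: A2; apply: class2_transfer BA B2 A1.
case: (class4P A) => [A4 | A4].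
  by apply: class4_affine; rewrite //; apply: class4_transfer AB A4 A1 A2 B1 B2.
have B4 : ~ class4 B by move=> B4; apply: A4; apply: class4_transfer BA B4 B1 B2 A1 A2.
have [//|//|A_3|//] := nonrigid_class n_gt1 A3 A_flex.
have [//|//|B_3|//] := nonrigid_class n_gt1 B3 B_flex.
exact: class3_affine.
Qed.

End TypeI.

(** * Bi-Cayley graphs of valency at most 3, for n odd *)

Section OddBCIGroup.

Import GRing.Theory.

Variables (n : nat) (gT : finGroupType) (Q : quat_coords n gT).
Hypotheses (n_gt1 : 1 < n) (n_odd : odd n).

Local Notation E := (qE Q).
Local Notation F := (qF Q).
Local Notation nu := (half_turn n).
Local Notation R := 'Z_(2 * n).
Implicit Types (i j k l x y : R) (A B : {set R}) (c d g : gT) (S T : {set gT}).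

Let N_gt1 : 1 < 2 * n. Proof. by rewrite mul2n -addnn ltn_addl. Qed.

Lemma order_qE_dvd i : #[E i] %| 2 * n.
Proof.
rewrite order_dvdn qEX qE1_eq; apply/eqP.
by apply/eqP; rewrite Zp_mulrn_eq0 // dvdn_mull.
Qed.

Lemma four_ndvd : ~~ (4 %| 2 * n).
Proof. by rewrite -[4]/(2 * 2)%N dvdn_pmul2l // dvdn2 n_odd. Qed.

Lemma gen_qE_dvd A : #|<<E @: A>>| %| 2 * n.
Proof.
apply: dvdn_trans (order_qE_dvd 1%R); apply: cardSg; rewrite gen_subG.
apply/subsetP=> _ /imsetP[i _ ->]; rewrite -[i]natr_Zp -qEX; exact: mem_cycle.
Qed.

Lemma gen_qF_dvd S j : F j \in S -> 4 %| #|<<S>>|.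
Proof.
by move=> jS; rewrite -(order_qF Q n_gt1 j) order_dvdG // mem_gen.
Qed.

(** Elements outside <a> have order 4, which does not divide 2n, so the order tells on which side of
    <a> an element lies; within each side [qaut] suffices. *)
Lemma aut_of_order g d : #[g] = #[d] ->
  exists2 alpha : {perm gT}, alpha \in Aut [set: gT] & alpha g = d.
Proof.
have EF i j : #[E i] <> #[F j].
  by move=> o; have := order_qE_dvd i; rewrite o order_qF // (negPf four_ndvd).
case: (q_cover Q g) (q_cover Q d) => -[i ->] [] [j ->].
- case/(order_unit n_gt1) => k kU kij; have [alpha aA [aE _]] := qaut Q n_gt1 0%R kU.
  by exists alpha; rewrite // aE kij.
- by move/EF.
- by move/esym/EF.
have [alpha aA [_ aF]] := qaut Q n_gt1 (j - i)%R (unitr1 R).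
by exists alpha; rewrite // aF mul1r addrC subrK.
Qed.

Lemma three_forms S : #|S| = 3 ->
  [\/ exists2 A : {set R}, #|A| = 3 & S = E @: A, exists2 A : {set R}, #|A| = 3 & S = F @: A |
      exists c x j, x != 0%R /\ S = [set c; c * E x; c * F j]].
Proof.
have formEEF i j k : E i != E j ->
    exists c x l, x != 0%R /\ [set E i; E j; F k] = [set c; c * E x; c * F l].
  move=> ij; exists (E i), (j - i)%R, (k - i)%R; rewrite !qM ![(i + _)%R]addrC !subrK.
  by rewrite subr_eq0 eq_sym -(qE_eq Q).
have formFFE i j k : F i != F j ->
    exists c x l, x != 0%R /\ [set F i; F j; E k] = [set c; c * E x; c * F l].
  move=> ij; exists (F i), (i - j)%R, (i + nu - k)%R; rewrite !qM.
  rewrite subr_eq0 -(qF_eq Q); split=> //; congr [set _; F _; E _]; first by ring.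
  rewrite (_ : i - (i + nu - k) + nu = k + (nu - nu))%R ?subrr ?addr0 //; ring.
have rot (a b c : gT) : [set a; b; c] = [set b; c; a] by rewrite -setUA setUC.
have card3 (f : R -> gT) i j k : injective f ->
    f i != f j -> f i != f k -> f j != f k -> #|[set i; j; k]| = 3.
  move=> fI; rewrite !(inj_eq fI) => ij ik jk.
  by rewrite -setUA !cardsU1 !inE negb_or ij ik jk cards1.
move=> /card3_set[a [b [c [-> ab ac bc]]]].
case: (q_cover Q a) ab ac => -[i ->]; case: (q_cover Q b) bc => -[j ->];
  case: (q_cover Q c) => -[k ->] bc ab ac.
- apply: Or31; exists [set i; j; k]; rewrite ?imset3 //.
  exact: (card3 _ _ _ _ (@qE_inj _ _ Q)).
- by apply: Or33; apply: formEEF.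
- by apply: Or33; rewrite -rot; apply: formEEF; rewrite eq_sym.
- by apply: Or33; rewrite rot; apply: formFFE.
- by apply: Or33; rewrite rot; apply: formEEF.
- by apply: Or33; rewrite -rot; apply: formFFE; rewrite eq_sym.
- by apply: Or33; apply: formFFE.
apply: Or32; exists [set i; j; k]; rewrite ?imset3 //.
exact: (card3 _ _ _ _ (@qF_inj _ _ Q)).
Qed.

Lemma qF_bequiv A : bequiv (F @: A) (E @: [set (- i + nu)%R | i in A]).
Proof.
have := bequiv_lcoset (F 0%R) (F @: A); rewrite -!imset_comp.
rewrite (eq_imset _ (_ : _ =1 E \o (fun i => (- i + nu)%R))) // => i /=.
by rewrite qFF add0r.
Qed.

Lemma bequivII c d x y j l k : k \is a GRing.unit -> (k * x = y)%R ->
  bequiv [set c; c * E x; c * F j] [set d; d * E y; d * F l].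
Proof.
move=> kU kx; have [alpha aA [aE aF]] := qaut Q n_gt1 (l - k * j)%R kU.
exists (d * (alpha c)^-1), alpha; split=> //.
rewrite lcosetE' !imset3 !(aut_mul aA) aE aF kx [(k * j + _)%R]addrC subrK.
by rewrite !mulgA !mulgKV.
Qed.

(** Once both sets are normalised to contain 1, component sizes compare the generated subgroups: one
    order divides 2n, the other is a multiple of 4. *)
Lemma bcay_typeI_neq_typeII A c x j :
  ~ graph_iso (bcay (E @: A)) (bcay [set c; c * E x; c * F j]).
Proof.
move=> iso; have /set0Pn[i iA] : A != set0.
  apply/eqP=> A0; have := bcay_iso_card iso; rewrite A0 imset0 cards0 => /esym/eqP.
  by rewrite cards_eq0 => /eqP/setP/(_ c); rewrite !inE eqxx.
have AA := affine_shift A (- i)%R; set A' := [set _ | _ in A] in AA.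
have A'1 : 1 \in E @: A'.
  by rewrite -(qE0 Q) imset_f //; apply/imsetP; exists i; rewrite ?subrr.
have := bequivII c 1 j j (unitr1 R) (mul1r x); set S' := [set 1; _; _] => SS.
have S'1 : 1 \in S' by rewrite /S' !inE ?eqxx.
have : graph_iso (bcay (E @: A')) (bcay S').
  apply: graph_iso_trans (bequiv_iso SS); apply: graph_iso_trans iso.
  exact/graph_iso_sym/affine_iso.
move/(bcay_iso_gen A'1 S'1) => e; have := gen_qE_dvd A'; rewrite e => d.
have : 4 %| #|<<S'>>| by apply: (@gen_qF_dvd _ j); rewrite !inE !mul1g eqxx !orbT.
by move/dvdn_trans/(_ d); apply/negP/four_ndvd.
Qed.

Lemma bequiv_card1 S T : #|S| = 1%N -> #|T| = 1%N -> bequiv S T.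
Proof.
move=> /eqP/cards1P[s ->] /eqP/cards1P[t ->].
have := bequiv_lcoset (t * s^-1) [set s].
by rewrite imset_set1 mulgKV.
Qed.

Lemma bequiv_card2 S : #|S| = 2 -> exists g, bequiv S [set 1; g].
Proof.
move=> /eqP/cards2P[s [t [_ ->]]]; exists (s^-1 * t).
have := bequiv_lcoset s^-1 [set s; t].
by rewrite imsetU !imset_set1 mulVg.
Qed.

Lemma gen_pair1 g : <<[set 1; g]>> = <[g]>.
Proof.
apply/eqP; rewrite eqEsubset gen_subG cycle_subG mem_gen ?set22 // andbT.
by apply/subsetP=> x /set2P[] ->; rewrite ?group1 ?cycle_id.
Qed.

Lemma bcay_iso_bequiv S T : #|S| <= 3 ->
  graph_iso (bcay S) (bcay T) -> bequiv S T.
Proof.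
move=> S3 iso; have ST := bcay_iso_card iso.
case S_card: #|S| S3 ST => [|[|[|[|//]]]] _ /esym T_card.
- move/eqP: S_card T_card; rewrite cards_eq0 => /eqP-> /eqP; rewrite cards_eq0 => /eqP->.
  exact: bequiv_refl.
- exact: bequiv_card1.
- have [g Sg] := bequiv_card2 S_card; have [d Td] := bequiv_card2 T_card.
  have : graph_iso (bcay [set 1; g]) (bcay [set 1; d]).
    apply: graph_iso_trans (bequiv_iso Td); apply: graph_iso_trans iso.
    exact/graph_iso_sym/bequiv_iso.
  move/(bcay_iso_gen (set21 _ _) (set21 _ _)); rewrite !gen_pair1.
  case/aut_of_order=> alpha aA agd; apply: bequiv_trans Sg _.
  apply: bequiv_trans (bequiv_sym Td); have := bequiv_aut [set 1; g] aA.
  by rewrite imsetU !imset_set1 (aut_one aA) agd.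
have typeI A : #|A| = 3 -> bequiv S (E @: A) -> bequiv S T.
  move=> A3 SA; have AT : graph_iso (bcay (E @: A)) (bcay T).
    exact: graph_iso_trans (graph_iso_sym (bequiv_iso SA)) iso.
  have caseE B : #|B| = 3 -> bequiv T (E @: B) -> bequiv S T.
    move=> B3 TB; apply: bequiv_trans SA _; apply: bequiv_trans (bequiv_sym TB).
    apply: affine_bequiv => //; apply: typeI_affine => //.
    exact: graph_iso_trans AT (bequiv_iso TB).
  case: (three_forms T_card) => [[B B3 TB]|[B B3 TB]|[c [x [j [x0 TE]]]]].
  - by apply: (caseE B); rewrite // TB; apply: bequiv_refl.
  - apply: caseE (_ : bequiv T _); last by rewrite TB; apply: qF_bequiv.
    by rewrite card_imset // => i i' /addIr/oppr_inj.
  by case: (@bcay_typeI_neq_typeII A c x j); rewrite -TE.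
case: (three_forms S_card) => [[A A3 SA]|[A A3 SA]|[c [x [j [x0 SE]]]]].
- by apply: (typeI A); rewrite // SA; apply: bequiv_refl.
- apply: typeI (_ : bequiv S _); last by rewrite SA; apply: qF_bequiv.
  by rewrite card_imset // => i i' /addIr/oppr_inj.
have notI B : bequiv T (E @: B) -> bequiv S T.
  move=> TB; case: (@bcay_typeI_neq_typeII B c x j); rewrite -SE.
  exact: graph_iso_trans (graph_iso_sym (bequiv_iso TB)) (graph_iso_sym iso).
case: (three_forms T_card) => [[B B3 TB]|[B B3 TB]|[d [y [l [y0 TE]]]]].
- by apply: (notI B); rewrite TB; apply: bequiv_refl.
- by apply: notI; rewrite TB; apply: qF_bequiv.
rewrite SE TE in iso *; have [k kU kx] := bcay_isoII n_gt1 n_odd x0 y0 iso.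
exact: bequivII kU kx.
Qed.

End OddBCIGroup.

(** * Cayley digraphs of subsets of the cyclic subgroup *)

Section CayleyAffine.

Import GRing.Theory.

Variables (n : nat) (gT : finGroupType) (Q : quat_coords n gT).
Hypotheses (n_gt1 : 1 < n) (n_odd : odd n).

Local Notation E := (qE Q).
Local Notation F := (qF Q).
Local Notation nu := (half_turn n).
Local Notation R := 'Z_(2 * n).
Implicit Types (a b i j u w x y : R) (A B : {set R}) (g : gT) (S T : {set gT}).

Let N_gt1 : 1 < 2 * n. Proof. by rewrite mul2n -addnn ltn_addl. Qed.
Let nu0 : nu != 0%R := half_turn_neq0 n_gt1.

Variable h : gT -> gT.
Hypothesis h_inj : injective h.

(** A sum of the a's vanishes exactly when walking along it returns to 1, and h carries this walk to
    the corresponding sum of the b's. The predicate [inv] allows labels to be known only at the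
    vertices met on the way. *)
Lemma translation_unit (inv : gT -> Prop) a0 a1 a2 b0 b1 b2 :
    inv 1 ->
    (forall g, inv g -> [/\ h (E a0 * g) = E b0 * h g, h (E a1 * g) = E b1 * h g &
                            h (E a2 * g) = E b2 * h g]) ->
    (forall g, inv g -> [/\ inv (E a0 * g), inv (E a1 * g) & inv (E a2 * g)]) ->
  exists2 k, k \is a GRing.unit & [/\ k * a0 = b0, k * a1 = b1 & k * a2 = b2]%R.
Proof.
move=> inv1 h_tr inv_tr.
pose pt (l m p : nat) : R := (a0 *+ l + a1 *+ m + a2 *+ p)%R.
pose im (l m p : nat) : R := (b0 *+ l + b1 *+ m + b2 *+ p)%R.
have walk l m p : h (E (pt l m p)) = E (im l m p) * h 1 /\ inv (E (pt l m p)).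
  elim: l => [|l [IHl il]].
    elim: m => [|m [IHm im']].
      elim: p => [|p [IHp ip]]; first by rewrite /pt /im !mulr0n !addr0 qE0 mul1g.
      have -> : pt 0 0 p.+1 = (a2 + pt 0 0 p)%R by rewrite /pt mulrS; ring.
      have -> : im 0 0 p.+1 = (b2 + im 0 0 p)%R by rewrite /im mulrS; ring.
      have [_ _ ht] := h_tr _ ip; have [_ _ it] := inv_tr _ ip.
      by rewrite -(qEE Q a2) -(qEE Q b2) ht IHp mulgA.
    have -> : pt 0 m.+1 p = (a1 + pt 0 m p)%R by rewrite /pt mulrS; ring.
    have -> : im 0 m.+1 p = (b1 + im 0 m p)%R by rewrite /im mulrS; ring.
    have [_ ht _] := h_tr _ im'; have [_ it _] := inv_tr _ im'.
    by rewrite -(qEE Q a1) -(qEE Q b1) ht IHm mulgA.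
  have -> : pt l.+1 m p = (a0 + pt l m p)%R by rewrite /pt mulrS; ring.
  have -> : im l.+1 m p = (b0 + im l m p)%R by rewrite /im mulrS; ring.
  have [ht _ _] := h_tr _ il; have [it _ _] := inv_tr _ il.
  by rewrite -(qEE Q a0) -(qEE Q b0) ht IHl mulgA.
apply: unit_rel3 => // l m p; rewrite -/(pt l m p) -/(im l m p).
have [hw _] := walk l m p; split=> e.
  by move: hw; rewrite e qE0 -[X in X = _]mul1g => /mulIg/esym/eqP; rewrite qE1_eq => /eqP.
by move: hw; rewrite e qE0 mul1g => /h_inj/eqP; rewrite qE1_eq => /eqP.
Qed.

Lemma translation_unit1 u u' : (forall g, h (E u * g) = E u' * h g) ->
  exists2 k, k \is a GRing.unit & (k * u = u')%R.
Proof.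
move=> hu; have [||//|k kU [ku _ _]] := @translation_unit (fun=> True) u 0%R 0%R u' 0%R 0%R.
- by [].
- by move=> g _; rewrite qE0 !mul1g.
by exists k.
Qed.

(** The sign chosen at 1 persists. Along E u it does because translations commute; along E x a
    change of sign would make h take equal values at g and E (2x) g. *)
Lemma translation_unit2 u u' x x' : (x *+ 2 != 0)%R ->
    (forall g, h (E u * g) = E u' * h g) ->
    (forall g, h (E x * g) = E x' * h g \/ h (E x * g) = E (- x')%R * h g) ->
  exists2 k, k \is a GRing.unit & (k * u = u' /\ (k * x = x' \/ k * x = - x'))%R.
Proof.
move=> x2 hu hx.
have key y : (forall g, h (E x * g) = E y * h g \/ h (E x * g) = E (- y)%R * h g) ->
    h (E x * 1) = E y * h 1 ->
    exists2 k, k \is a GRing.unit & (k * u = u' /\ k * x = y)%R.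
  move=> hy hy1; pose inv g := h (E x * g) = E y * h g.
  have [||g ig|k kU [ku kx _]] := @translation_unit inv u x 0%R u' y 0%R.
  - by [].
  - by move=> g ig; rewrite qE0 !mul1g.
  - split; rewrite /inv ?qE0 ?mul1g //.
      have -> : E x * (E u * g) = E u * (E x * g) by rewrite !mulgA !qEE addrC.
      by rewrite !hu ig !mulgA !qEE addrC.
    case: (hy (E x * g)) => // e; case/eqP: x2; apply/eqP; rewrite -(qE1_eq Q).
    rewrite mulr2n -qEE; apply/eqP; apply: (mulIg g); rewrite mul1g -mulgA; apply: h_inj.
    by rewrite e ig mulgA qEE addNr qE0 mul1g.
  by exists k.
case: (hx 1) => h1.
  by have [k kU [ku kx]] := key x' hx h1; exists k => //; split; [|left].
have [|k kU [ku kx]] := key (- x')%R _ h1; first by move=> g; rewrite opprK; case: (hx g); [right|left].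
by exists k => //; split; [|right].
Qed.

Definition sum_free_pairs B := forall p q r s : R, p \in B -> q \in B -> r \in B -> s \in B ->
  p != q -> (p + r = q + s)%R -> r = q.

(* Two out-neighbours [E a * g], [E a' * g] of [g] have only [E (a + a') * g] as a common
   out-neighbour, so the labels of the arcs at [g] propagate to the arcs at [E a * g]. *)
Lemma sum_free_unit A B a0 a1 a2 : A = [set a0; a1; a2] -> #|A| = #|B| ->
    sum_free_pairs B ->
    (forall g a, a \in A -> exists2 b, b \in B & h (E a * g) = E b * h g) ->
  exists2 k, k \is a GRing.unit & B = [set (k * a)%R | a in A].
Proof.
move=> AE AB sf hA; pose f g a := odflt 0%R [pick b in B | h (E a * g) == E b * h g].
have fP g a : a \in A -> f g a \in B /\ h (E a * g) = E (f g a) * h g.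
  move=> aA; rewrite /f; case: pickP => [b /andP[bB /eqP hb] // | no].
  by have [b bB hb] := hA g a aA; have := no b; rewrite bB hb eqxx.
have f_inj g : {in A &, injective (f g)}.
  move=> a a' aA a'A e; apply: (@qE_inj _ _ Q); apply: (mulIg g); apply: h_inj.
  by have [_ ->] := fP g a aA; have [_ ->] := fP g a' a'A; rewrite e.
have f_img g : B = f g @: A.
  apply/esym/eqP; rewrite eqEcard card_in_imset // AB leqnn andbT.
  by apply/subsetP=> _ /imsetP[a aA ->]; have [] := fP g a aA.
have f_neq g a a' : a \in A -> a' \in A -> a != a' -> f (E a * g) a' = f g a'.
  move=> aA a'A aa'; have [faB fa] := fP g a aA; have [fa'B fa'] := fP g a' a'A.
  have [f1B f1] := fP (E a * g) a' a'A; have [f2B f2] := fP (E a' * g) a aA.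
  apply: (sf _ _ _ _ faB fa'B f1B f2B).
    by apply: contraNneq aa' => /f_inj ->.
  apply: (@qE_inj _ _ Q); apply: (mulIg (h g)).
  rewrite addrC -(qEE Q _ (f g a)) -mulgA -fa -f1 [in RHS]addrC -(qEE Q _ (f g a')) -mulgA.
  by rewrite -fa' -f2 !mulgA !qEE addrC.
(* For a' = a the label is the only one left, since the labels at each vertex form a bijection from
   A to B. *)
have f_const g a a' : a \in A -> a' \in A -> f (E a * g) a' = f g a'.
  move=> aA a'A; have [<- | aa'] := eqVneq a a'; last exact: f_neq.
  have [fB _] := fP (E a * g) a aA; move: fB; rewrite (f_img g) => /imsetP[b bA fb].
  have [ba | ab] := eqVneq b a; first by rewrite fb ba.
  have := f_neq g a b aA bA; rewrite eq_sym ab => /(_ isT); rewrite -fb.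
  by move/f_inj => /(_ bA aA) ba; rewrite ba eqxx in ab.
have [a0A a1A a2A] : [/\ a0 \in A, a1 \in A & a2 \in A] by rewrite AE !inE !eqxx !orbT.
pose inv g := forall a, a \in A -> f g a = f 1 a.
have [||g ig|k kU [k0 k1 k2]] := @translation_unit inv a0 a1 a2 (f 1 a0) (f 1 a1) (f 1 a2).
- by [].
- by move=> g ig; rewrite -!ig //; split;
    [have [] := fP g a0 a0A | have [] := fP g a1 a1A | have [] := fP g a2 a2A].
- by split=> a aA; rewrite f_const // ig.
exists k => //; rewrite (f_img 1); apply: eq_in_imset => a.
by rewrite AE !inE -orbA => /or3P[] /eqP ->.
Qed.

End CayleyAffine.

Section CayleyTypeI.

Import GRing.Theory.

Variables (n : nat) (gT : finGroupType) (Q : quat_coords n gT).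
Hypotheses (n_gt1 : 1 < n) (n_odd : odd n).

Local Notation E := (qE Q).
Local Notation nu := (half_turn n).
Local Notation R := 'Z_(2 * n).
Implicit Types (a b d e i j k s t w x y : R) (A B : {set R}) (g : gT) (S T : {set gT}).

Let N_gt1 : 1 < 2 * n. Proof. by rewrite mul2n -addnn ltn_addl. Qed.
Let nu0 : nu != 0%R := half_turn_neq0 n_gt1.

Lemma cay_qE_step A B (h : gT -> gT) a g :
    (forall g1 g2, cay (E @: B) (h g1) (h g2) = cay (E @: A) g1 g2) ->
  a \in A -> exists2 b, b \in B & h (E a * g) = E b * h g.
Proof.
move=> h_iso aA; have [_ /imsetP[b bB ->] hb] := cay_iso_mul h_iso g (imset_f E aA).
by exists b.
Qed.

Lemma cay_closed_walks A B (h : gT -> gT) (k : nat) g a b : bijective h ->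
    (forall g1 g2, cay (E @: B) (h g1) (h g2) = cay (E @: A) g1 g2) ->
    h (E a * g) = E b * h g ->
  closed_walks Q B k (h g, false) b = closed_walks Q A k (g, false) a.
Proof.
move=> h_bij h_iso hab; have [l_bij l_iso] := cay_iso_lift h_bij h_iso.
rewrite /closed_walks /nb /= -hab.
exact: (walks_iso _ (E a * g, true) (g, false) l_bij l_iso).
Qed.

Lemma half_turn_unit k : k \is a GRing.unit -> (k * nu = nu)%R.
Proof.
move=> kU; have [] := @two_torsion n n_gt1 (k * nu)%R => //.
  by rewrite -mulrnAr mulr2n half_turnD mulr0.
by move/eqP; rewrite -[X in _ == X](mulr0 k) (inj_eq (mulrI kU)) (negPf nu0).
Qed.

Lemma sum_free_class A : #|A| = 3 -> ~ class1 A -> ~ class2 A -> sum_free_pairs A.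
Proof.
move=> A3 n1 n2 p q r s pA qA rA sA pq e.
have [l [AE pl ql]] := card3_third A3 pA qA pq.
have AE1 : A = [set q; p; l] by rewrite AE (setUC [set p]).
have [qp lp lq] : [/\ q != p, l != p & l != q] by split; rewrite eq_sym.
have no2 x y z : A = [set x; y; z] -> x != y -> y != z -> (x *+ 2 = y + z)%R -> False.
  by move=> Axyz xy yz /(double_class2 Axyz xy yz)/n2.
move: rA sA; rewrite AE !inE -!orbA => /or3P[] /eqP er // /or3P[] /eqP es; rewrite er es in e *.
- by move: e => /addIr/eqP; rewrite (negPf pq).
- by case: n1; apply: (double_class1 n_gt1 AE pq pl ql); rewrite !mulr2n.
- by case: (no2 _ _ _ AE pq ql); rewrite mulr2n.
- by move: e => /eqP; rewrite addrC (inj_eq (addIr p)) (negPf lq).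
- by case: (no2 _ _ _ AE1 qp pl); rewrite mulr2n.
by move: e => /addIr/eqP; rewrite (negPf pq).
Qed.

Lemma sum_free_pair a b : (a *+ 2 != b *+ 2)%R -> sum_free_pairs [set a; b].
Proof.
move=> ab2 p q r s; rewrite !inE => /orP[] /eqP-> /orP[] /eqP-> /orP[] /eqP-> /orP[] /eqP->;
  rewrite ?eqxx // => _ /eqP.
all: rewrite -?mulr2n ?(negPf ab2) ?[(b *+ 2 == _)%R]eq_sym ?(negPf ab2) //.
all: rewrite ?mulr2n ?[(a + b)%R]addrC ?(inj_eq (addIr _)) ?(inj_eq (addrI _)) => /eqP //.
Qed.

(** If 3e != 0, closed walks of length 4 recognise s, and the other two labels give translation by e
    up to sign. If 3e = 0, both sets are cosets of <e>, and comparing the generated subgroups is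
    enough. *)
Lemma class2_cay_unit s s' e (A := [set s; (s + e)%R; (s - e)%R])
    (B := [set s'; (s' + e)%R; (s' - e)%R]) :
    e != 0%R -> (e *+ 2 != 0)%R -> graph_iso (cay (E @: A)) (cay (E @: B)) ->
  exists2 k, k \is a GRing.unit & B = [set (k * i)%R | i in A].
Proof.
move=> e0 e2 iso; have [e3 | e3] := eqVneq (e *+ 3)%R 0%R; last first.
  case: iso => h [h_bij h_iso]; have h_inj := bij_inj h_bij.
  have e3F := negbTE e3.
  have hs g : h (E s * g) = E s' * h g.
    have sA : s \in A by rewrite !inE eqxx.
    have [b bB hb] := cay_qE_step g h_iso sA.
    have := cay_closed_walks 3 h_bij h_iso hb; rewrite hb.
    have := walks_class2 Q n_gt1 n_odd s (g, false) e0 e2; rewrite e3F => -[-> _ _].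
    have := walks_class2 Q n_gt1 n_odd s' (h g, false) e0 e2; rewrite e3F => -[_ W1 W2].
    by move: bB; rewrite !inE -orbA => /or3P[] /eqP -> //; rewrite ?W1 ?W2.
  have he g : h (E e * g) = E e * h g \/ h (E e * g) = E (- e)%R * h g.
    pose g0 := E (- s)%R * g.
    have gE : g = E s * g0 by rewrite mulgA qEE subrr qE0 mul1g.
    have egE : E e * g = E (s + e)%R * g0 by rewrite mulgA qEE addrAC subrr add0r.
    have hg0 : h g0 = E (- s')%R * h g by rewrite gE hs mulgA qEE addNr qE0 mul1g.
    have seA : (s + e)%R \in A by rewrite !inE eqxx orbT.
    have [b bB hb] := cay_qE_step g0 h_iso seA; rewrite egE hb.
    have := cay_closed_walks 3 h_bij h_iso hb.
    have := walks_class2 Q n_gt1 n_odd s (g0, false) e0 e2; rewrite e3F => -[_ -> _].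
    have := walks_class2 Q n_gt1 n_odd s' (h g0, false) e0 e2; rewrite e3F => -[W0 _ _].
    move: bB; rewrite !inE -orbA => /or3P[] /eqP -> ; first by rewrite W0.
      by left; rewrite hg0 mulgA qEE addrAC subrr add0r.
    by right; rewrite hg0 mulgA qEE addrAC subrr add0r.
  have [k kU [ks ke]] := translation_unit2 n_gt1 h_inj e2 hs he.
  exists k => //; rewrite imset3 mulrBr mulrDr ks; case: ke => -> //.
  by rewrite opprK /B setUAC.
have torsion d : (d *+ 3 = 0)%R -> [\/ d = 0%R, d = e | d = (- e)%R].
  by move=> d3; apply: Zp_torsion3.
have e2E : (e + e = - e)%R by apply/eqP; rewrite -addr_eq0 -mulr2n -mulrSr e3.
have shift x : [\/ x = 0%R, x = e | x = (- e)%R] -> forall y,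
    [set (y + x)%R; (y + x + e)%R; (y + x - e)%R] = [set y; (y + e)%R; (y - e)%R].
  case=> -> y; first by rewrite addr0.
    rewrite addrK -[(y + e + e)%R]addrA e2E; apply/setP=> z; rewrite !inE.
    by do 3?[case: (z == _)].
  rewrite subrK -[(y - e - e)%R]addrA -opprD e2E opprK; apply/setP=> z; rewrite !inE.
  by do 3?[case: (z == _)].
(* A representative x + d of the coset is chosen that has e among its multiples, so that it
   generates everything: d = 0 if 3 divides the order of x, and d = e otherwise, multiplying by that
   order. *)
have base x : exists d, [\/ d = 0%R, d = e | d = (- e)%R] /\
    exists m, e = ((x + d) *+ m)%R.
  have xo y : (y *+ #[E y] = 0)%R.
    by apply/eqP; rewrite -(qE1_eq Q) -qEX expg_order.
  have pm y m : [\/ y *+ m = 0, y *+ m = e | y *+ m = - e]%R -> (y *+ m != 0)%R ->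
      exists m', e = (y *+ m')%R.
    case=> [-> | ym _ | ym _]; first by rewrite eqxx.
      by exists m.
    by exists (m * (2 * n).-1)%N; rewrite (Zp_mulrn_opp N_gt1) ym opprK.
  have [/dvdnP[q oq] | no3] := boolP (3 %| #[E x]).
    exists 0%R; split; first exact: Or31.
    rewrite addr0; apply: (pm x q).
      by apply: torsion; rewrite -mulrnA -oq xo.
    rewrite -(qE1_eq Q) -qEX -order_dvdn oq; apply: contraL (order_gt0 (E x)).
    rewrite oq => /dvdn_leq; case: q {oq} => // q /(_ isT).
    by rewrite mulnC -[X in _ <= X]mul1n leq_pmul2r.
  exists e; split; first exact: Or32.
  have xe : ((x + e) *+ #[E x] = e *+ #[E x])%R by rewrite mulrnDl xo add0r.
  apply: (pm _ #[E x]); rewrite xe.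
    by apply: torsion; rewrite mulrnAC e3 mul0rn.
  by rewrite mulrn_order3.
have gen x d (D := [set x; (x + e)%R; (x - e)%R]) : [\/ d = 0%R, d = e | d = (- e)%R] ->
    (exists m, e = ((x + d) *+ m)%R) -> <<E @: D>> = <[E (x + d)%R]>.
  move=> dP [m em]; rewrite /D -(shift d dP x); apply: gen_cycle.
    by rewrite mem_gen // imset_f // !inE eqxx.
  move=> i; rewrite !inE -orbA => /or3P[] /eqP ->.
  - by exists 1%N; rewrite mulr1n.
  - by exists m.+1; rewrite mulrS -em.
  by exists (m * (2 * n).-1).+1; rewrite mulrS (Zp_mulrn_opp N_gt1) -em.
have [d [dP em]] := base s; have [d' [d'P em']] := base s'.
have := cay_iso_gen iso; rewrite /A /B (gen _ _ dP em) (gen _ _ d'P em').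
case/(order_unit n_gt1) => k kU kd; exists k => //.
rewrite -(shift d dP s) -(shift d' d'P s') imset3 mulrBr [(k * (_ + e))%R]mulrDr kd.
have [||->|->] := torsion (k * e)%R; first by rewrite -mulrnAr e3 mulr0.
- by move/eqP; rewrite -[X in _ == X](mulr0 k) (inj_eq (mulrI kU)) (negPf e0).
- by [].
by rewrite opprK /B setUAC.
Qed.

(** The group Z/2n is the direct sum of {0, [nu]} and its part of odd order n, so the pair has a
    representative in the latter. *)
Lemma half_turn_pair_normal s : exists s0,
  (s0 *+ n = 0)%R /\ [set s; (s + nu)%R] = [set s0; (s0 + nu)%R].
Proof.
have [|sn|sn] := @two_torsion n n_gt1 (s *+ n)%R.
- by apply/eqP; rewrite -mulrnA Zp_mulrn_eq0 // [(n * 2)%N]mulnC dvdn_mull.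
- by exists s.
exists (s + nu)%R; rewrite mulrnDl sn half_turn_mulrn n_odd half_turnD.
by rewrite -addrA half_turnD addr0 setUC.
Qed.

Lemma gen_half_turn_pair s : (s *+ n = 0)%R ->
  exists2 m, s = ((s + nu) *+ m)%R & nu = ((s + nu) *+ n)%R.
Proof.
move=> sn; have e : ((s + nu) *+ n = nu)%R.
  by rewrite mulrnDl sn add0r half_turn_mulrn n_odd.
by exists n.+1; rewrite // mulrSr e addrCA half_turnD addr0.
Qed.

Lemma half_turn_pair_unit s s' : (s *+ n = 0)%R -> (s' *+ n = 0)%R ->
  #[E (s + nu)%R] = #[E (s' + nu)%R] -> exists2 k, k \is a GRing.unit & (k * s = s')%R.
Proof.
move=> sn s'n /(order_unit n_gt1)[k kU]; rewrite mulrDr half_turn_unit // => /addIr ks.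
by exists k.
Qed.

Lemma pair_cay_unit s s' (A := [set s; (s + nu)%R]) (B := [set s'; (s' + nu)%R]) :
  graph_iso (cay (E @: A)) (cay (E @: B)) ->
  exists2 k, k \is a GRing.unit & B = [set (k * i)%R | i in A].
Proof.
rewrite /A /B; have [t [tn ->]] := half_turn_pair_normal s.
have [t' [t'n ->]] := half_turn_pair_normal s'.
have gen x : (x *+ n = 0)%R -> <<E @: [set x; (x + nu)%R]>> = <[E (x + nu)%R]>.
  move=> xn; have [m xm nun] := gen_half_turn_pair xn.
  apply: gen_cycle; first by rewrite mem_gen // imset_f // !inE eqxx orbT.
  move=> i; rewrite !inE => /orP[] /eqP ->; first by exists m.
  by exists 1%N; rewrite mulr1n.
move/cay_iso_gen; rewrite !gen //; case/(half_turn_pair_unit tn t'n) => k kU kt.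
by exists k => //; rewrite imsetU !imset_set1 mulrDr half_turn_unit // kt.
Qed.

(** Walks recognise t, while s and s + [nu] may be interchanged at any vertex. So h is controlled
    only up to [nu], and the relations that transfer are those between the doubles of s and t. *)
Lemma class1_cay_unit s t s' t' (A := [set s; (s + nu)%R; t])
    (B := [set s'; (s' + nu)%R; t']) :
    t != s -> t != (s + nu)%R -> t' != s' -> t' != (s' + nu)%R ->
    graph_iso (cay (E @: A)) (cay (E @: B)) ->
  exists2 k, k \is a GRing.unit & B = [set (k * i)%R | i in A].
Proof.
move=> ts tsn ts' tsn' [h [h_bij h_iso]]; have h_inj := bij_inj h_bij.
have [sA snA tA] : [/\ s \in A, (s + nu)%R \in A & t \in A].
  by rewrite !inE !eqxx !orbT.
have ht g : h (E t * g) = E t' * h g.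
  have [b bB hb] := cay_qE_step g h_iso tA.
  have := cay_closed_walks 3 h_bij h_iso hb; rewrite hb.
  have [_ _ ->] := walks_class1 Q n_gt1 n_odd (g, false) ts tsn.
  have [W0 W1 _] := walks_class1 Q n_gt1 n_odd (h g, false) ts' tsn'.
  by move: bB; rewrite !inE -orbA => /or3P[] /eqP -> //; rewrite ?W0 ?W1.
have pairP a g : a \in A -> a != t ->
    h (E a * g) = E s' * h g \/ h (E a * g) = E (s' + nu)%R * h g.
  move=> aA at'; have [b bB hb] := cay_qE_step g h_iso aA.
  have := cay_closed_walks 3 h_bij h_iso hb; rewrite hb.
  have [_ _ W2] := walks_class1 Q n_gt1 n_odd (h g, false) ts' tsn'.
  have [W0 W1 _] := walks_class1 Q n_gt1 n_odd (g, false) ts tsn.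
  move: bB; rewrite !inE -orbA => /or3P[] /eqP ->; [by left | by right | rewrite W2].
  by move: aA at'; rewrite !inE -orbA => /or3P[] /eqP -> //; rewrite ?W0 ?W1 ?eqxx.
have hnu g : h (E nu * g) = E nu * h g.
  pose g0 := E (- s)%R * g.
  have gE : g = E s * g0 by rewrite mulgA qEE subrr qE0 mul1g.
  have ngE : E nu * g = E (s + nu)%R * g0 by rewrite mulgA qEE addrAC subrr add0r.
  have nn : E nu * E nu = 1 by rewrite qEE half_turnD qE0.
  have neq : h (E nu * g) <> h g.
    move=> /h_inj e; case/eqP: nu0; apply/eqP; rewrite -(qE1_eq Q); apply/eqP.
    by apply: (mulIg g); rewrite mul1g.
  have st : s != t by rewrite eq_sym.
  have snt : (s + nu)%R != t by rewrite eq_sym.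
  move: neq; rewrite ngE [in h g]gE.
  case: (pairP s g0 sA st) => ->; case: (pairP _ g0 snA snt) => -> //.
    by move=> _; rewrite mulgA qEE addrC.
  by move=> _; rewrite mulgA qEE addrCA half_turnD addr0.
pose near (z : R) := z = 0%R \/ z = nu.
have nearD y z : near y -> near z -> near (y + z)%R.
  by case=> ->; case=> ->; rewrite ?add0r ?addr0 ?half_turnD; [left|right|right|left].
have near2 z : near z <-> (z *+ 2 = 0)%R.
  by split=> [[] -> | /(two_torsion n_gt1)]; rewrite ?mul0rn // mulr2n half_turnD.
have walk (l m : nat) : exists2 z, near z &
    h (E (s *+ l + t *+ m)%R) = E (s' *+ l + t' *+ m + z)%R * h 1.
  elim: l => [|l [z z0 IHl]].
    exists 0%R; first by left.
    rewrite !mulr0n !add0r addr0; elim: m => [|m IHm]; first by rewrite !mulr0n qE0 mul1g.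
    by rewrite !mulrS -(qEE Q t) ht IHm mulgA qEE.
  have -> : (s *+ l.+1 + t *+ m = s + (s *+ l + t *+ m))%R by rewrite mulrS addrA.
  have st : s != t by rewrite eq_sym.
  rewrite -qEE; case: (pairP s (E (s *+ l + t *+ m)%R) sA st) => ->; rewrite IHl mulgA qEE.
    by exists z => //; congr (E _ * _); rewrite mulrS !addrA.
  exists (nu + z)%R; first by apply: nearD => //; right.
  by congr (E _ * _); rewrite mulrS; ring.
have near_h z : near z <-> exists2 y, near y & h (E z) = E y * h 1.
  split=> [[] -> | [y [] -> ]].
  - by exists 0%R; [left | rewrite qE0 mul1g].
  - by exists nu; [right | rewrite -[E nu]mulg1 hnu mulg1].
  - by rewrite qE0 mul1g => /h_inj/eqP; rewrite qE1_eq => /eqP ->; left.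
  by rewrite -hnu => /h_inj; rewrite mulg1 => /qE_inj ->; right.
have rel (l m p : nat) : ((s *+ 2) *+ l + (t *+ 2) *+ m + 0 *+ p = 0 <->
    (s' *+ 2) *+ l + (t' *+ 2) *+ m + 0 *+ p = 0)%R.
  rewrite !mul0rn !addr0 !(mulrnAC _ 2) -!mulrnDl -!near2 near_h.
  have [z z0 hz] := walk l m; split=> [[y y0 hy] | near'].
    move: hz; rewrite hy => /mulIg/qE_inj ye.
    have -> : (s' *+ l + t' *+ m = y + z)%R.
      rewrite ye -addrA; case: z0 => ->; by rewrite ?addr0 // half_turnD addr0.
    exact: nearD.
  by exists (s' *+ l + t' *+ m + z)%R => //; apply: nearD.
have [k kU [ks kt _]] := unit_rel3 N_gt1 rel.
have near_diff a b : (k * (a *+ 2) = b *+ 2)%R -> near (k * a - b)%R.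
  by move=> e; apply/near2; rewrite mulrnBl -mulrnAr e subrr.
(* Doubling leaves k t = t' or k t = t' + [nu]. Multiplication by n detects [nu] because n is odd,
   and it excludes the second case. *)
have tn_eq : (t *+ n == 0)%R = (t' *+ n == 0)%R.
  have hX m : h (E (t *+ m)%R) = E (t' *+ m)%R * h 1.
    elim: m => [|m IHm]; first by rewrite !mulr0n qE0 mul1g.
    by rewrite !mulrS -(qEE Q t) ht IHm mulgA qEE.
  apply/eqP/eqP=> e; have := hX n; rewrite e qE0 ?mul1g.
    by rewrite -[X in X = _]mul1g => /mulIg/esym/eqP; rewrite qE1_eq => /eqP.
  by move/h_inj/eqP; rewrite qE1_eq => /eqP.
have nn z : near (z *+ n)%R.
  by apply/near2/eqP; rewrite -mulrnA Zp_mulrn_eq0 // [(n * 2)%N]mulnC dvdn_mull.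
have ktE : (k * t = t')%R.
  case: (near_diff _ _ kt) => /eqP; rewrite subr_eq ?add0r => /eqP // e.
  have : (k * (t *+ n) = nu + t' *+ n)%R.
    by rewrite mulrnAr e mulrnDl half_turn_mulrn n_odd.
  case: (nn t) (nn t') => tn [] t'n; move: tn_eq; rewrite tn t'n ?eqxx ?(negPf nu0) // => _.
    by rewrite mulr0 addr0 => /esym/eqP; rewrite (negPf nu0).
  by rewrite half_turn_unit // half_turnD => /eqP; rewrite (negPf nu0).
exists k => //; rewrite imset3 mulrDr half_turn_unit // ktE.
case: (near_diff _ _ ks) => /eqP; rewrite subr_eq ?add0r => /eqP -> //.
by rewrite (addrC nu) -addrA half_turnD addr0 /B (setUC [set s']).
Qed.

(** Since B is a translate of A, it lies in the same class with the same difference e. Outside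
    classes 1 and 2 the labels propagate by [sum_free_unit]. *)
Lemma cay_typeI_unit A w (B := [set (i + w)%R | i in A]) : 1 < #|A| <= 3 ->
    graph_iso (cay (E @: A)) (cay (E @: B)) ->
  exists2 k, k \is a GRing.unit & B = [set (k * i)%R | i in A].
Proof.
move=> A_card iso; have AB : #|A| = #|B| by rewrite card_imset //; apply: addIr.
have free a0 a1 a2 : A = [set a0; a1; a2] -> sum_free_pairs B ->
    exists2 k, k \is a GRing.unit & B = [set (k * i)%R | i in A].
  move=> AE sf; case: iso => h [h_bij h_iso].
  apply: (sum_free_unit n_gt1 (bij_inj h_bij) AE AB sf) => g a.
  exact: cay_qE_step.
have [A2 | A3] : #|A| = 2 \/ #|A| = 3 by lia.
  move/eqP/cards2P: A2 => [a [b [ab AE]]].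
  have BE : B = [set (a + w)%R; (b + w)%R] by rewrite /B AE imsetU !imset_set1.
  have [e | e] := eqVneq (a *+ 2)%R (b *+ 2)%R; last first.
    apply: (free a b b); first by rewrite AE -setUA setUid.
    by rewrite BE; apply: sum_free_pair; rewrite !mulrnDl (inj_eq (addIr _)).
  have bE : b = (a + nu)%R.
    have [|z|z] := @two_torsion n n_gt1 (b - a)%R; first by rewrite mulrnBl e subrr.
      by move/eqP: z ab; rewrite subr_eq0 eq_sym => ->.
    by move/eqP: z; rewrite subr_eq addrC => /eqP.
  move: iso; rewrite BE AE bE (addrAC a); exact: pair_cay_unit.
have B3 : #|B| = 3 by rewrite -AB.
have [a0 [a1 [a2 [AE _ _ _]]]] := card3_set A3.
case: (class1P A) => [[s [t [A1 ts tsn]]] | n1].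
  have BE : B = [set s + w; s + w + nu; t + w]%R by rewrite /B A1 imset3 (addrAC s).
  move: iso; rewrite BE A1; apply: class1_cay_unit => //.
    by rewrite (inj_eq (addIr w)).
  by rewrite addrAC (inj_eq (addIr w)).
case: (class2P A) => [[s [e [A2 e0 e2]]] | n2].
  have BE : B = [set s + w; s + w + e; s + w - e]%R.
    by rewrite /B A2 imset3 (addrAC s e) (addrAC s (- e)%R).
  move: iso; rewrite BE A2; exact: class2_cay_unit.
have AB' : A = [set (i - w)%R | i in B].
  by rewrite /B -imset_comp -[LHS]imset_id; apply: eq_imset => i /=; rewrite addrK.
apply: (free _ _ _ AE); apply: sum_free_class => // -[s].
  case=> t [BE ts tsn]; apply: n1; exists (s - w)%R, (t - w)%R.
  rewrite AB' BE imset3 (addrAC s nu) !(inj_eq (addIr _)); split=> //.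
  by rewrite (addrAC s) (inj_eq (addIr _)).
case=> e [BE e0 e2]; apply: n2; exists (s - w)%R, e.
by rewrite AB' BE imset3 (addrAC s e) (addrAC s (- e)%R).
Qed.

End CayleyTypeI.

(** * Cayley digraphs of the remaining triples *)

Section CayleyTypeII.

Import GRing.Theory.

Variables (n : nat) (gT : finGroupType) (Q : quat_coords n gT).
Hypotheses (n_gt1 : 1 < n) (n_odd : odd n).

Local Notation E := (qE Q).
Local Notation F := (qF Q).
Local Notation nu := (half_turn n).
Local Notation R := 'Z_(2 * n).
Implicit Types (i j k u x y : R) (c d g s t : gT) (S T : {set gT}).

Let nu0 : nu != 0%R := half_turn_neq0 n_gt1.

Definition aut_equiv S T := exists sigma : {perm gT},
  sigma \in Aut [set: gT] /\ sigma @: S = T.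

Section Iso.

Variables (S T : {set gT}) (h : gT -> gT).
Hypotheses (h_bij : bijective h) (h_iso : forall g1 g2, cay T (h g1) (h g2) = cay S g1 g2).

Lemma cay_iso_onto t g : t \in T -> exists2 s, s \in S & h (s * g) = t * h g.
Proof.
move=> tT; have [h' hK h'K] := h_bij.
have : cay S g (h' (t * h g)) by rewrite -h_iso h'K; apply/cayP; exists t.
by case/cayP=> s sS e; exists s; rewrite // -e h'K.
Qed.

Lemma cay_iso_digon s t g : h (s * g) = t * h g -> (s^-1 \in S) = (t^-1 \in T).
Proof.
move=> e; have := h_iso (s * g) g; rewrite e !cayE !invMg !mulgA !mulgV !mul1g.
by move->.
Qed.

End Iso.

Lemma Zp_neg_eq u : (- u == u)%R = (u *+ 2 == 0)%R.
Proof. by rewrite eq_sym -addr_eq0 mulr2n. Qed.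

(** A 2-cycle recognises E u when u = [nu]; otherwise the directed 4-cycles produced by F j
    recognise F j. *)
Lemma cay_mixed_pair u j u' j' : u != 0%R -> u' != 0%R ->
  graph_iso (cay [set E u; F j]) (cay [set E u'; F j']) ->
  aut_equiv [set E u; F j] [set E u'; F j'].
Proof.
move=> u0 u'0 [h [h_bij h_iso]]; have h_inj := bij_inj h_bij.
suff [k kU ku] : exists2 k, k \is a GRing.unit & (k * u = u')%R.
  have [a aA [aE aF]] := qaut Q n_gt1 (j' - k * j)%R kU; exists a; split=> //.
  by rewrite imsetU !imset_set1 aE aF ku addrC subrK.
have digE y l : y != 0%R -> ((E y)^-1 \in [set E y; F l]) = (y == nu).
  move=> y0; rewrite !inE qEV !q_eqs orbF Zp_neg_eq.
  by apply/eqP/eqP=> [/(two_torsion n_gt1)[/eqP|]|->]; rewrite ?(negPf y0) // mulr2n half_turnD.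
have digF y l : ((F l)^-1 \in [set E y; F l]) = false.
  by rewrite !inE qFV !q_eqs -{2}[l]addr0 (inj_eq (addrI l)) (negPf nu0).
have [t tT ht] := cay_iso_mul h_iso 1 (set21 (E u) (F j)).
have := cay_iso_digon h_iso ht; rewrite digE // => dt.
have [s sS hs] := cay_iso_onto h_bij h_iso 1 (set21 (E u') (F j')).
have := cay_iso_digon h_iso hs; rewrite digE // => ds.
have [unu | unu] := eqVneq u nu.
  move: dt; rewrite unu eqxx; case/set2P: tT => ->; rewrite ?digF // digE // => /esym/eqP ->.
  by exists 1%R; rewrite ?unitr1 ?mul1r.
have u'nu : u' != nu.
  by rewrite -ds; case/set2P: sS => ->; rewrite ?digF // digE.
(* The fourth power of F j gives a closed walk. If its image began with E u', the four labels would
   force 4u' = 0, 2u' = [nu] or [nu] = 0. *)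
have hF g : h (F j * g) = F j' * h g.
  have FS := set22 (E u) (F j).
  have [t1 t1T h1] := cay_iso_mul h_iso g FS.
  have [t2 t2T h2] := cay_iso_mul h_iso (F j * g) FS.
  have [t3 t3T h3] := cay_iso_mul h_iso (F j * (F j * g)) FS.
  have [t4 t4T h4] := cay_iso_mul h_iso (F j * (F j * (F j * g))) FS.
  have F4 : F j * (F j * (F j * (F j * g))) = g.
    rewrite !mulgA (_ : F j * F j * F j * F j = F j ^+ 4) ?qFX4 ?mul1g //.
    by have := qFX4 Q j; rewrite !expgS expg0 mulg1 !mulgA.
  rewrite F4 h3 h2 h1 in h4.
  have {h4} : t4 * (t3 * (t2 * t1)) = 1.
    by apply: (mulIg (h g)); rewrite mul1g -!mulgA -h4.
  rewrite h1; case/set2P: t1T => -> //; case/set2P: t2T => ->; case/set2P: t3T => ->;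
    case/set2P: t4T => ->; rewrite !qM => /eqP; rewrite q_eqs //.
  - rewrite (_ : _ + _ = u' *+ 4)%R; last by ring.
    by move/eqP/(four_torsion n_gt1 n_odd)/(two_torsion n_gt1)=> [] /eqP;
       rewrite ?(negPf u'0) ?(negPf u'nu).
  - rewrite (_ : j' - _ + nu = u' *+ 2 + nu)%R; last by ring.
    by rewrite addr_eq0 half_turnN (negPf (double_neq_half n_gt1 n_odd _)).
  - rewrite (_ : j' - _ + nu = nu)%R; last by ring.
    by rewrite (negPf nu0).
  rewrite (_ : u' + _ = u' *+ 2 + nu)%R; last by ring.
  by rewrite addr_eq0 half_turnN (negPf (double_neq_half n_gt1 n_odd _)).
have hE g : h (E u * g) = E u' * h g.
  have [t1 t1T h1] := cay_iso_mul h_iso g (set21 (E u) (F j)).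
  case/set2P: t1T h1 => -> // h1; have := hF g; rewrite -h1 => /h_inj/mulIg/eqP.
  by rewrite q_eqs.
exact: (translation_unit1 n_gt1 h_inj hE).
Qed.

(** These are the two shapes of {c, c E x, c F l}, for c inside and outside <a>. A translation can
    exchange them, so Cayley digraphs of both shapes have to be compared. *)
Definition formEEF x u j : {set gT} := [set E u; E (u + x)%R; F j].
Definition formFFE x i u : {set gT} := [set F i; F (i - x)%R; E u].

Lemma formEEF_coset x u j : formEEF x u j = [set E u; E u * E x; E u * F (j - u)%R].
Proof. by rewrite !qM [(u + (j - u))%R]addrC subrK. Qed.

Lemma formFFE_coset x i u : formFFE x i u = [set F i; F i * E x; F i * F (i + nu - u)%R].
Proof.
rewrite !qM; congr [set _; _; E _].
rewrite (_ : i - (i + nu - u) + nu = u + (nu - nu))%R ?subrr ?addr0 //; ring.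
Qed.

Lemma coset_forms c x j : (exists u l, [set c; c * E x; c * F j] = formEEF x u l) \/
  (exists i u, [set c; c * E x; c * F j] = formFFE x i u).
Proof.
case: (q_cover Q c) => -[i ->]; [left | right].
  by exists i, (i + j)%R; rewrite formEEF_coset addrC addKr.
exists i, (i + nu - j)%R; rewrite formFFE_coset (_ : i + nu - _ = j)%R //; ring.
Qed.

Lemma special_label x c d j l (h : gT -> gT) : x != 0%R -> x != nu -> (x *+ 3 != nu)%R ->
    bijective h ->
    (forall g1 g2, cay [set d; d * E x; d * F l] (h g1) (h g2) =
                   cay [set c; c * E x; c * F j] g1 g2) ->
  forall g, h (c * F j * g) = d * F l * h g.
Proof.
move=> x0 xnu x3 h_bij h_iso g; have [l_bij l_iso] := cay_iso_lift h_bij h_iso.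
have [_ /(_ xnu x3 (g, false))] := iso_colourII n_gt1 n_odd x0 x0 l_bij l_iso.
by case.
Qed.

Section Labelled.

Variables (x : R) (h : gT -> gT).
Hypotheses (x0 : x != 0%R) (xnu : x != nu) (h_bij : bijective h).

Let h_inj := bij_inj h_bij.

(** With F j recognised, the other two labels form a pair whose difference x satisfies 2x != 0, and
    labels of such a pair propagate. *)
Lemma formEEF_labelled u j u' j' :
    (forall g1 g2, cay (formEEF x u' j') (h g1) (h g2) = cay (formEEF x u j) g1 g2) ->
    (forall g, h (F j * g) = F j' * h g) ->
  aut_equiv (formEEF x u j) (formEEF x u' j').
Proof.
move=> h_iso hF; pose A := [set u; (u + x)%R]; pose B := [set u'; (u' + x)%R].
have card2 (y : R) : #|[set y; (y + x)%R]| = 2.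
  by rewrite cards2 -{1}[y]addr0 (inj_eq (addrI y)) eq_sym x0.
have hA g a : a \in A -> exists2 b, b \in B & h (E a * g) = E b * h g.
  move=> aA; have aS : E a \in formEEF x u j.
    by move: aA; rewrite !inE => /orP[] /eqP ->; rewrite eqxx ?orbT.
  have [t tT ht] := cay_iso_mul h_iso g aS.
  move: tT; rewrite !inE -orbA => /or3P[] /eqP et; rewrite et in ht.
  - by exists u'; rewrite // !inE eqxx.
  - by exists (u' + x)%R; rewrite // !inE eqxx orbT.
  by move: ht; rewrite -hF => /h_inj/mulIg/eqP; rewrite q_eqs.
have AE : A = [set u; (u + x)%R; (u + x)%R] by rewrite /A -setUA setUid.
have [||k kU BE] := sum_free_unit n_gt1 h_inj AE _ _ hA.
- by rewrite !card2.
- apply: sum_free_pair; rewrite mulrnDl eq_sym -subr_eq0 addrAC subrr add0r.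
  exact: Zp_double_neq0.
have [a aA [aE aF]] := qaut Q n_gt1 (j' - k * j)%R kU; exists a; split=> //.
rewrite /formEEF imsetU imset_set1 aF [(k * j + _)%R]addrC subrK; congr (_ :|: _).
have <- : E @: B = [set E u'; E (u' + x)%R] by rewrite imsetU !imset_set1.
by rewrite BE /A !imsetU !imset_set1 !aE.
Qed.

(** The vertex F (i - x) g is an out-neighbour of both g and E x g. Comparing its images along the
    two arcs shows that h carries translation by x to translation by x or -x; the sign -x exchanges
    the two elements outside <a>. *)
Lemma formFFE_labelled i u i' u' :
    (forall g1 g2, cay (formFFE x i' u') (h g1) (h g2) = cay (formFFE x i u) g1 g2) ->
    (forall g, h (E u * g) = E u' * h g) ->
  aut_equiv (formFFE x i u) (formFFE x i' u').
Proof.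
move=> h_iso hE.
have hF (p : R) g : F p \in formFFE x i u -> h (F p * g) = F i' * h g \/
    h (F p * g) = F (i' - x)%R * h g.
  move=> pS; have [t tT ht] := cay_iso_mul h_iso g pS.
  move: tT; rewrite !inE -orbA => /or3P[] /eqP et; rewrite et in ht; [by left | by right|].
  by move: ht; rewrite -hE => /h_inj/mulIg/eqP; rewrite q_eqs.
have iS : F i \in formFFE x i u by rewrite !inE eqxx.
have ixS : F (i - x)%R \in formFFE x i u by rewrite !inE eqxx orbT.
have hx g : h (E x * g) = E x * h g \/ h (E x * g) = E (- x)%R * h g.
  have e : F i * (E x * g) = F (i - x)%R * g by rewrite mulgA qFE.
  have cancelF (p q : R) a b : F p * a = F q * b -> a = E (p - q)%R * b.
    move=> /(canRL (mulKg _)) ->; rewrite mulgA !qM; congr (E _ * _).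
    rewrite (_ : p + nu - q + nu = p - q + (nu + nu))%R; last by ring.
    by rewrite half_turnD addr0.
  have xg : E x * g <> g.
    by rewrite -[X in _ <> X]mul1g => /mulIg/eqP; rewrite q_eqs (negPf x0).
  have nxg y : y = 0%R -> h (E x * g) <> E y * h g.
    by move=> ->; rewrite qE0 mul1g => /h_inj.
  have := hF _ g ixS; rewrite -e => -[] h2; have := hF _ (E x * g) iS => -[] h1;
    rewrite h1 in h2; have := cancelF _ _ _ _ h2.
  - by move/nxg; rewrite subrr => /(_ erefl).
  - by move=> ->; right; congr (E _ * _); ring.
  - by move=> ->; left; congr (E _ * _); ring.
  by move/nxg; rewrite subrr => /(_ erefl).
have x2 := Zp_double_neq0 n_gt1 x0 xnu.
have [k kU [ku kx]] := translation_unit2 n_gt1 h_inj x2 hE hx.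
case: kx => kx.
  have [a aA [aE aF]] := qaut Q n_gt1 (i' - k * i)%R kU; exists a; split=> //.
  rewrite /formFFE imset3 aE !aF ku mulrBr kx; congr [set F _; F _; _]; ring.
have [a aA [aE aF]] := qaut Q n_gt1 (i' - x - k * i)%R kU; exists a; split=> //.
rewrite /formFFE imset3 aE !aF ku mulrBr kx (setUC [set F _]).
congr [set F _; F _; _]; ring.
Qed.

End Labelled.

(** Four steps along F j return to the start, so 4u = 0 and hence 2u = 0; then two steps would
    already return, contrary to F j having order 4. *)
Lemma form_labelled_neq (h : gT -> gT) j u : injective h ->
  ~ (forall g, h (F j * g) = E u * h g).
Proof.
move=> h_inj hF; have F4 : F j * (F j * (F j * (F j * 1))) = 1.
  by have := qFX4 Q j; rewrite !expgS expg0.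
have : E (u *+ 4)%R * h 1 = 1 * h 1.
  rewrite mul1g -{2}F4 !hF !mulgA !qEE; congr (E _ * _).
  by rewrite !mulrS mulr0n addr0 !addrA.
move/mulIg/eqP; rewrite qE1_eq => /eqP/(four_torsion n_gt1 n_odd) u2.
have : h (F j * (F j * 1)) = h 1 by rewrite !hF mulgA qEE -mulr2n u2 qE0 mul1g.
by move/h_inj/eqP; rewrite mulg1 qFF subrr add0r q_eqs (negPf nu0).
Qed.

(** Both u and [nu] are multiples of u + [nu]. The cyclic group it generates is normalised by F j
    and contains the square of F j, so it has index 2. *)
Lemma gen_formEEF_half u j : (u *+ n = 0)%R ->
  #|<<formEEF nu u j>>| = (#[E (u + nu)%R] * 2)%N.
Proof.
move=> un; set e := (u + nu)%R; pose C := <[E e]>%G.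
have [m um nun] := gen_half_turn_pair n_odd un.
have uC : E u \in C by rewrite um -qEX mem_cycle.
have nC : E nu \in C by rewrite nun -qEX mem_cycle.
have CE c : c \in C -> exists i, c = E i.
  by case/cycleP=> q ->; exists (e *+ q)%R; rewrite qEX.
have dis : C :&: (C :* F j) = set0.
  apply/setP=> c; rewrite !inE mem_rcoset; apply/andP=> -[/CE[i ->]].
  by case/CE=> l; rewrite qFV qEF => /eqP; rewrite q_eqs.
have -> : <<formEEF nu u j>> = C :|: C :* F j.
  apply/eqP; rewrite eqEsubset; apply/andP; split.
    apply: gen_sub_closed => [|s c sS]; first by rewrite inE group1.
    have FC c1 : c1 \in C -> F j * c1 \in C :* F j.
      move=> c1C; have [i ci] := CE _ c1C; rewrite mem_rcoset ci qM qFV qFF.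
      rewrite (_ : j - i - (j + nu) + nu = - i)%R; last by ring.
      by rewrite -qEV groupV -ci.
    have EC z : z \in C -> c \in C :|: C :* F j -> z * c \in C :|: C :* F j.
      move=> zC; rewrite !inE !mem_rcoset => /orP[cC | cC]; apply/orP; [left | right].
        by rewrite groupM.
      by rewrite -mulgA groupM.
    move: sS; rewrite !inE -orbA => /or3P[] /eqP ->.
    - by have := EC _ uC; rewrite !inE.
    - by have := EC _ (cycle_id (E e)); rewrite !inE.
    rewrite mem_rcoset => /orP[cC | cC]; apply/orP; [right | left]; first exact: FC.
    have [i ci] := CE _ cC; rewrite (canRL (mulgKV _) ci) qEF qFF.
    rewrite (_ : j - (i + j) + nu = - i + nu)%R; last by ring.
    by rewrite -qEE -qEV groupM // groupV -ci.
  rewrite subUset; apply/andP; split.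
    by rewrite cycle_subG mem_gen // !inE eqxx orbT.
  apply/subsetP=> c; rewrite mem_rcoset => cC; rewrite -[c](mulgKV (F j)) groupM //.
    by apply: (subsetP _ _ cC); rewrite cycle_subG mem_gen // !inE eqxx orbT.
  by rewrite mem_gen // !inE eqxx orbT.
by rewrite cardsU dis cards0 subn0 card_rcoset addnn -muln2.
Qed.

End CayleyTypeII.

(** * Cayley digraphs of the triples with x of order 2 *)

Section CayleyOrder2.

Import GRing.Theory.

Variables (n : nat) (gT : finGroupType) (Q : quat_coords n gT).
Hypotheses (n_gt1 : 1 < n) (n_odd : odd n).

Local Notation E := (qE Q).
Local Notation F := (qF Q).
Local Notation nu := (half_turn n).
Local Notation R := 'Z_(2 * n).
Implicit Types (i j k u x y : R) (c d g s t : gT) (S T : {set gT}).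

Let nu0 : nu != 0%R := half_turn_neq0 n_gt1.

Lemma formEEF_half_aut u j u' j' :
  graph_iso (cay (formEEF Q nu u j)) (cay (formEEF Q nu u' j')) ->
  aut_equiv (formEEF Q nu u j) (formEEF Q nu u' j').
Proof.
have normal v l : exists2 t : R, (t *+ n = 0)%R & formEEF Q nu v l = formEEF Q nu t l.
  have [t [tn e]] := half_turn_pair_normal n_gt1 n_odd v; exists t => //.
  have fE (w : R) : [set E w; E (w + nu)%R] = E @: [set w; (w + nu)%R].
    by rewrite imsetU !imset_set1.
  by rewrite /formEEF !fE e.
have [t tn ->] := normal u j; have [t' t'n ->] := normal u' j'.
move/cay_iso_gen; rewrite !gen_formEEF_half // => /eqP; rewrite eqn_pmul2r // => /eqP.
case/(half_turn_pair_unit n_gt1 tn t'n) => k kU kt.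
have [a aA [aE aF]] := qaut Q n_gt1 (j' - k * j)%R kU; exists a; split=> //.
by rewrite /formEEF imset3 !aE aF mulrDr kt half_turn_unit // [(k * j + _)%R]addrC subrK.
Qed.

(** The two elements outside <a> are inverse to each other, so 2-cycles tell them from E u unless u
    = [nu]. *)
Lemma formFFE_half_digon i u s : u != 0%R -> s \in formFFE Q nu i u ->
  (s^-1 \in formFFE Q nu i u) = (s != E u) || (u == nu).
Proof.
move=> u0; rewrite !inE -orbA => /or3P[] /eqP ->; rewrite ?qFV ?qEV !q_eqs ?orbF /=.
- by rewrite half_turnN eqxx orbT.
- by rewrite subrK eqxx.
rewrite eqxx Zp_neg_eq; apply/eqP/eqP => [/(two_torsion n_gt1)[/eqP|//] | ->].
  by rewrite (negPf u0).
by rewrite mulr2n half_turnD.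
Qed.

Lemma formFFE_half_aut i u i' u' : u != 0%R -> u' != 0%R ->
  graph_iso (cay (formFFE Q nu i u)) (cay (formFFE Q nu i' u')) ->
  aut_equiv (formFFE Q nu i u) (formFFE Q nu i' u').
Proof.
move=> u0 u'0 [h [h_bij h_iso]]; have h_inj := bij_inj h_bij.
have uS v l : E v \in formFFE Q nu l v by rewrite !inE eqxx !orbT.
suff [k kU ku] : exists2 k, k \is a GRing.unit & (k * u = u')%R.
  have [a aA [aE aF]] := qaut Q n_gt1 (i' - k * i)%R kU; exists a; split=> //.
  rewrite /formFFE imset3 !aF aE ku mulrBr half_turn_unit //.
  by congr [set F _; F _; _]; ring.
have hE g : exists2 t, t \in formFFE Q nu i' u' &
    h (E u * g) = t * h g /\ (u == nu) = (t != E u') || (u' == nu).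
  have [t tT ht] := cay_iso_mul h_iso g (uS u i); exists t => //; split=> //.
  by have := cay_iso_digon h_iso ht; rewrite !formFFE_half_digon // eqxx.
have [s sS hs] := cay_iso_onto h_bij h_iso 1 (uS u' i').
have ds : (s != E u) || (u == nu) = (u' == nu).
  by have := cay_iso_digon h_iso hs; rewrite !formFFE_half_digon // eqxx.
have [t tT [_ dt]] := hE 1.
have [unu | unu] := eqVneq u nu.
  by exists 1%R; rewrite ?unitr1 // mul1r unu; apply/esym/eqP; rewrite -ds unu eqxx orbT.
suff hu g : h (E u * g) = E u' * h g by exact: (translation_unit1 n_gt1 h_inj hu).
have [t1 _ [ht1 /esym]] := hE g; rewrite ht1 (negPf unu) => /norP[].
by rewrite negbK => /eqP ->.
Qed.

Lemma formEEF_half_neq_formFFE i u j u' : 1 \notin formEEF Q nu u j ->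
  ~ graph_iso (cay (formEEF Q nu u j)) (cay (formFFE Q nu i u')).
Proof.
move=> S1 [h [h_bij h_iso]].
have iT : F i \in formFFE Q nu i u' by rewrite !inE eqxx.
have [s sS hs] := cay_iso_onto h_bij h_iso 1 iT.
have := cay_iso_digon h_iso hs.
have -> : (F i)^-1 \in formFFE Q nu i u'.
  by rewrite !inE qFV !q_eqs half_turnN eqxx orbT.
have [u0 unu] : u != 0%R /\ u != nu.
  split; apply: contraNneq S1 => ->; rewrite !inE ?qE0 ?eqxx //.
  by rewrite half_turnD qE0 eqxx orbT.
have u2 := Zp_double_neq0 n_gt1 u0 unu; have u2n := double_neq_half n_gt1 n_odd u.
move: sS; rewrite !inE -orbA => /or3P[] /eqP ->; rewrite ?qEV ?qFV !q_eqs ?orbF.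
- have -> : (- u == u + nu)%R = false.
    by rewrite eq_sym -addr_eq0 addrAC -mulr2n addr_eq0 half_turnN (negPf u2n).
  by rewrite Zp_neg_eq (negPf u2).
- have -> : (- (u + nu) == u)%R = false.
    by rewrite eq_sym -addr_eq0 addrA -mulr2n addr_eq0 half_turnN (negPf u2n).
  by rewrite opprD half_turnN (inj_eq (addIr nu)) Zp_neg_eq (negPf u2).
by rewrite -{2}[j]addr0 (inj_eq (addrI j)) (negPf nu0).
Qed.

End CayleyOrder2.

(** * Cayley digraphs of the triples with x of order 6 *)

Section CayleyOrder6.

Import GRing.Theory.

Local Arguments walks : simpl never.

Variables (n : nat) (gT : finGroupType) (Q : quat_coords n gT).
Hypotheses (n_gt1 : 1 < n) (n_odd : odd n).

Local Notation E := (qE Q).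
Local Notation F := (qF Q).
Local Notation nu := (half_turn n).
Local Notation R := 'Z_(2 * n).
Implicit Types (i j k u : R) (c d g s t : gT) (S T : {set gT}).

Let N_gt1 : 1 < 2 * n. Proof. by rewrite mul2n -addnn ltn_addl. Qed.
Let nu0 : nu != 0%R := half_turn_neq0 n_gt1.

Definition gensEEF (al be : int) : seq formal_gen :=
  [:: (al, be, false); (al, (be + 1)%R, false); (0%R, 0%R, true)].

Definition gensFFE (al be : int) : seq formal_gen :=
  [:: (0%R, 0%R, true); (0%R, (-1)%R, true); (al, be, false)].

Lemma gensEEF_val v y j (al be : int) : map (gen_val Q v y j) (gensEEF al be) =
  let u := (v *~ al + y *~ be)%R in [:: E u; E (u + y)%R; F j].
Proof.
by rewrite /= /gen_val /= !mulr0z add0r qE0 !mulg1 mul1g mulrzDr mulr1z addrA.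
Qed.

Lemma gensFFE_val v y i (al be : int) : map (gen_val Q v y i) (gensFFE al be) =
  [:: F i; F (i - y)%R; E (v *~ al + y *~ be)%R].
Proof.
rewrite /= /gen_val /= !mulr0z !add0r qE0 !mulg1 mul1g qEF mulrNz mulr1z.
by rewrite [(- y + i)%R]addrC.
Qed.

Variable x : R.
Hypotheses (xnu : x != nu) (x3 : (x *+ 3 = nu)%R).

Let x6 : (x *+ 6 = 0)%R. Proof. by rewrite (mulrnA _ 3 2) x3 mulr2n half_turnD. Qed.
Let x0 : x != 0%R. Proof. by apply: contraNneq nu0 => x0; rewrite -x3 x0 mul0rn. Qed.

Lemma formEEF_gens v y j (al be : int) :
  formEEF Q y (v *~ al + y *~ be)%R j = [set:: map (gen_val Q v y j) (gensEEF al be)].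
Proof. by rewrite gensEEF_val -set3_seq. Qed.

Lemma formFFE_gens v y i (al be : int) :
  formFFE Q y i (v *~ al + y *~ be)%R = [set:: map (gen_val Q v y i) (gensFFE al be)].
Proof. by rewrite gensFFE_val -set3_seq. Qed.

Lemma gensEEF_uniq v j (al be : int) : uniq (map (gen_val Q v x j) (gensEEF al be)).
Proof.
rewrite gensEEF_val; set u := (_ + _)%R.
by rewrite /= !inE !q_eqs !orbF !andbT -{1}[u]addr0 (inj_eq (addrI u)) eq_sym x0.
Qed.

Lemma gensFFE_uniq v j (al be : int) : uniq (map (gen_val Q v x j) (gensFFE al be)).
Proof.
by rewrite gensFFE_val /= !inE !q_eqs !orbF !andbT -{1}[j]subr0 (inj_eq (addrI j)) eqr_opp eq_sym x0.
Qed.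

Definition order6_test (a : formal_elt) :=
  ((a.2 %% 4 == 0) && (6 %| `|a.1.2|)) || ((a.2 %% 4 == 2) && (6 %| `|a.1.2| + 3)).

Lemma order6_val a v j : (v *~ a.1.1 = 0)%R -> (formal_val Q v x j a == 1) = order6_test a.
Proof.
move=> va; rewrite formal_val_eq1 // va add0r Zp_mulrz_eq0 Zp_mulrz_eq_half /order6_test.
by rewrite -!(mulrn_order6 n_gt1 n_odd _ xnu x3) mulrnDr x3 addr_eq0 half_turnN.
Qed.

(** The coefficients of v that occur with an even exponent of F j are 0 and, if [free], 2 up to
    sign. In the latter case a word trivial in the group would give 12v = 0, hence 6v = 0, because
    6x = 0. *)
Lemma walks_order6 gens v j ds a (free : bool) g : uniq (map (gen_val Q v x j) gens) ->
    (free -> v *+ 6 != 0)%R ->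
    all (fun b : formal_elt => [|| b.1.1 == 0%R, odd b.2 | free && (`|b.1.1| == 2)%N])
      (formal_ends (cay_step gens) ds a) ->
  walks (cay [set:: map (gen_val Q v x j) gens]) ds (formal_val Q v x j a * g) g =
  count (fun b => (b.1.1 == 0%R) && order6_test b) (formal_ends (cay_step gens) ds a).
Proof.
move=> gU v6 /allP bound; rewrite cay_walks //; apply: eq_in_count => b /bound.
have [b0 _ | b0 /=] := eqVneq b.1.1 0%R; first by rewrite order6_val // b0 mulr0z.
have even0 q : odd q -> (q %% 4 == 0) = false /\ (q %% 4 == 2) = false.
  by move=> q1; split; apply/eqP=> e; have := @odd_mod q 4 erefl; rewrite e q1.
rewrite formal_val_eq1 // => /orP[/even0[-> ->] // | /andP[/v6 {}v6 /eqP b2]].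
apply: contraNF v6 => e.
have : ((v *~ b.1.1 + x *~ b.1.2) *+ 6 == 0)%R.
  by case/orP: e => /andP[_ /eqP ->]; rewrite ?mul0rn // half_turn_mulrn.
rewrite mulrnDl [(x *~ _ *+ 6)%R]pmulrn mulrzAC -pmulrn x6 mul0rz addr0.
rewrite pmulrn mulrzAC -pmulrn Zp_mulrz_eq0 b2 -mulrnA (mulrnA v 3 4) => /eqP.
by move/(four_torsion n_gt1 n_odd); rewrite -mulrnA => ->.
Qed.

(* Two arcs forward, then two arcs backward. On the sets [formEEF], [formFFE] with x of order 6,
   it singles out the element that is alone on its coset of <a>, unless [u *+ 6 = 0]. *)
Definition probe := [:: true; false; false].

Definition special S s := s \in S /\ forall g t, t \in S ->
  walks (cay S) probe (t * g) g = if t == s then 3 else 4.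

Definition flat S := forall g t, t \in S -> 3 < walks (cay S) probe (t * g) g.

Definition closed_counts S g :=
  (walks (cay S) (nseq 3 true) g g, walks (cay S) (nseq 2 true) g g).

Lemma walks_order6_gens gens v j (free : bool) g : uniq (map (gen_val Q v x j) gens) ->
    (free -> v *+ 6 != 0)%R ->
    all (fun b : formal_elt => [|| b.1.1 == 0%R, odd b.2 | free && (`|b.1.1| == 2)%N])
      (flatten [seq formal_ends (cay_step gens) probe (formal_mul p true formal1) | p <- gens]) ->
  [seq walks (cay [set:: map (gen_val Q v x j) gens]) probe (t * g) g |
     t <- map (gen_val Q v x j) gens] =
  [seq count (fun b => (b.1.1 == 0%R) && order6_test b)
     (formal_ends (cay_step gens) probe (formal_mul p true formal1)) | p <- gens].
Proof.
move=> gU v6 /allP bound; rewrite -[LHS]map_comp; apply/eq_in_map => p pG.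
transitivity (walks (cay [set:: map (gen_val Q v x j) gens]) probe
    (formal_val Q v x j (formal_mul p true formal1) * g) g).
  by rewrite formal_mul_val formal1_val mulg1.
apply: (walks_order6 (free := free)) => //; apply/allP => b b_end; apply: bound.
apply/flattenP; exists (formal_ends (cay_step gens) probe (formal_mul p true formal1)) => //.
exact: (map_f (fun p => formal_ends _ probe (formal_mul p true formal1))).
Qed.

Lemma special_formEEF u j : (u *+ 6 != 0)%R -> special (formEEF Q x u j) (F j).
Proof.
move=> u6; split=> [|g t]; first by rewrite !inE eqxx !orbT.
have uE : u = (u *~ 1 + x *~ 0)%R by rewrite mulr1z mulr0z addr0.
have := walks_order6_gens g (gensEEF_uniq u j 1 0) (free := true) (fun _ => u6).
move/(_ isT); rewrite -formEEF_gens gensEEF_val -uE => -[W0 W1 W2].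
rewrite !inE -orbA => /or3P[] /eqP ->; rewrite q_eqs ?eqxx.
- by rewrite W0.
- by rewrite W1.
by rewrite W2.
Qed.

Lemma special_formFFE i u : (u *+ 6 != 0)%R -> special (formFFE Q x i u) (E u).
Proof.
move=> u6; split=> [|g t]; first by rewrite !inE eqxx !orbT.
have uE : u = (u *~ 1 + x *~ 0)%R by rewrite mulr1z mulr0z addr0.
have := walks_order6_gens g (gensFFE_uniq u i 1 0) (free := true) (fun _ => u6).
move/(_ isT); rewrite -formFFE_gens gensFFE_val -uE => -[W0 W1 W2].
rewrite !inE -orbA => /or3P[] /eqP ->; rewrite q_eqs ?eqxx.
- by rewrite W0.
- by rewrite W1.
by rewrite W2.
Qed.

Lemma flat_gens gens i (closed3 closed2 : nat) :
    uniq (map (gen_val Q 0%R x i) gens) ->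
    all (fun p => 3 < count (fun b => (b.1.1 == 0%R) && order6_test b)
       (formal_ends (cay_step gens) probe (formal_mul p true formal1))) gens ->
    all (fun b : formal_elt => b.1.1 == 0%R)
      (flatten [seq formal_ends (cay_step gens) probe (formal_mul p true formal1) | p <- gens] ++
       formal_ends (cay_step gens) (nseq 3 true) formal1 ++
       formal_ends (cay_step gens) (nseq 2 true) formal1) ->
    count (fun b => (b.1.1 == 0%R) && order6_test b)
      (formal_ends (cay_step gens) (nseq 3 true) formal1) = closed3 ->
    count (fun b => (b.1.1 == 0%R) && order6_test b)
      (formal_ends (cay_step gens) (nseq 2 true) formal1) = closed2 ->
  flat [set:: map (gen_val Q 0%R x i) gens] /\
  forall g, closed_counts [set:: map (gen_val Q 0%R x i) gens] g = (closed3, closed2).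
Proof.
rewrite !all_cat => gU big /and3P[Z0 Z3 Z2] <- <-.
have bound (ends : seq formal_elt) : all (fun b => b.1.1 == 0%R) ends ->
    all (fun b : formal_elt => [|| b.1.1 == 0%R, odd b.2 | false && (`|b.1.1| == 2)%N]) ends.
  by apply: sub_all => b /= ->.
have closed ds g : all (fun b => b.1.1 == 0%R) (formal_ends (cay_step gens) ds formal1) ->
    walks (cay [set:: map (gen_val Q 0%R x i) gens]) ds g g =
    count (fun b => (b.1.1 == 0%R) && order6_test b) (formal_ends (cay_step gens) ds formal1).
  move=> /bound Z; have := walks_order6 g gU (free := false) (fun e => False_ind _ (notF e)) Z.
  by rewrite formal1_val mul1g.
split=> [g t | g]; last by rewrite /closed_counts !closed.
have := walks_order6_gens g gU (free := false) (fun e => False_ind _ (notF e)) (bound _ Z0).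
rewrite inE => W /(map_f (fun t => walks (cay [set:: map (gen_val Q 0%R x i) gens]) probe (t * g) g)).
by rewrite W => /mapP[p pG ->]; apply: (allP big).
Qed.

(** Entry m belongs to u = m x; the extreme entries 0 and 5 are those with 1 in the set. The others
    are symmetric under m -> 5 - m, the effect of the automorphism a -> a^-1 on {m, m + 1} modulo
    6. *)
Definition countsEEF (m : nat) :=
  (nth (0, 0) [:: (1, 1); (1, 0); (4, 1); (4, 1); (1, 0); (1, 1)] m)%N.

(** Here 1 lies in the set only for m = 0, and the symmetry is m -> 6 - m. The entries with m > 0
    are disjoint from the entries 1 to 4 of [countsEEF], which separates the two shapes. *)
Definition countsFFE (m : nat) :=
  (nth (0, 0) [:: (1, 1); (0, 0); (4, 0); (6, 1); (4, 0); (0, 0)] m)%N.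

Lemma flat_formEEF (m : nat) j : m < 6 ->
  flat (formEEF Q x (x *+ m)%R j) /\
  forall g, closed_counts (formEEF Q x (x *+ m)%R j) g = countsEEF m.
Proof.
move=> m6; have uE : (x *+ m = 0 *~ 0 + x *~ m%:Z)%R by rewrite mulr0z add0r.
rewrite {1 2}uE formEEF_gens; have := gensEEF_uniq 0%R j 0 m%:Z.
by case: m m6 {uE} => [|[|[|[|[|[|//]]]]]] _ U; apply: (flat_gens U); vm_compute.
Qed.

Lemma flat_formFFE (m : nat) i : m < 6 ->
  flat (formFFE Q x i (x *+ m)%R) /\
  forall g, closed_counts (formFFE Q x i (x *+ m)%R) g = countsFFE m.
Proof.
move=> m6; have uE : (x *+ m = 0 *~ 0 + x *~ m%:Z)%R by rewrite mulr0z add0r.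
rewrite {1 2}uE formFFE_gens; have := gensFFE_uniq 0%R i 0 m%:Z.
by case: m m6 {uE} => [|[|[|[|[|[|//]]]]]] _ U; apply: (flat_gens U); vm_compute.
Qed.

Lemma special_iso S T s t (h : gT -> gT) g : bijective h ->
    (forall g1 g2, cay T (h g1) (h g2) = cay S g1 g2) -> special S s -> special T t ->
  h (s * g) = t * h g.
Proof.
move=> h_bij h_iso [sS Ss] [tT Tt]; have [r rT hr] := cay_iso_mul h_iso g sS.
have := walks_iso probe (s * g) g h_bij h_iso; rewrite hr Tt // Ss // eqxx.
by case: eqP => // ->.
Qed.

Lemma special_neq_flat S T s : special S s -> flat T -> ~ graph_iso (cay S) (cay T).
Proof.
move=> [sS Ss] fT [h [h_bij h_iso]]; have [r rT hr] := cay_iso_mul h_iso 1 sS.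
have := walks_iso probe (s * 1) 1 h_bij h_iso; rewrite hr Ss // eqxx => e.
by have := fT (h 1) r rT; rewrite e.
Qed.

Lemma order6_multiple u : (u *+ 6 = 0)%R -> exists2 m : nat, m < 6 & u = (x *+ m)%R.
Proof.
move=> u6; have [m mx|m ->] := @ann_multiple (2 * n) N_gt1 x u.
  have /dvdnP[q ->] : 6 %| m by rewrite -(mulrn_order6 n_gt1 n_odd m xnu x3) mx.
  by rewrite [(q * 6)%N]mulnC mulrnA u6 mul0rn.
exists (m %% 6); first exact: ltn_pmod.
by rewrite {1}(divn_eq m 6) mulrnDr [(m %/ 6 * 6)%N]mulnC mulrnA x6 mul0rn add0r.
Qed.

Lemma probe_formEEF u j : special (formEEF Q x u j) (F j) \/
  exists2 m : nat, m < 6 & [/\ u = (x *+ m)%R, flat (formEEF Q x u j) &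
    forall g, closed_counts (formEEF Q x u j) g = countsEEF m].
Proof.
have [/order6_multiple[m m6 ->] | u6] := eqVneq (u *+ 6)%R 0%R; last first.
  by left; apply: special_formEEF.
by right; exists m => //; have [] := flat_formEEF j m6.
Qed.

Lemma probe_formFFE i u : special (formFFE Q x i u) (E u) \/
  exists2 m : nat, m < 6 & [/\ u = (x *+ m)%R, flat (formFFE Q x i u) &
    forall g, closed_counts (formFFE Q x i u) g = countsFFE m].
Proof.
have [/order6_multiple[m m6 ->] | u6] := eqVneq (u *+ 6)%R 0%R; last first.
  by left; apply: special_formFFE.
by right; exists m => //; have [] := flat_formFFE i m6.
Qed.

Lemma mulrn_compl (m p : nat) : m + p = 6 -> (x *+ p = - (x *+ m))%R.
Proof. by move=> e; apply/eqP; rewrite -addr_eq0 addrC -mulrnDr e x6. Qed.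

Lemma order6_range (m : nat) u j : m < 6 -> 1 \notin formEEF Q x u j -> u = (x *+ m)%R ->
  (0 < m /\ m < 5)%N.
Proof.
move=> m6 + um; rewrite um !inE !negb_or => /andP[/andP[m0 m5] _].
case: m m6 m0 m5 {um} => [|[|[|[|[|[|//]]]]]] _ //; first by rewrite mulr0n qE0 eqxx.
by rewrite -mulrSr x6 qE0 eqxx.
Qed.

Lemma formEEF_order6_aut u j u' j' :
    1 \notin formEEF Q x u j -> 1 \notin formEEF Q x u' j' ->
    graph_iso (cay (formEEF Q x u j)) (cay (formEEF Q x u' j')) ->
  aut_equiv (formEEF Q x u j) (formEEF Q x u' j').
Proof.
move=> S1 T1 iso; case: (probe_formEEF u j) => [Ss|[m m6 [um fS cS]]];
  case: (probe_formEEF u' j') => [Tt|[m' m'6 [um' fT cT]]].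
- case: iso => h [h_bij h_iso]; apply: (formEEF_labelled n_gt1 x0 xnu h_bij h_iso) => g.
  exact: special_iso h_bij h_iso Ss Tt.
- by case: (special_neq_flat Ss fT iso).
- by case: (special_neq_flat Tt fS (graph_iso_sym iso)).
have counts : countsEEF m' = countsEEF m.
  case: iso => h [h_bij h_iso]; rewrite -(cS 1) -(cT (h 1)) /closed_counts.
  by rewrite !(walks_iso _ _ _ h_bij h_iso).
have classes : (0 < m /\ m < 5)%N -> (0 < m' /\ m' < 5)%N -> m' = m \/ m + m'.+1 = 6.
  move: counts {um um' fS fT cS cT}; case: m m6 => [|[|[|[|[|[|//]]]]]] _ + [];
    by case: m' m'6 => [|[|[|[|[|[|//]]]]]] _ // _ _ _ [] // _ _; (left + right).
have [||mm|mm] := classes; [exact: order6_range S1 um | exact: order6_range T1 um' | |].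
  have [a aA [aE aF]] := qaut Q n_gt1 (j' - j)%R (unitr1 R); exists a; split=> //.
  by rewrite /formEEF imset3 !aE aF !mul1r um um' mm [(j + _)%R]addrC subrK.
have [a aA [aE aF]] := qaut Q n_gt1 (j' + j)%R (unitrN1 R); exists a; split=> //.
rewrite /formEEF imset3 !aE aF !mulN1r [(- j + _)%R]addrC addrK um um' -!mulrSr.
rewrite -(mulrn_compl mm) -(mulrn_compl (p := m')) ?addSnnS //.
by rewrite (setUC [set E _]).
Qed.

Lemma formFFE_order6_aut i u i' u' :
    1 \notin formFFE Q x i u -> 1 \notin formFFE Q x i' u' ->
    graph_iso (cay (formFFE Q x i u)) (cay (formFFE Q x i' u')) ->
  aut_equiv (formFFE Q x i u) (formFFE Q x i' u').
Proof.
move=> S1 T1 iso; case: (probe_formFFE i u) => [Ss|[m m6 [um fS cS]]];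
  case: (probe_formFFE i' u') => [Tt|[m' m'6 [um' fT cT]]].
- case: iso => h [h_bij h_iso]; apply: (formFFE_labelled n_gt1 x0 xnu h_bij h_iso) => g.
  exact: special_iso h_bij h_iso Ss Tt.
- by case: (special_neq_flat Ss fT iso).
- by case: (special_neq_flat Tt fS (graph_iso_sym iso)).
have counts : countsFFE m' = countsFFE m.
  case: iso => h [h_bij h_iso]; rewrite -(cS 1) -(cT (h 1)) /closed_counts.
  by rewrite !(walks_iso _ _ _ h_bij h_iso).
have range l v p : 1 \notin formFFE Q x l v -> v = (x *+ p)%R -> (0 < p)%N.
  by move=> + vp; rewrite lt0n vp !inE !negb_or => /andP[_]; apply: contraNneq => ->; rewrite qE0.
have classes : (0 < m')%N -> (0 < m)%N -> m' = m \/ m + m' = 6.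
  move: counts {range um um' fS fT cS cT}; case: m m6 => [|[|[|[|[|[|//]]]]]] _;
    by case: m' m'6 => [|[|[|[|[|[|//]]]]]] _ //; (left + right).
have [||mm|mm] := classes; [exact: (range _ _ _ T1 um') | exact: (range _ _ _ S1 um) | |].
  have [a aA [aE aF]] := qaut Q n_gt1 (i' - i)%R (unitr1 R); exists a; split=> //.
  rewrite /formFFE imset3 !aF aE !mul1r um um' mm.
  by congr [set F _; F _; _]; ring.
have [a aA [aE aF]] := qaut Q n_gt1 (i' + i - x)%R (unitrN1 R); exists a; split=> //.
rewrite /formFFE imset3 !aF aE !mulN1r um um' -(mulrn_compl mm) (setUC [set F _]).
by congr [set F _; F _; _]; ring.
Qed.

Lemma formEEF_order6_neq_formFFE i u j u' :
    1 \notin formEEF Q x u j -> 1 \notin formFFE Q x i u' ->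
  ~ graph_iso (cay (formEEF Q x u j)) (cay (formFFE Q x i u')).
Proof.
move=> S1 T1 iso; case: (probe_formEEF u j) => [Ss|[m m6 [um fS cS]]];
  case: (probe_formFFE i u') => [Tt|[m' m'6 [um' fT cT]]].
- case: iso => h [h_bij h_iso]; apply: (form_labelled_neq n_gt1 n_odd (bij_inj h_bij)) => g.
  exact: special_iso h_bij h_iso Ss Tt.
- by case: (special_neq_flat Ss fT iso).
- by case: (special_neq_flat Tt fS (graph_iso_sym iso)).
have : countsFFE m' = countsEEF m.
  case: iso => h [h_bij h_iso]; rewrite -(cS 1) -(cT (h 1)) /closed_counts.
  by rewrite !(walks_iso _ _ _ h_bij h_iso).
have [m0 m0'] := order6_range m6 S1 um.
have m'0 : (0 < m')%N.
  rewrite lt0n; apply: contraNneq T1 => z; rewrite um' z !inE mulr0n qE0 eqxx !orbT //.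
by case: m m6 m0 m0' {um fS cS} => [|[|[|[|[|[|//]]]]]] _ // _ _;
  case: m' m'6 m'0 {um' fT cT} => [|[|[|[|[|[|//]]]]]] _.
Qed.

End CayleyOrder6.

(** * Cayley digraphs of valency at most 3, for n odd *)

Section OddDCIGroup.

Import GRing.Theory.

Variables (n : nat) (gT : finGroupType) (Q : quat_coords n gT).
Hypotheses (n_gt1 : 1 < n) (n_odd : odd n).

Local Notation E := (qE Q).
Local Notation F := (qF Q).
Local Notation nu := (half_turn n).
Local Notation R := 'Z_(2 * n).
Implicit Types (i j k u x : R) (A : {set R}) (c d g s t : gT) (S T : {set gT}).

Lemma formEEF_aut x u j u' j' : x != 0%R ->
    1 \notin formEEF Q x u j -> 1 \notin formEEF Q x u' j' ->
    graph_iso (cay (formEEF Q x u j)) (cay (formEEF Q x u' j')) ->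
  aut_equiv (formEEF Q x u j) (formEEF Q x u' j').
Proof.
move=> x0 S1 T1; have [-> | xnu] := eqVneq x nu; first exact: formEEF_half_aut.
have [x3 | x3] := eqVneq (x *+ 3)%R nu; first exact: formEEF_order6_aut.
case=> h [h_bij h_iso]; apply: (formEEF_labelled n_gt1 x0 xnu h_bij h_iso) => g.
have := h_iso; rewrite !formEEF_coset => /(special_label n_gt1 n_odd x0 xnu x3 h_bij)/(_ g).
by rewrite !qEF ![(_ + (_ - _))%R]addrC !subrK.
Qed.

Lemma formFFE_aut x i u i' u' : x != 0%R ->
    1 \notin formFFE Q x i u -> 1 \notin formFFE Q x i' u' ->
    graph_iso (cay (formFFE Q x i u)) (cay (formFFE Q x i' u')) ->
  aut_equiv (formFFE Q x i u) (formFFE Q x i' u').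
Proof.
have neq0 (y v l : R) : 1 \notin formFFE Q y l v -> v != 0%R.
  by apply: contraNneq => ->; rewrite !inE qE0 eqxx !orbT.
move=> x0 S1 T1; have [xn | xnu] := eqVneq x nu.
  by rewrite xn; apply: formFFE_half_aut; rewrite // (neq0 _ _ _ S1, neq0 _ _ _ T1).
have [x3 | x3] := eqVneq (x *+ 3)%R nu; first exact: formFFE_order6_aut.
case=> h [h_bij h_iso]; apply: (formFFE_labelled n_gt1 x0 xnu h_bij h_iso) => g.
have e (l v : R) : F l * F (l + nu - v)%R = E v.
  rewrite qFF (_ : l - (l + nu - v) + nu = v + (nu - nu))%R ?subrr ?addr0 //; ring.
have := h_iso; rewrite !formFFE_coset => /(special_label n_gt1 n_odd x0 xnu x3 h_bij)/(_ g).
by rewrite !e.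
Qed.

Lemma formEEF_neq_formFFE x i u j u' : x != 0%R ->
    1 \notin formEEF Q x u j -> 1 \notin formFFE Q x i u' ->
  ~ graph_iso (cay (formEEF Q x u j)) (cay (formFFE Q x i u')).
Proof.
move=> x0 S1 T1; have [xn | xnu] := eqVneq x nu.
  by rewrite xn in S1 *; apply: formEEF_half_neq_formFFE.
have [x3 | x3] := eqVneq (x *+ 3)%R nu; first exact: formEEF_order6_neq_formFFE.
case=> h [h_bij h_iso].
apply: (form_labelled_neq (Q := Q) (j := j) (u := u') n_gt1 n_odd (bij_inj h_bij)) => g.
have e : F i * F (i + nu - u')%R = E u'.
  rewrite qFF (_ : i - (i + nu - u') + nu = u' + (nu - nu))%R ?subrr ?addr0 //; ring.
have := h_iso; rewrite formEEF_coset formFFE_coset.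
move=> /(special_label n_gt1 n_odd x0 xnu x3 h_bij)/(_ g).
by rewrite e qEF [(u + _)%R]addrC subrK.
Qed.

Lemma cay_typeII_aut c d x j : x != 0%R ->
    1 \notin [set c; c * E x; c * F j] -> 1 \notin [set d; d * E x; d * F j] ->
    graph_iso (cay [set c; c * E x; c * F j]) (cay [set d; d * E x; d * F j]) ->
  aut_equiv [set c; c * E x; c * F j] [set d; d * E x; d * F j].
Proof.
move=> x0; case: (coset_forms Q c x j) => -[u [l ->]];
  case: (coset_forms Q d x j) => -[u' [l' ->]].
- exact: formEEF_aut.
- by move=> S1 T1 /(formEEF_neq_formFFE x0 S1 T1).
- by move=> S1 T1 /graph_iso_sym/(formEEF_neq_formFFE x0 T1 S1).
exact: formFFE_aut.
Qed.

(** A translate by an element outside <a> would generate a subgroup of order divisible by 4, unlike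
    a subset of <a>. *)
Lemma cay_qE_coset_aut A g : 1 < #|A| <= 3 ->
    graph_iso (cay (E @: A)) (cay [set g * s | s in E @: A]) ->
  aut_equiv (E @: A) [set g * s | s in E @: A].
Proof.
move=> A_card; case: (q_cover Q g) => -[w ->].
  have -> : [set E w * s | s in E @: A] = E @: [set (i + w)%R | i in A].
    by rewrite -!imset_comp; apply: eq_imset => i /=; rewrite qEE addrC.
  case/(cay_typeI_unit n_gt1 n_odd A_card) => k kU ->.
  have [a aA [aE _]] := qaut Q n_gt1 0%R kU; exists a; split=> //.
  by rewrite -!imset_comp; apply: eq_imset => i /=.
move/cay_iso_gen => o; have /card_gt0P[i iA] : 0 < #|A| by lia.
have := @gen_qF_dvd _ _ Q n_gt1 [set F w * s | s in E @: A] (w - i)%R.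
rewrite -o => /(_ _)/dvdn_trans/(_ (gen_qE_dvd Q n_gt1 A)) d.
case/negP: (four_ndvd n_odd); apply: d; apply/imsetP; exists (E i); first exact: imset_f.
by rewrite qFE.
Qed.

Lemma cay_qF_coset_aut A g : A != set0 ->
    graph_iso (cay (F @: A)) (cay [set g * s | s in F @: A]) ->
  aut_equiv (F @: A) [set g * s | s in F @: A].
Proof.
move=> /set0Pn[i iA]; case: (q_cover Q g) => -[w ->].
  move=> _; have [a aA [_ aF]] := qaut Q n_gt1 w (unitr1 R); exists a; split=> //.
  by rewrite -!imset_comp; apply: eq_imset => l /=; rewrite aF mul1r qEF addrC.
move/cay_iso_gen => o.
have := @gen_qF_dvd _ _ Q n_gt1 (F @: A) i (imset_f _ iA); rewrite o.
have -> : [set F w * s | s in F @: A] = E @: [set (w - l + nu)%R | l in A].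
  by rewrite -!imset_comp; apply: eq_imset => l /=; rewrite qFF.
by move/dvdn_trans/(_ (gen_qE_dvd Q n_gt1 _)) => d; case/negP: (four_ndvd n_odd).
Qed.

Lemma cay_coset_aut S g : #|S| <= 3 -> 1 \notin S -> 1 \notin [set g * s | s in S] ->
    graph_iso (cay S) (cay [set g * s | s in S]) ->
  aut_equiv S [set g * s | s in S].
Proof.
move=> S3 S1 T1 iso; case S_card: #|S| S3 => [|[|[|[|//]]]] _.
- move/eqP: S_card; rewrite cards_eq0 => /eqP ->; rewrite imset0.
  by exists 1; rewrite group1 imset0.
- move/eqP/cards1P: S_card iso => [s ->]; rewrite imset_set1 => /cay_iso_gen o.
  have [a aA as1] := aut_of_order Q n_gt1 n_odd o.
  by exists a; split=> //; rewrite imset_set1 as1.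
- have mixed u j : 1 \notin [set E u; F j] -> 1 \notin [set g * s | s in [set E u; F j]] ->
      graph_iso (cay [set E u; F j]) (cay [set g * s | s in [set E u; F j]]) ->
    aut_equiv [set E u; F j] [set g * s | s in [set E u; F j]].
    have neq0 (v l : R) : 1 \notin [set E v; F l] -> v != 0%R.
      by apply: contraNneq => ->; rewrite !inE qE0 eqxx.
    rewrite imsetU !imset_set1; case: (q_cover Q g) => -[w ->]; rewrite !qM.
      by move=> /neq0 u0 /neq0 u'0; apply: cay_mixed_pair.
    by rewrite (setUC [set F _]) => /neq0 u0 /neq0 u'0; apply: cay_mixed_pair.
  move/eqP/cards2P: S_card S1 T1 iso => [s [t [+ ->]]].
  have pairE (f : R -> gT) i j : [set f i; f j] = f @: [set i; j].
    by rewrite imsetU !imset_set1.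
  case: (q_cover Q s) (q_cover Q t) => -[i ->] [] [j ->] st S1 T1.
  + rewrite pairE; apply: cay_qE_coset_aut.
    by rewrite cards2 -(qE_eq Q) st.
  + exact: mixed.
  + by rewrite (setUC [set F i]) in S1 T1 *; apply: mixed.
  rewrite pairE; apply: cay_qF_coset_aut.
  by apply/set0Pn; exists i; rewrite !inE eqxx.
case: (three_forms Q S_card) iso S1 T1 => [[A A3 ->]|[A A3 ->]|[c [x [j [x0 ->]]]]].
- by move=> iso _ _; apply: cay_qE_coset_aut; rewrite ?A3.
- by move=> iso _ _; apply: cay_qF_coset_aut; rewrite // -card_gt0 A3.
by rewrite imset3 !mulgA => iso S1 T1; apply: cay_typeII_aut.
Qed.

(** The bi-Cayley result gives T = g alpha(S). As alpha is itself an isomorphism of Cayley digraphs,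
    it remains to compare alpha(S) with its own translate by g. *)
Lemma cay_iso_aut S T : #|S| <= 3 -> 1 \notin S -> 1 \notin T ->
  graph_iso (cay S) (cay T) -> aut_equiv S T.
Proof.
move=> S3 S1 T1 iso.
have [g [alpha [aA TE]]] := bcay_iso_bequiv Q n_gt1 n_odd S3 (cay_bcay_iso iso).
rewrite lcosetE' in TE; rewrite TE in T1 iso *.
have iso_alpha : graph_iso (cay S) (cay (alpha @: S)).
  exists alpha; split=> [|x y]; first by exists (alpha^-1)%g => z; rewrite ?permK ?permKV.
  apply/cayP/cayP=> [[_ /imsetP[s sS ->]] | [s sS ->]].
    by rewrite -(aut_mul aA) => /perm_inj ->; exists s.
  by exists (alpha s); rewrite ?imset_f ?(aut_mul aA).
have [||||b [bA <-]] := @cay_coset_aut (alpha @: S) g.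
- by rewrite card_imset //; apply: perm_inj.
- by rewrite -(aut_one aA) mem_imset //; apply: perm_inj.
- by [].
- exact: graph_iso_trans (graph_iso_sym iso_alpha) iso.
exists (alpha * b)%g; split; first exact: groupM.
by rewrite -imset_comp; apply: eq_imset => z /=; rewrite permM.
Qed.

End OddDCIGroup.

(** * The quaternion group of order 8 *)

Section OrderEight.

Import GRing.Theory.

Local Arguments walks : simpl never.
Local Arguments has : simpl never.

(* [(f, h, o)] stands for a^(2h + o) if f is false, and for a^(2h + o) b otherwise. *)
Definition code := (bool * bool * bool)%type.
Implicit Types (a c d x y : code) (C D : seq code).

(** Two-bit arithmetic modulo 4: the conditional is the carry of a sum, or the borrow of a
    difference when the first factor lies outside <a>; [f1 && f2] adds b^2 = a^2. *)
Definition code_mul c d : code :=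
  let: (f1, h1, o1) := c in let: (f2, h2, o2) := d in
  (f1 (+) f2, h1 (+) h2 (+) (if f1 then ~~ o1 && o2 else o1 && o2) (+) (f1 && f2), o1 (+) o2).

Definition code1 : code := (false, false, false).

Definition codes : seq code :=
  [:: (false, false, false); (false, false, true); (false, true, false); (false, true, true);
      (true, false, false); (true, false, true); (true, true, false); (true, true, true)].

(** The cube is the inverse, because all orders divide 4. *)
Definition code_inv c := code_mul c (code_mul c c).

Definition code_aut x y c : code :=
  let: (f, h, o) := c in
  code_mul (if h then code_mul x x else code1)
    (code_mul (if o then x else code1) (if f then y else code1)).

(** For n = 2 there are automorphisms mixing <a> with its complement, beyond those of [qaut]; all
    pairs of images of a and b are tried. *)
Definition code_auts : seq (code * code) :=
  [seq p <- [seq (x, y) | x <- codes, y <- codes] |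
     uniq (map (code_aut p.1 p.2) codes) &&
     all (fun c => all (fun d => code_aut p.1 p.2 (code_mul c d) ==
        code_mul (code_aut p.1 p.2 c) (code_aut p.1 p.2 d)) codes) codes].

Fixpoint subseqs (T : Type) (s : seq T) : seq (seq T) :=
  if s is z :: s' then let ss := subseqs s' in ss ++ map (cons z) ss else [:: [::]].

Lemma filter_subseqs (T : eqType) (P : pred T) (s : seq T) : filter P s \in subseqs s.
Proof.
elim: s => //= z s IHs; case: (P z); rewrite mem_cat ?IHs //.
by rewrite (map_f (cons z)) ?orbT.
Qed.

Definition small_codes := [seq C <- subseqs codes | size C <= 3].

Definition cay_code_step C (d : bool) a :=
  [seq code_mul (if d then s else code_inv s) a | s <- C].

Definition bcay_code_step C (d : bool) (p : code * bool) :=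
  [seq (code_mul (if p.2 then code_inv s else s) p.1, ~~ p.2) | s <- C].

Definition cay_code_walks C :=
  count (pred1 code1) (formal_ends (cay_code_step C) (nseq 2 true) code1).

Definition bcay_code_walks C (i : bool) :=
  count (pred1 (code1, i)) (formal_ends (bcay_code_step C) (nseq 4 true) (code1, i)).

Definition same_set C D := all [in D] C && all [in C] D.

(** The conditional, unlike a boolean implication, keeps call-by-value evaluation from searching for
    an automorphism when the counts already differ. *)
Lemma cay_code_check :
  let tab := [seq (C, (size C, cay_code_walks C)) | C <- small_codes & code1 \notin C] in
  all (fun p => all (fun q => if p.2 != q.2 then true else
    has (fun xy => same_set (map (code_aut xy.1 xy.2) p.1) q.1) code_auts) tab) tab.
Proof. by vm_compute. Qed.

(** An isomorphism may exchange the two halves, so the count must be the same from both. *)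
Lemma bcay_code_walks_side C i : C \in small_codes ->
  bcay_code_walks C i = bcay_code_walks C false.
Proof.
have : all (fun C => bcay_code_walks C true == bcay_code_walks C false) small_codes.
  by vm_compute.
by move=> /allP check /check/eqP e; case: i.
Qed.

Lemma bcay_code_check :
  let tab := [seq (C, (size C, bcay_code_walks C false)) | C <- small_codes] in
  all (fun p => all (fun q => if p.2 != q.2 then true else
    has (fun g => has (fun xy =>
      same_set (map (fun c => code_mul g (code_aut xy.1 xy.2 c)) p.1) q.1) code_auts) codes) tab) tab.
Proof. by vm_compute. Qed.

Variables (gT : finGroupType) (Q : quat_coords 2 gT).

Local Notation E := (qE Q).
Local Notation F := (qF Q).

Definition code_val c : gT :=
  let: (f, h, o) := c in (if f then F else E) (h.*2 + o)%:R%R.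

Lemma code_val_inj : injective code_val.
Proof.
have ninj (h1 o1 h2 o2 : bool) : ((h1.*2 + o1)%:R = (h2.*2 + o2)%:R :> 'Z_4)%R ->
    (h1, o1) = (h2, o2).
  by move/(congr1 val); case: h1; case: o1; case: h2; case: o2.
case=> [[f1 h1] o1] [[f2 h2] o2]; case: f1; case: f2 => /=.
- by move/qF_inj/ninj => [-> ->].
- by move/eqP; rewrite qFE_eq.
- by move/eqP; rewrite qEF_eq.
by move/qE_inj/ninj => [-> ->].
Qed.

Lemma code_valM c d : code_val (code_mul c d) = code_val c * code_val d.
Proof.
by case: c d => [[[] []] []] [[[] []] []]; rewrite /code_val /= qM; congr (_ _); apply: val_inj.
Qed.

Lemma code_val1 : code_val code1 = 1.
Proof. by rewrite /code_val /= qE0. Qed.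

Lemma code_valV c : code_val (code_inv c) = (code_val c)^-1.
Proof.
apply: (mulgI (code_val c)); rewrite mulgV -!code_valM -code_val1.
by case: c => [[[] []] []].
Qed.

Lemma code_onto (g : gT) : exists2 c, c \in codes & g = code_val c.
Proof.
have lift (i : 'Z_4) : exists h o : bool, i = (h.*2 + o)%:R%R.
  exists (2 <= i)%N, (odd i); rewrite -[LHS]natr_Zp; congr (_%:R)%R.
  by case: i => [[|[|[|[|//]]]] ?].
case: (q_cover Q g) => -[i ->]; have [h [o ->]] := lift i.
  by exists (false, h, o) => //; case: h; case: o.
by exists (true, h, o) => //; case: h; case: o.
Qed.

Definition codes_of (S : {set gT}) := [seq c <- codes | code_val c \in S].

Lemma codes_ofK (S : {set gT}) : [set:: map code_val (codes_of S)] = S.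
Proof.
apply/setP=> g; rewrite inE; apply/mapP/idP => [[c + ->] | gS].
  by rewrite mem_filter => /andP[].
have [c c_in gc] := code_onto g; exists c => //.
by rewrite mem_filter -gc gS.
Qed.

Lemma codes_of_uniq (S : {set gT}) : uniq (map code_val (codes_of S)).
Proof. by rewrite map_inj_uniq ?filter_uniq //; apply: code_val_inj. Qed.

Lemma codes_of_small (S : {set gT}) : #|S| <= 3 -> codes_of S \in small_codes.
Proof.
rewrite -{1}(codes_ofK S) cardsE (card_uniqP (codes_of_uniq S)) size_map => S3.
by rewrite mem_filter S3 filter_subseqs.
Qed.

Lemma size_codes_of (S : {set gT}) : size (codes_of S) = #|S|.
Proof. by rewrite -{2}(codes_ofK S) cardsE (card_uniqP (codes_of_uniq S)) size_map. Qed.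

Lemma cay_code_walksE (S : {set gT}) g :
  walks (cay S) (nseq 2 true) g g = cay_code_walks (codes_of S).
Proof.
pose phi c := code_val c * g.
have phi_inj : injective phi by move=> c d /mulIg/code_val_inj.
have phi1 : phi code1 = g by rewrite /phi code_val1 mul1g.
rewrite -phi1 -{1}(codes_ofK S) (@walks_formal _ _ _ (cay_code_step (codes_of S)) phi).
- by apply: eq_count => c /=; rewrite (inj_eq phi_inj).
- move=> d a; rewrite map_inj_uniq // map_inj_uniq ?filter_uniq //.
  move=> c c' /(congr1 code_val); rewrite !code_valM => /mulIg.
  by case: d; rewrite ?code_valV => e; apply: code_val_inj => //; apply: invg_inj.
move=> d a y; rewrite -map_comp.
have E1 s : phi (code_mul (if d then s else code_inv s) a) =
    (if d then code_val s else (code_val s)^-1) * phi a.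
  by rewrite /phi code_valM mulgA; case: d; rewrite ?code_valV.
apply/mapP/idP => [[s sC ->] /= | ].
  rewrite E1; have := map_f code_val sC; move: (phi a) (code_val s) => w z zS.
  by case: d {E1}; rewrite cayE ?mulgK ?invMg ?invgK ?mulKVg inE.
move=> e; suff [s sC se] : exists2 s, s \in codes_of S &
    y = (if d then code_val s else (code_val s)^-1) * phi a.
  by exists s; rewrite //= E1.
case: d e {E1}; rewrite cayE inE => /mapP[s sC /(canRL (mulgKV _)) e]; exists s => //.
by rewrite e mulKg.
Qed.

Lemma bcay_code_walksE (S : {set gT}) (u : gT * bool) :
  walks (bcay S) (nseq 4 true) u u = bcay_code_walks (codes_of S) u.2.
Proof.
case: u => g i /=; pose phi (p : code * bool) := (code_val p.1 * g, p.2).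
have phi_inj : injective phi by move=> [c i1] [d i2] [/mulIg/code_val_inj -> ->].
have phi1 : phi (code1, i) = (g, i) by rewrite /phi code_val1 mul1g.
rewrite -phi1 -{1}(codes_ofK S) (@walks_formal _ _ _ (bcay_code_step (codes_of S)) phi).
- by apply: eq_count => c /=; rewrite (inj_eq phi_inj).
- move=> d a; rewrite map_inj_uniq // map_inj_uniq ?filter_uniq //.
  move=> c c' [] /(congr1 code_val); rewrite !code_valM => /mulIg.
  by case: a.2; rewrite ?code_valV => e; apply: code_val_inj => //; apply: invg_inj.
move=> d p y; rewrite -map_comp.
have -> : (if d then bcay [set:: map code_val (codes_of S)] (phi p) y
    else bcay [set:: map code_val (codes_of S)] y (phi p)) =
    bcay [set:: map code_val (codes_of S)] (phi p) y by case: d; rewrite // bcay_sym.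
have E1 s : phi (code_mul (if p.2 then code_inv s else s) p.1, ~~ p.2) = nb (code_val s) (phi p).
  by rewrite /phi /nb /= code_valM !mulgA; case: p.2; rewrite ?code_valV.
apply/mapP/bcayP=> [[s sC ->] | [t]].
  by exists (code_val s); [rewrite inE map_f | apply: E1].
by rewrite inE => /mapP[s sC ->] ->; exists s => //; apply/esym/E1.
Qed.

Lemma code_aut_perm xy : xy \in code_auts -> exists2 alpha : {perm gT},
  alpha \in Aut [set: gT] & forall c, alpha (code_val c) = code_val (code_aut xy.1 xy.2 c).
Proof.
rewrite mem_filter => /andP[/andP[f_uniq /allP fM] _]; set f := code_aut _ _ in f_uniq fM *.
have all_codes c : c \in codes by case: c => [[[] []] []].
pose dec g := odflt code1 [pick c | code_val c == g].
have decK c : dec (code_val c) = c.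
  rewrite /dec; case: pickP => [d /eqP/code_val_inj // | /(_ c)].
  by rewrite eqxx.
have f_inj : injective f.
  move=> c d e; have := @nth_uniq _ (f code1) (map f codes) (index c codes) (index d codes).
  rewrite !size_map !index_mem !all_codes => /(_ isT isT f_uniq).
  rewrite !(nth_map code1) ?index_mem // !nth_index // e eqxx => /esym/eqP ie.
  by rewrite -(nth_index code1 (all_codes c)) ie nth_index.
have alpha_inj : injective (fun g => code_val (f (dec g))).
  move=> g1 g2; have [c _ ->] := code_onto g1; have [d _ ->] := code_onto g2.
  by rewrite !decK => /code_val_inj/f_inj ->.
exists (perm alpha_inj); last by move=> c; rewrite permE decK.
apply: perm_Aut => g1 g2; have [c _ ->] := code_onto g1; have [d _ ->] := code_onto g2.
by rewrite -code_valM !decK -code_valM (eqP (allP (fM c (all_codes c)) d (all_codes d))).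
Qed.

Lemma same_set_image C (T : {set gT}) : same_set C (codes_of T) ->
  [set:: map code_val C] = T.
Proof.
case/andP=> /allP CT /allP TC; rewrite -[RHS]codes_ofK.
apply/setP=> g; rewrite !inE; apply/mapP/mapP=> -[c c_in ->]; exists c => //; [exact: CT | exact: TC].
Qed.

Lemma set_map_imset (T U : finType) (f : T -> U) (s : seq T) : [set:: map f s] = f @: [set:: s].
Proof.
apply/setP=> z; rewrite inE; apply/mapP/imsetP=> -[w ws ->]; exists w => //; by rewrite inE in ws *.
Qed.

Lemma order8_cay_iso_aut (S T : {set gT}) : #|S| <= 3 -> 1 \notin S -> 1 \notin T ->
  graph_iso (cay S) (cay T) -> aut_equiv S T.
Proof.
move=> S3 S1 T1 iso; have ST := cay_iso_card iso.
have memTab (U : {set gT}) : #|U| <= 3 -> 1 \notin U ->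
  (codes_of U, (size (codes_of U), cay_code_walks (codes_of U))) \in
  [seq (C, (size C, cay_code_walks C)) | C <- small_codes & code1 \notin C].
  move=> U3 U1; apply/mapP; exists (codes_of U) => //.
  by rewrite mem_filter codes_of_small // andbT mem_filter code_val1 (negPf U1).
have T3 : #|T| <= 3 by rewrite -ST.
have /allP/(_ _ (memTab S S3 S1))/allP/(_ _ (memTab T T3 T1)) := cay_code_check.
rewrite /= !size_codes_of ST.
have -> : cay_code_walks (codes_of S) = cay_code_walks (codes_of T).
  case: iso => h [h_bij h_iso].
  by rewrite -(cay_code_walksE S 1) -(cay_code_walksE T (h 1)) (walks_iso _ _ _ h_bij h_iso).
rewrite eqxx /= => /hasP[xy /code_aut_perm[alpha aA aE] /same_set_image <-].
exists alpha; split=> //; rewrite -{1}(codes_ofK S) -set_map_imset -!map_comp.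
by apply: (congr1 (fun r : seq gT => [set:: r])); apply: eq_map => c /=; rewrite aE.
Qed.

Lemma order8_bcay_iso_bequiv (S T : {set gT}) : #|S| <= 3 ->
  graph_iso (bcay S) (bcay T) -> bequiv S T.
Proof.
move=> S3 iso; have ST := bcay_iso_card iso.
have memTab (U : {set gT}) : #|U| <= 3 ->
  (codes_of U, (size (codes_of U), bcay_code_walks (codes_of U) false)) \in
  [seq (C, (size C, bcay_code_walks C false)) | C <- small_codes].
  by move=> U3; apply/mapP; exists (codes_of U); rewrite ?codes_of_small.
have T3 : #|T| <= 3 by rewrite -ST.
have /allP/(_ _ (memTab S S3))/allP/(_ _ (memTab T T3)) := bcay_code_check.
rewrite /= !size_codes_of ST.
have -> : bcay_code_walks (codes_of S) false = bcay_code_walks (codes_of T) false.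
  case: iso => h [h_bij h_iso].
  have := walks_iso (nseq 4 true) (1, false) (1, false) h_bij h_iso.
  by rewrite !bcay_code_walksE bcay_code_walks_side ?codes_of_small // => ->.
rewrite eqxx /= => /hasP[g _ /hasP[xy /code_aut_perm[alpha aA aE] /same_set_image <-]].
exists (code_val g), alpha; split=> //.
rewrite lcosetE' -{2}(codes_ofK S) -!set_map_imset -!map_comp.
by apply: (congr1 (fun r : seq gT => [set:: r])); apply: eq_map => c /=; rewrite code_valM aE.
Qed.

End OrderEight.

Theorem corollary1p2 (n : nat) (hn : 2 <= n)
    (gT : finGroupType) (hQ : is_quaternion n gT)
    (m : nat) (hm : m = 2 \/ m = 3) :
  [<-> BCI_group m gT;
       DCI_group m gT;
       CI_group m gT;
       odd n \/ n = 2].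
Proof.
have [Q] := quaternion_coords hn hQ.
have m2 : 2 <= m by case: hm => ->.
have m3 : m <= 3 by case: hm => ->.
have even_gt2 : ~ (odd n \/ n = 2) -> 2 < n /\ ~~ odd n.
  move=> no; split; last by apply/negP=> n_odd; apply: no; left.
  by rewrite ltn_neqAle hn andbT; apply/eqP=> n2; apply: no; right.
(* The arithmetic condition is decidable, so it may be derived from the failure of the even case. *)
have odd_or2 : ~ ~ (odd n \/ n = 2) -> odd n \/ n = 2.
  move=> nn; case: (boolP (odd n || (n == 2))) => [/orP[|/eqP] | no]; [by left | by right |].
  by case: nn => -[o | n2]; case/norP: no => /negP no1 /eqP.
tfae.
(* The bi-Cayley hypothesis serves only to reach the arithmetic condition, from which the digraph
   property follows. *)
- move=> bci; suff: odd n \/ n = 2.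
    move=> n_cond S S1 Sm T T1 iso; have S3 := leq_trans Sm m3.
    case: n_cond => [n_odd | n2]; first exact: (cay_iso_aut Q hn n_odd S3 S1 T1 iso).
    by subst n; apply: order8_cay_iso_aut iso.
  apply: odd_or2 => /even_gt2[n_gt2 n_even]; apply: (not_2BCI Q n_gt2 n_even) => S S2.
  by apply: bci; apply: leq_trans S2 m2.
- by move=> dci S S1 _; apply: dci.
- move=> ci; apply: odd_or2 => /even_gt2[n_gt2 n_even]; apply: (not_2CI Q n_gt2 n_even) => S S1 SV S2.
  by apply: ci => //; apply: leq_trans S2 m2.
move=> n_cond S Sm T iso; have S3 := leq_trans Sm m3.
case: n_cond => [n_odd | n2]; first exact: (bcay_iso_bequiv Q hn n_odd S3 iso).
by subst n; apply: (order8_bcay_iso_bequiv Q S3 iso).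
Qed.
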